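(* There is an absolute constant $C>0$ such that the following holds. Let $A$ be a real $m\times n$ matrix with full column rank ($m\ge n$), let $b\in\mathbb{R}^m$, let $x_*\in\mathbb{R}^n$ be the solution of the minimization problem $\min_{x}\|Ax-b\|_2^2$, and let $e:=Ax_*-b$. Let $1\le s<n$ be an integer, let $c>3$, and let $N$ be an integer with $64\,c\,m^2\log m\le N\le\exp\bigl((\sqrt n-\sqrt s)^2/16\bigr)$. Let $\mathcal{S}=\{S^{(1)},\dots,S^{(N)}\}$ be a set of $N$ independent $m\times s$ random matrices with i.i.d. standard normal entries. Then, with probability at least $1-1.1\,m^{3-c}-e^{-(\sqrt n-\sqrt s)^2/16}$ (over the choice of $\mathcal{S}$), for any initial estimate $x_0\in\mathbb{R}^n$, the finite block Gaussian Kaczmarz method with collection $\mathcal{S}$ produces a sequence of iterates $\{x_k,\ k\ge 0\}$ that satisfies, for every $k\ge 0$, $$\mathbb{E}\|x_k-x_*\|_2^2\le\left(1-\frac{s}{36\,m\,\kappa^2(A)}\right)^k\|x_0-x_*\|_2^2+\frac{C\,m\,\kappa^2(A)}{\sigma_{\min}^2(A)}\cdot\frac{\|e\|_2^2}{(\sqrt n-\sqrt s)^2}.$$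
   Context: $\sigma_{\min}(A),\sigma_{\max}(A)$ are the smallest and largest singular values of $A$ and $\kappa^2(A)=\sigma_{\max}^2(A)/\sigma_{\min}^2(A)$. $\log$ is the natural logarithm. $M^\dagger$ denotes the Moore-Penrose inverse of a matrix $M$. Finite block Gaussian Kaczmarz method with collection $\mathcal{S}$: starting from $x_0\in\mathbb{R}^n$, at each iteration a matrix $S$ is chosen uniformly at random from $\mathcal{S}$, with replacement (i.e. independently of the choices at previous iterations), and $$x_{k+1}=\bigl(\mathrm{Id}-(S^TA)^\dagger S^TA\bigr)x_k+(S^TA)^\dagger S^Tb .$$ For a given $\mathcal{S}$, the expectation $\mathbb{E}$ is over the random choices of the matrices from $\mathcal{S}$ during the iterations. *)

(* Defs.v *)
From HB Require Import structures.
From mathcomp Require Import all_boot all_order all_algebra.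
From mathcomp Require Import all_classical all_reals all_analysis.

Set Implicit Arguments.
Unset Strict Implicit.
Unset Printing Implicit Defensive.

Import Order.TTheory GRing.Theory Num.Theory.

Local Open Scope classical_set_scope.
Local Open Scope ring_scope.

(* The norm that MathComp-Analysis puts on matrices is the sup norm, hence a
   separate Euclidean norm. *)
Definition l2norm (R : realType) (n : nat) (x : 'cV[R]_n) : R :=
  Num.sqrt (\sum_(i < n) x i 0 ^+ 2).

(* Singular values as the nonnegative square roots of the eigenvalues of
   A^T A. This is the usual notion for n <= m, the only case in which it is
   used; for m < n it would add n - m spurious zeros. *)
Definition singular_value (R : realType) (m n : nat) (A : 'M[R]_(m, n)) :
  set R := [set sg | 0 <= sg /\ eigenvalue (A^T *m A) (sg ^+ 2)].

Definition sigma_min (R : realType) (m n : nat) (A : 'M[R]_(m, n)) : R :=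
  inf (singular_value A).

Definition sigma_max (R : realType) (m n : nat) (A : 'M[R]_(m, n)) : R :=
  sup (singular_value A).

Definition kappa2 (R : realType) (m n : nat) (A : 'M[R]_(m, n)) : R :=
  sigma_max A ^+ 2 / sigma_min A ^+ 2.

Definition moore_penrose (R : realType) (m n : nat) (M : 'M[R]_(m, n))
    (X : 'M[R]_(n, m)) : Prop :=
  [/\ M *m X *m M = M, X *m M *m X = X,
      (M *m X)^T = M *m X & (X *m M)^T = X *m M].

(* The default value 0 is never used: see pinvP. *)
Definition pinv (R : realType) (m n : nat) (M : 'M[R]_(m, n)) : 'M[R]_(n, m) :=
  xget 0 [set X | moore_penrose M X].

Lemma gram_unitmx (R : realType) (m r : nat) (C : 'M[R]_(m, r)) :
  \rank C = r -> C^T *m C \in unitmx.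
Proof.
move=> rC; rewrite -row_free_unit; apply/inj_row_free => v.
move=> /(congr1 (mulmx^~ v^T)); rewrite mul0mx mulmxA -(mulmxA (_ *m _)).
have -> : v *m C^T = (C *m v^T)^T by rewrite trmx_mul trmxK.
move=> /matrixP/(_ 0 0); rewrite mxE [RHS]mxE.
under eq_bigr do rewrite mxE -expr2.
move/eqP; rewrite psumr_eq0 => [/allP Cv0|i _]; last exact: sqr_ge0.
have {Cv0} Cv0 : C *m v^T = 0.
  apply/colP => i; rewrite [RHS]mxE; apply/eqP.
  by rewrite -sqrf_eq0; apply: (implyP (Cv0 i (mem_index_enum i))).
have fC : row_free C^T by rewrite /row_free mxrank_tr rC.
by apply: (row_free_inj fC); rewrite mul0mx -[v]trmxK -trmx_mul Cv0 trmx0.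
Qed.

Lemma pinvP (R : realType) (m n : nat) (M : 'M[R]_(m, n)) :
  moore_penrose M (pinv M).
Proof.
suff [X MX] : exists X, moore_penrose M X.
  exact: (@xgetPex _ 0 _ (ex_intro _ X MX)).
have [r [C [F [eM rC rF]]]] : exists r (C : 'M[R]_(m, r)) (F : 'M[R]_(r, n)),
    [/\ M = C *m F, \rank C = r & \rank F = r].
  exists (\rank M), (col_base M), (row_base M); split.
  - by rewrite mulmx_base.
  - by apply/eqP; rewrite -/(row_full _) col_base_full.
  - by apply/eqP; rewrite -/(row_free _) row_base_free.
have uC : C^T *m C \in unitmx by exact: gram_unitmx.
have uF : F *m F^T \in unitmx.
  by rewrite -[F in F *m _]trmxK; apply: gram_unitmx; rewrite mxrank_tr.
exists (F^T *m invmx (F *m F^T) *m (invmx (C^T *m C) *m C^T)).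
set X := _ *m _.
have MX : M *m X = C *m invmx (C^T *m C) *m C^T.
  by rewrite eM /X -!mulmxA (mulmxA F) (mulmxA (F *m _)) mulmxV // mul1mx.
have XM : X *m M = F^T *m invmx (F *m F^T) *m F.
  rewrite eM /X -!mulmxA (mulmxA C^T) (mulmxA (invmx (C^T *m _))).
  by rewrite mulVmx // mul1mx.
split.
- by rewrite MX eM -!mulmxA (mulmxA C^T) (mulmxA (invmx _)) mulVmx // mul1mx.
- rewrite XM /X -!mulmxA (mulmxA F) (mulmxA (F *m F^T)) mulmxV //.
  by rewrite mul1mx.
- by rewrite MX !trmx_mul trmx_inv trmx_mul !trmxK mulmxA.
- by rewrite XM !trmx_mul trmx_inv trmx_mul !trmxK mulmxA.
Qed.

Definition least_squares_sol (R : realType) (m n : nat) (A : 'M[R]_(m, n))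
    (b : 'cV[R]_m) (xs : 'cV[R]_n) : Prop :=
  forall x : 'cV[R]_n,
    l2norm (A *m xs - b) ^+ 2 <= l2norm (A *m x - b) ^+ 2.

Definition kaczmarz_step (R : realType) (m n s : nat) (A : 'M[R]_(m, n))
    (b : 'cV[R]_m) (S : 'M[R]_(m, s)) (x : 'cV[R]_n) : 'cV[R]_n :=
  (1%:M - pinv (S^T *m A) *m (S^T *m A)) *m x
  + pinv (S^T *m A) *m (S^T *m b).

(* The k-th iterate when entry j of t is the index, in the collection S, of the
   matrix chosen at iteration j. *)
Definition kaczmarz_iter (R : realType) (m n s N k : nat) (A : 'M[R]_(m, n))
    (b : 'cV[R]_m) (S : 'I_N -> 'M[R]_(m, s)) (x0 : 'cV[R]_n)
    (t : k.-tuple 'I_N) : 'cV[R]_n :=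
  foldl (fun x l => kaczmarz_step A b (S l) x) x0 t.

(* k independent uniform choices in 'I_N are a uniform choice among the N ^ k
   tuples of indices; this is the expectation of f under that law. *)
Definition expect_choices (R : realType) (N k : nat)
    (f : k.-tuple 'I_N -> R) : R :=
  (\sum_(t : k.-tuple 'I_N) f t) / (N ^ k)%:R.

Definition mutual_independence (d : measure_display) (T : measurableType d)
    (R : realType) (P : probability T R) (I : finType)
    (X : I -> {RV P >-> R}) : Prop :=
  forall (J : {set I}) (B : I -> set R), (forall i, measurable (B i)) ->
    P (\bigcap_(i in [set` J]) (X i @^-1` B i)) =
    (\prod_(i in J) P (X i @^-1` B i))%E.

(* normal_prob takes the mean and the standard deviation. *)
Definition standard_normal (d : measure_display) (T : measurableType d)
    (R : realType) (P : probability T R) (X : {RV P >-> R}) : Prop :=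
  forall B : set R, measurable B -> distribution P X B = normal_prob 0 1 B.

(* G (l, i, j) is entry (i, j) of the l-th random matrix. Independence of the
   N matrices and of the entries within each of them amounts to independence
   of the whole family. *)
Definition gaussian_entries (d : measure_display) (T : measurableType d)
    (R : realType) (P : probability T R) (N m s : nat)
    (G : 'I_N * 'I_m * 'I_s -> {RV P >-> R}) : Prop :=
  mutual_independence G /\ forall p, standard_normal (G p).

Definition gaussian_collection (d : measure_display) (T : measurableType d)
    (R : realType) (P : probability T R) (N m s : nat)
    (G : 'I_N * 'I_m * 'I_s -> {RV P >-> R}) (w : T) (l : 'I_N) :
  'M[R]_(m, s) := \matrix_(i < m, j < s) G (l, i, j) w.

(* The good event need not be known to be measurable, so the bound is on a
   measurable event on which Q holds. *)
Definition with_prob_at_least (d : measure_display) (T : measurableType d)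
    (R : realType) (P : probability T R) (p : R) (Q : T -> Prop) : Prop :=
  exists E : set T,
    [/\ measurable E, (p%:E <= P E)%E & forall w, E w -> Q w].

(* Main.v *)
Require Import Defs.
From HB Require Import structures.
From mathcomp Require Import all_boot all_order all_algebra.
From mathcomp Require Import all_classical all_reals all_analysis.
From mathcomp Require Import measurable_realfun zify ring lra.

Set Implicit Arguments.
Unset Strict Implicit.
Unset Printing Implicit Defensive.

Import Order.TTheory GRing.Theory Num.Theory.

Local Open Scope classical_set_scope.
Local Open Scope ring_scope.

(** As S^T b = S^T A xs - S^T e, the error of one step splits orthogonally: with
M = S^T A and P = M^+ M the orthogonal projection onto the row space of M,
  x' - xs = (1 - P) (x - xs) - M^+ S^T e,   M^+ S^T e being in the range of P
(kaczmarz_err).  Two bounds on averages over the collection therefore suffice: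
a lower bound on the mean of |P_l v|^2 and an upper bound nu on the mean of
|M_l^+ S_l^T e|^2.  The mean error then satisfies a recursion r <- (1-q) r + nu,
whose fixed point nu / q is the horizon (expect_choices_bound).

Contraction.  Cauchy-Schwarz gives |P v|^2 >= z^T Pi z / sigma_max^2 with
z = A v and Pi = S (S^T S + eta)^-1 S^T, a ridge version of the projection onto
the column space of S that no longer involves A (proj_ge).  The law of S is
invariant under a quarter turn of two rows, so the off-diagonal entries of Pi
have mean zero and the diagonal entries share one mean, close to s/m because
tr Pi = s - eta tr (S^T S + eta)^-1; from 0 <= Pi <= 1 the off-diagonal
variance is at most s/(m(m-1)).  Exponential moments show that with high
probability the average of the Pi_l has diagonal entries at least 9/20 s/m and
off-diagonal entries at most 2/5 s/(m(m-1)), and Gershgorin's theorem bounds its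
smallest eigenvalue from below (avg_ridge_proj).

Noise.  With H = M M^T + eta, the noise is at most 2 h^T H^-1 h, where
h = S^T e, as soon as tr H^-1 is bounded (pinv_noise).  That trace is controlled
through 1/(H^-1)_jj, which dominates the squared distance of the j-th column of
B = A^T S to the span of the other columns (inv_ridge_le): it stochastically
dominates sigma_min^2 times a chi-square variable with at least
n - s + 1 >= (sqrt n - sqrt s)^2 degrees of freedom, and its lower tail is
read off the formula
  E exp(- x^T K x / 2) = det(1 + K)^(-1/2)
(EX_quad, EX_lower_tail).  Since A^T e = 0, rotating e onto a coordinate axis
makes h depend on a row of S that B does not see: h is Gaussian and independent
of B, and the same formula together with det(1 - Q) >= 1 - tr Q bounds the
exponential moment of h^T H^-1 h (EX_noise).

Each of these events fails only if an exponential, normalised to be at least 1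
on the failure, is at least 1.  One Markov inequality for the sum of all of them
gives the probability (markov_lt, failure_bound). *)

(** * Positive definite matrices over a real field *)

Section Dot.
Variable R : realFieldType.

Definition dot (n : nat) (u v : 'cV[R]_n) : R := (u^T *m v) 0 0.

Lemma dotE n (u v : 'cV[R]_n) : dot u v = \sum_i u i 0 * v i 0.
Proof. by rewrite /dot mxE; apply: eq_bigr => i _; rewrite mxE. Qed.

Lemma dotC n (u v : 'cV[R]_n) : dot u v = dot v u.
Proof. by rewrite !dotE; apply: eq_bigr => i _; rewrite mulrC. Qed.

Lemma dotDl n (u v w : 'cV[R]_n) : dot (u + v) w = dot u w + dot v w.
Proof. by rewrite /dot linearD mulmxDl mxE. Qed.

Lemma dotDr n (u v w : 'cV[R]_n) : dot w (u + v) = dot w u + dot w v.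
Proof. by rewrite /dot mulmxDr mxE. Qed.

Lemma dotZl n a (u w : 'cV[R]_n) : dot (a *: u) w = a * dot u w.
Proof. by rewrite /dot linearZ -scalemxAl mxE. Qed.

Lemma dotZr n a (u w : 'cV[R]_n) : dot w (a *: u) = a * dot w u.
Proof. by rewrite /dot -scalemxAr mxE. Qed.

Lemma dotNl n (u w : 'cV[R]_n) : dot (- u) w = - dot u w.
Proof. by rewrite -scaleN1r dotZl mulN1r. Qed.

Lemma dotNr n (u w : 'cV[R]_n) : dot w (- u) = - dot w u.
Proof. by rewrite -scaleN1r dotZr mulN1r. Qed.

Lemma dotBl n (u v w : 'cV[R]_n) : dot (u - v) w = dot u w - dot v w.
Proof. by rewrite dotDl dotNl. Qed.

Lemma dotBr n (u v w : 'cV[R]_n) : dot w (u - v) = dot w u - dot w v.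
Proof. by rewrite dotDr dotNr. Qed.

Lemma dot0l n (u : 'cV[R]_n) : dot 0 u = 0.
Proof. by rewrite /dot trmx0 mul0mx mxE. Qed.

Lemma dot_mull m n (M : 'M[R]_(m, n)) u v : dot (M *m u) v = dot u (M^T *m v).
Proof. by rewrite /dot trmx_mul mulmxA. Qed.

Lemma dot_mulr m n (M : 'M[R]_(m, n)) u v : dot v (M *m u) = dot (M^T *m v) u.
Proof. by rewrite dotC dot_mull dotC. Qed.

Lemma dot_ge0 n (u : 'cV[R]_n) : 0 <= dot u u.
Proof. by rewrite dotE sumr_ge0// => i _; rewrite -expr2 sqr_ge0. Qed.

Lemma dot_eq0 n (u : 'cV[R]_n) : (dot u u == 0) = (u == 0).
Proof.
apply/eqP/eqP => [|->]; last by rewrite dot0l.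
rewrite dotE => /eqP; rewrite psumr_eq0 => [/allP u0|i _]; last first.
  by rewrite -expr2 sqr_ge0.
apply/colP => i; rewrite mxE; apply/eqP.
by have := u0 i (mem_index_enum i); rewrite /= mulf_eq0 orbb.
Qed.

Lemma dot_gt0 n (u : 'cV[R]_n) : (0 < dot u u) = (u != 0).
Proof. by rewrite lt_def dot_ge0 andbT dot_eq0. Qed.

Lemma dot_delta n (u : 'cV[R]_n) i : dot (delta_mx i 0) u = u i 0.
Proof.
rewrite dotE (bigD1 i)//= mxE !eqxx mul1r big1 ?addr0// => j ji.
by rewrite mxE (negbTE ji) mul0r.
Qed.

Lemma qf_delta n (M : 'M[R]_n) i j : dot (delta_mx i 0) (M *m delta_mx j 0) = M i j.
Proof. by rewrite dot_delta -colE mxE. Qed.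

Definition psd n (M : 'M[R]_n) := M^T = M /\ forall x, 0 <= dot x (M *m x).
Definition pd n (M : 'M[R]_n) := M^T = M /\ forall x, x != 0 -> 0 < dot x (M *m x).

Lemma pd_psd n (M : 'M[R]_n) : pd M -> psd M.
Proof.
move=> [sM M0]; split=> // x; have [->|/M0/ltW//] := eqVneq x 0.
by rewrite dot0l.
Qed.

Lemma le_of_eq (a b : R) : a = b -> a <= b. Proof. by move=> ->. Qed.

(** The degenerate cases matter: c = 0 occurs for singular forms in the
Cauchy-Schwarz inequality, and a = 0 in the normal equations. *)
Lemma discriminant_le (a b c : R) :
  (forall t, 0 <= a + t * b *+ 2 + t ^+ 2 * c) -> b ^+ 2 <= a * c.
Proof.
move=> h.
have [c0|c0] := ltrP 0 c.
  have := h (- (b / c)).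
  have -> : a + - (b / c) * b *+ 2 + (- (b / c)) ^+ 2 * c = (a * c - b ^+ 2) / c.
    by field; rewrite gt_eqF.
  by rewrite pmulr_lge0 ?invr_gt0// subr_ge0.
have [b0|b0] := eqVneq b 0.
  have h0 : 0 <= a by have := h 0; rewrite !mul0r mul0rn addr0 expr0n/= mul0r addr0.
  rewrite b0 expr0n/=.
  have [->|c1] := eqVneq c 0; first by rewrite mulr0.
  exfalso; have c2 : c < 0 by rewrite lt_def eq_sym c1.
  have := h ((a + 1) / (- c) + 1); rewrite b0 mulr0 mul0rn addr0.
  set s := (a + 1) / - c.
  have s0 : 0 <= s by rewrite /s divr_ge0//; lra.
  have sc : s * c = - (a + 1) by rewrite /s; field.
  suff : a + (s + 1) ^+ 2 * c < 0 by move=> /lt_geF ->.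
  have -> : (s + 1) ^+ 2 * c = s * (s * c) + 2 * (s * c) + c by ring.
  rewrite sc; nra.
exfalso.
have := h (- (a + 1) / b).
suff : a + - (a + 1) / b * b *+ 2 + (- (a + 1) / b) ^+ 2 * c < 0.
  by move=> /lt_geF ->.
rewrite divfK//.
have : (- (a + 1) / b) ^+ 2 * c <= 0 by rewrite mulr_ge0_le0// sqr_ge0.
have h0 := h 0; rewrite !mul0r mul0rn addr0 expr0n/= mul0r addr0 in h0.
by lra.
Qed.

Lemma psd_CS n (M : 'M[R]_n) (u v : 'cV[R]_n) : psd M ->
  dot u (M *m v) ^+ 2 <= dot u (M *m u) * dot v (M *m v).
Proof.
move=> [sM M0]; apply: discriminant_le => t.
have := M0 (u + t *: v).
rewrite mulmxDr -scalemxAr !(dotDl, dotDr, dotZl, dotZr).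
have -> : dot v (M *m u) = dot u (M *m v) by rewrite dot_mulr sM dotC.
by move=> h; apply: le_trans h _; apply: le_of_eq; ring.
Qed.

Lemma psd1 n : psd (1%:M : 'M[R]_n).
Proof. by split; [exact: trmx1|move=> x; rewrite mul1mx dot_ge0]. Qed.

Lemma dot_CS n (u v : 'cV[R]_n) : dot u v ^+ 2 <= dot u u * dot v v.
Proof. by have := psd_CS u v (psd1 n); rewrite !mul1mx. Qed.

Lemma psd_diag n (M : 'M[R]_n) i : psd M -> 0 <= M i i.
Proof. by move=> [_ /(_ (delta_mx i 0))]; rewrite qf_delta. Qed.

Lemma psd_entry n (M : 'M[R]_n) i j : psd M -> M i j ^+ 2 <= M i i * M j j.
Proof. by move=> /(psd_CS (delta_mx i 0) (delta_mx j 0)); rewrite !qf_delta. Qed.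

Lemma psd_tr_ge0 n (M : 'M[R]_n) : psd M -> 0 <= \tr M.
Proof. by move=> pM; rewrite sumr_ge0// => i _; exact: psd_diag. Qed.

(** M^2 <= (tr M) M: entry i of M x is a product for the form M, to which
Cauchy-Schwarz applies with the i-th basis vector, and the M i i add up to the
trace.  This replaces the operator norm, hence any spectral theory. *)
Lemma psd_sqr_le n (M : 'M[R]_n) x : psd M ->
  dot (M *m x) (M *m x) <= \tr M * dot x (M *m x).
Proof.
move=> pM; rewrite dotE /mxtrace mulr_suml; apply: ler_sum => i _.
by have := psd_CS (delta_mx i 0) x pM; rewrite dot_delta qf_delta expr2.
Qed.

Lemma psd_le_tr n (M : 'M[R]_n) x : psd M ->
  dot x (M *m x) <= \tr M * dot x x.
Proof.
move=> pM; have [q0|q0] := eqVneq (dot x (M *m x)) 0.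
  by rewrite q0 mulr_ge0 ?psd_tr_ge0 ?dot_ge0.
have qp : 0 < dot x (M *m x) by rewrite lt_def q0 pM.2.
rewrite -(ler_pM2r qp) -expr2 (le_trans (dot_CS _ _))//.
by rewrite [leRHS]mulrAC mulrC ler_wpM2r ?dot_ge0// psd_sqr_le.
Qed.

Definition schur_compl n (M : 'M[R]_(1 + n)) : 'M[R]_n :=
  drsubmx M - (M 0 0)^-1 *: (dlsubmx M *m ursubmx M).

Lemma ulsubmx00 n (M : 'M[R]_(1 + n)) : ulsubmx M = (M 0 0)%:M.
Proof.
by apply/matrixP => i j; rewrite !ord1 !mxE /= mulr1n; congr (M _ _); apply: val_inj.
Qed.

Lemma det_schur n (M : 'M[R]_(1 + n)) : M 0 0 != 0 ->
  \det M = M 0 0 * \det (schur_compl M).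
Proof.
move=> a0; set a := M 0 0 in a0 *.
have {1}-> : M = block_mx 1%:M 0 (a^-1 *: dlsubmx M) 1%:M *m
              block_mx a%:M (ursubmx M) 0 (schur_compl M).
  rewrite mulmx_block !mul1mx !mul0mx !addr0.
  rewrite -[LHS]submxK ulsubmx00; congr block_mx.
    by rewrite -scalemxAl mul_mx_scalar scalerA mulVf// scale1r.
  by rewrite /schur_compl -/a -scalemxAl addrC subrK.
by rewrite det_mulmx det_lblock det_ublock !det1 !mul1r det_scalar1.
Qed.

Lemma trmx_schur n (M : 'M[R]_(1 + n)) : M^T = M -> (schur_compl M)^T = schur_compl M.
Proof.
move=> sM; rewrite /schur_compl linearB/= linearZ/= trmx_mul.
by rewrite trmx_drsub trmx_ursub trmx_dlsub sM.
Qed.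

Lemma dot_col n (a c : 'cV[R]_1) (b d : 'cV[R]_n) :
  dot (col_mx a b) (col_mx c d) = a 0 0 * c 0 0 + dot b d.
Proof.
by rewrite /dot tr_col_mx mul_row_col mxE -![(_^T *m _) 0 0]/(dot _ _) {1}dotE big_ord1.
Qed.

(** Completing the square in the first coordinate.  It is used twice: for
determinants, and in the Gaussian integral over one coordinate. *)
Lemma qf_schur n (M : 'M[R]_(1 + n)) (x : R) (y : 'cV[R]_n) :
  M^T = M -> M 0 0 != 0 ->
  dot (col_mx x%:M y) (M *m col_mx x%:M y) =
  M 0 0 * (x + (ursubmx M *m y) 0 0 / M 0 0) ^+ 2 + dot y (schur_compl M *m y).
Proof.
move=> sM a0; set a := M 0 0 in a0 *.
have dlE : dlsubmx M = (ursubmx M)^T by rewrite trmx_ursub sM.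
rewrite -{1}[M]submxK mul_block_col dot_col ulsubmx00 -/a.
rewrite !mul_mx_scalar.
set u := (ursubmx M *m y) 0 0.
have e1 : dot y (dlsubmx M) = u.
  by rewrite dlE dotC /dot trmxK.
rewrite dotDr dotZr e1 /schur_compl mulmxBl dotBr -scalemxAl dotZr -mulmxA.
have -> : dot y (dlsubmx M *m (ursubmx M *m y)) = u ^+ 2.
  have -> : ursubmx M *m y = u%:M by apply/matrixP => i j; rewrite !ord1 [RHS]mxE mulr1n.
  by rewrite mul_mx_scalar dotZr e1 expr2.
rewrite !mxE/= !mulr1n -/a.
have -> : \sum_j ursubmx M 0 j * y j 0 = u by rewrite /u mxE.
by field.
Qed.

Lemma pd_diag n (M : 'M[R]_n) i : pd M -> 0 < M i i.
Proof.
move=> [_ /(_ (delta_mx i 0))]; rewrite qf_delta; apply.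
by apply/eqP => /matrixP/(_ i 0); rewrite !mxE !eqxx => /eqP; rewrite oner_eq0.
Qed.

Lemma col_mx_eq0_d n (x : R) (y : 'cV[R]_n) : y != 0 -> col_mx x%:M y != 0.
Proof. by apply: contra => /eqP; rewrite -col_mx0 => /eq_col_mx[_ ->]. Qed.

Lemma pd_schur n (M : 'M[R]_(1 + n)) : pd M -> pd (schur_compl M).
Proof.
move=> pM; have a0 : M 0 0 != 0 by rewrite gt_eqF// pd_diag.
split=> [|y y0]; first by rewrite trmx_schur//; case: pM.
have := pM.2 _ (col_mx_eq0_d (- ((ursubmx M *m y) 0 0 / M 0 0)) y0).
by rewrite qf_schur//; [rewrite addNr expr0n mulr0 add0r | case: pM].
Qed.

(** Monotonicity of the determinant by induction on the size: choosing the first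
coordinate so as to cancel the square for M' shows that the Schur complements
are again comparable. *)
Lemma det_pd_le n (M M' : 'M[R]_n) : pd M -> M'^T = M' ->
  (forall x, dot x (M *m x) <= dot x (M' *m x)) -> 0 < \det M <= \det M'.
Proof.
elim: n M M' => [|n IH] M M' pM sM' le; first by rewrite !det_mx00 ltr01 lexx.
have pM' : pd M'.
  by split=> // x x0; apply: lt_le_trans (le x); exact: pM.2.
have a0 := pd_diag (ord0 : 'I_(1 + n)) pM.
have a'0 := pd_diag (ord0 : 'I_(1 + n)) pM'.
have aa' : M ord0 ord0 <= M' ord0 ord0.
  by have := le (delta_mx ord0 0); rewrite !qf_delta.
have /andP[d0 dd'] : 0 < \det (schur_compl (M : 'M[R]_(1 + n))) <= \det (schur_compl (M' : 'M[R]_(1 + n))).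
  apply: IH.
  - exact: pd_schur.
  - exact: trmx_schur.
  - move=> y; have := le (col_mx (- ((ursubmx (M' : 'M[R]_(1 + n)) *m y) 0 0 / M' 0 0))%:M y).
    rewrite [leLHS]qf_schur ?[leRHS]qf_schur//; [|exact: lt0r_neq0|by case: pM|exact: lt0r_neq0].
    rewrite addNr expr0n mulr0 add0r; apply: le_trans.
    by rewrite lerDr mulr_ge0 ?sqr_ge0// ltW.
rewrite (@det_schur n M) ?lt0r_neq0// (@det_schur n M') ?lt0r_neq0//.
by rewrite mulr_gt0//= ler_pM// ltW.
Qed.

Lemma det_pd n (M : 'M[R]_n) : pd M -> 0 < \det M.
Proof. by move=> pM; case/andP: (det_pd_le pM pM.1 (fun x => lexx _)). Qed.

Lemma pd_unit n (M : 'M[R]_n) : pd M -> M \in unitmx.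
Proof. by move=> /det_pd; rewrite unitmxE unitfE => /lt0r_neq0. Qed.

(** For eigenvalues in [0, 1) this is prod (1 - l_i) >= 1 - sum l_i.  The
induction goes through the Schur complement, whose trace is controlled by the
inequality between an entry and the two diagonal entries. *)
Lemma det_1B_ge n (N : 'M[R]_n) : psd N -> \tr N < 1 -> 1 - \tr N <= \det (1%:M - N).
Proof.
elim: n N => [|n IH] N pN t1.
  by rewrite det_mx00 /mxtrace big_ord0 subr0.
rewrite -[n.+1]/(1 + n)%N in N pN t1 *.
set M : 'M[R]_(1 + n) := 1%:M - N.
have trE : \tr N = N 0 0 + \tr (drsubmx N).
  rewrite {1}/mxtrace big_ord_recl; congr (_ + _); apply: eq_bigr => i _.
  by rewrite !mxE; congr (N _ _); apply: val_inj.
have M00 : M 0 0 = 1 - N 0 0 by rewrite !mxE.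
have n00 := psd_diag (0 : 'I_(1 + n)) pN.
have pdr : psd (drsubmx N).
  split=> [|y]; first by rewrite trmx_drsub pN.1.
  have := pN.2 (col_mx 0 y); rewrite -{1}[N]submxK mul_block_col dot_col.
  by rewrite mxE mul0r add0r !mulmx0 add0r.
have tdr := psd_tr_ge0 pdr.
have a0 : 0 < M 0 0 by rewrite M00; lra.
set N' := drsubmx N + (M 0 0)^-1 *: (dlsubmx N *m (dlsubmx N)^T).
have SE : schur_compl M = 1%:M - N'.
  rewrite /schur_compl /N' opprD addrA; congr (_ - _); last first.
    congr (_ *: _); rewrite trmx_dlsub pN.1.
    have -> : dlsubmx M = - dlsubmx N.
      by apply/matrixP => i j; rewrite !mxE eq_rlshift sub0r.
    have -> : ursubmx M = - ursubmx N.
      by apply/matrixP => i j; rewrite !mxE eq_lrshift sub0r.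
    by rewrite mulmxN mulNmx opprK.
  apply/matrixP => i j; by rewrite !mxE; congr (_ %:R - _).
have pN' : psd N'.
  split=> [|y].
    by rewrite linearD/= linearZ/= trmx_mul trmxK pdr.1.
  rewrite mulmxDl dotDr addr_ge0//; first exact: pdr.2.
  rewrite -scalemxAl dotZr; apply: mulr_ge0; first by rewrite invr_ge0 ltW.
  by rewrite -mulmxA dot_mulr dot_ge0.
(* The first column without its head has squared norm at most N 0 0 times the
   trace of the lower block: psd_entry, summed. *)
have v2 : \tr (dlsubmx N *m (dlsubmx N)^T) <= N 0 0 * \tr (drsubmx N).
  rewrite /mxtrace mulr_sumr; apply: ler_sum => i _.
  rewrite mxE big_ord1 [_^T _ _]mxE -expr2 mulrC.
  apply: le_trans (_ : N (rshift 1 i) (lshift n 0) ^+ 2 <= _).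
    by rewrite mxE mxE.
  rewrite (le_trans (psd_entry _ _ pN))//.
  rewrite !mxE le_eqVlt; apply/orP; left; apply/eqP.
  by congr (_ * N _ _); apply: val_inj.
have v20 : 0 <= \tr (dlsubmx N *m (dlsubmx N)^T).
  apply: psd_tr_ge0; split=> [|y]; first by rewrite trmx_mul trmxK.
  by rewrite -mulmxA dot_mulr dot_ge0.
have trN' : M 0 0 * (1 - \tr N') = M 0 0 - M 0 0 * \tr (drsubmx N) - \tr (dlsubmx N *m (dlsubmx N)^T).
  rewrite /N' mxtraceD mxtraceZ; field; exact: lt0r_neq0.
have key : 1 - \tr N <= M 0 0 * (1 - \tr N').
  by rewrite trN' trE M00; nra.
have t1' : \tr N' < 1.
  rewrite -subr_gt0 -(pmulr_rgt0 _ a0); apply: lt_le_trans key; lra.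
rewrite -/M (@det_schur n M) ?lt0r_neq0//.
apply: le_trans key _; rewrite ler_pM2l// SE; exact: IH.
Qed.

(** Two triangular eliminations of the block matrix (1, -A; B, 1). *)
Lemma det_1D_mulC m n (A : 'M[R]_(m, n)) (B : 'M[R]_(n, m)) :
  \det (1%:M + A *m B) = \det (1%:M + B *m A).
Proof.
pose X := block_mx 1%:M (- A) B (1%:M : 'M[R]_n).
have e1 : X *m block_mx 1%:M A 0 1%:M = block_mx 1%:M 0 B (1%:M + B *m A).
  by rewrite mulmx_block !mulmx1 !mul1mx !mulmx0 !addr0 addrN addrC.
have e2 : X *m block_mx 1%:M 0 (- B) 1%:M = block_mx (1%:M + A *m B) (- A) 0 1%:M.
  by rewrite mulmx_block !mulmx1 !mul1mx !mulmx0 !add0r mulNmx mulmxN opprK addrN.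
have := congr1 determinant e1; have := congr1 determinant e2.
rewrite !det_mulmx !det_lblock !det_ublock !det1 !mulr1 !mul1r.
by move=> -> ->.
Qed.

End Dot.

(** * Row-space projections and ridge inverses *)

Section RowProj.
Variable R : realFieldType.

Lemma pd_gram k n (F : 'M[R]_(k, n)) : row_free F -> pd (F *m F^T).
Proof.
move=> fF; split=> [|x x0]; first by rewrite trmx_mul trmxK.
rewrite -mulmxA dot_mulr dot_gt0; apply: contra x0 => /eqP Fx.
rewrite -[x]trmxK -trmx0 (inj_eq (@trmx_inj _ _ _)).
apply/eqP; apply: (row_free_inj fF); rewrite mul0mx.
by rewrite -[F]trmxK -trmx_mul Fx trmx0.
Qed.

Definition rowproj k n (F : 'M[R]_(k, n)) : 'M[R]_n :=
  F^T *m invmx (F *m F^T) *m F.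

Lemma trmx_rowproj k n (F : 'M[R]_(k, n)) : (rowproj F)^T = rowproj F.
Proof. by rewrite /rowproj !trmx_mul trmx_inv trmx_mul !trmxK mulmxA. Qed.

Lemma rowproj_idem k n (F : 'M[R]_(k, n)) : row_free F ->
  rowproj F *m rowproj F = rowproj F.
Proof.
move=> /pd_gram/pd_unit uF; rewrite /rowproj -!mulmxA.
by rewrite (mulmxA F) (mulmxA _ (F *m F^T)) mulVmx// mul1mx.
Qed.

Lemma qf_rowproj k n (F : 'M[R]_(k, n)) x : row_free F ->
  dot x (rowproj F *m x) = dot (rowproj F *m x) (rowproj F *m x).
Proof. by move=> fF; rewrite dot_mull trmx_rowproj mulmxA rowproj_idem. Qed.

Lemma rowproj_le k n (F : 'M[R]_(k, n)) x : row_free F ->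
  dot x (rowproj F *m x) <= dot x x.
Proof.
move=> fF; rewrite -subr_ge0.
have := dot_ge0 (x - rowproj F *m x).
rewrite dotBl !dotBr [dot (rowproj F *m x) x]dotC (qf_rowproj _ fF).
by set a := dot x x; set b := dot _ _; move=> h; apply: le_trans h _; lra.
Qed.

Lemma pd_1D m n k (F : 'M[R]_(k, n)) (A : 'M[R]_(m, n)) (t : R) :
  row_free F -> 0 <= t -> pd (1%:M + t *: (A *m rowproj F *m A^T)).
Proof.
move=> fF t0; split.
  by rewrite linearD/= linearZ/= trmx1 2!trmx_mul trmxK trmx_rowproj mulmxA.
move=> x x0; rewrite mulmxDl mul1mx dotDr -scalemxAl dotZr.
rewrite ltr_wpDr ?dot_gt0// mulr_ge0//.
rewrite -(mulmxA (A *m _)) -(mulmxA A) dot_mulr qf_rowproj//.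
exact: dot_ge0.
Qed.

(** This is the determinant in the lower tail: if A stretches by at least
sqrt sg, then A Q A^T has at least k eigenvalues above sg, where Q is the
projection onto a space of dimension k.  Commuting the factors reduces it to a
comparison of k x k Gram matrices. *)
Lemma det_rowproj_ge m n k (F : 'M[R]_(k, n)) (A : 'M[R]_(m, n)) (sg t : R) :
  row_free F -> 0 < sg -> 0 <= t ->
  (forall v, sg * dot v v <= dot (A *m v) (A *m v)) ->
  (1 + t) ^+ k <= \det (1%:M + (t / sg) *: (A *m rowproj F *m A^T)).
Proof.
move=> fF sg0 t0 Asg; set X := F *m F^T.
have pX : pd X := pd_gram fF; have uX := pd_unit pX.
have -> : (t / sg) *: (A *m rowproj F *m A^T) =
    ((t / sg) *: (A *m F^T *m invmx X)) *m (F *m A^T).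
  by rewrite -scalemxAl /rowproj !mulmxA.
rewrite det_1D_mulC.
set Y := (t / sg) *: (F *m A^T *m A *m F^T).
have -> : 1%:M + F *m A^T *m (t / sg *: (A *m F^T *m invmx X)) =
    (X + Y) *m invmx X.
  rewrite mulmxDl mulmxV//; congr (_ + _).
  by rewrite /Y -scalemxAr -scalemxAl !mulmxA.
rewrite det_mulmx det_inv ler_pdivlMr ?det_pd// -detZ.
have pZ : pd ((1 + t) *: X).
  split; first by rewrite linearZ/= pX.1.
  by move=> x x0; rewrite -scalemxAl dotZr mulr_gt0 ?pX.2//; lra.
suff /andP[_ ->//] : 0 < \det ((1 + t) *: X) <= \det (X + Y).
apply: det_pd_le => //.
  by rewrite linearD/= linearZ/= pX.1 !trmx_mul !trmxK !mulmxA.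
move=> x; rewrite -scalemxAl dotZr mulmxDl dotDr mulrDl mul1r lerD2l.
have e1 : dot x (X *m x) = dot (F^T *m x) (F^T *m x).
  by rewrite /X -mulmxA dot_mulr.
have e2 : dot x (F *m A^T *m A *m F^T *m x) = dot (A *m (F^T *m x)) (A *m (F^T *m x)).
  by rewrite -!mulmxA [RHS]dot_mull dot_mull trmxK.
rewrite /Y -scalemxAl dotZr e1 e2 mulrAC ler_pdivlMr// -mulrA ler_wpM2l//.
by rewrite mulrC.
Qed.

Lemma pd_ridge n s (B : 'M[R]_(n, s)) (eta : R) : 0 < eta ->
  pd (B^T *m B + eta%:M).
Proof.
move=> e0; split=> [|x x0]; first by rewrite linearD/= trmx_mul trmxK tr_scalar_mx.
rewrite mulmxDl dotDr mul_scalar_mx dotZr ltr_wpDl//.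
  by rewrite -mulmxA dot_mulr trmxK dot_ge0.
by rewrite mulr_gt0// dot_gt0.
Qed.

Lemma pd_inv n (H : 'M[R]_n) : pd H -> pd (invmx H).
Proof.
move=> pH; have uH := pd_unit pH; split=> [|x x0]; first by rewrite trmx_inv pH.1.
have -> : dot x (invmx H *m x) = dot (invmx H *m x) (H *m (invmx H *m x)).
  by rewrite mulmxA mulmxV// mul1mx dotC.
apply: pH.2; apply: contra x0 => /eqP Hx.
by rewrite -[x]mul1mx -(mulmxV uH) -mulmxA Hx mulmx0.
Qed.

(** The inverse of a diagonal entry of (B^T B)^-1 is the squared distance of
column j to the span of the others, and a ridge only increases it.  The distance
is bounded below by the projection onto the row space of any F that kills the
other columns. *)
Lemma inv_ridge_le n s k (B : 'M[R]_(n, s)) (eta : R) (j : 'I_s) (F : 'M[R]_(k, n)) :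
  0 < eta -> row_free F -> (forall i, i != j -> F *m col i B = 0) ->
  invmx (B^T *m B + eta%:M) j j * dot (col j B) (rowproj F *m col j B) <= 1.
Proof.
move=> e0 fF Fi; set H := _ + _; have pH : pd H := pd_ridge B e0.
have uH := pd_unit pH.
pose y : 'cV_s := invmx H *m delta_mx j 0.
have yj : y j 0 = invmx H j j by rewrite /y -colE mxE.
have yj0 : 0 < y j 0 by rewrite yj; apply: pd_diag; exact: pd_inv.
have Hy : H *m y = delta_mx j 0 by rewrite /y mulmxA mulmxV// mul1mx.
(* Only column j survives F, so the projection of B y is y j times that of
   column j; on the other side |B y|^2 <= y^T H y = y j. *)
have FB : F *m (B *m y) = y j 0 *: (F *m col j B).
  have -> : B *m y = \sum_i y i 0 *: col i B.
    apply/colP => i; rewrite mxE summxE; apply: eq_bigr => l _.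
    by rewrite !mxE mulrC.
  rewrite mulmx_sumr (bigD1 j)//= big1 ?addr0 -?scalemxAr// => i ij.
  by rewrite -scalemxAr Fi// scaler0.
have q1 : dot (B *m y) (rowproj F *m (B *m y)) =
    y j 0 ^+ 2 * dot (col j B) (rowproj F *m col j B).
  rewrite !qf_rowproj// /rowproj -!mulmxA FB -!scalemxAr dotZl dotZr; ring.
have q2 : dot (B *m y) (B *m y) <= y j 0.
  rewrite -[leRHS]dot_delta -Hy dotC /H mulmxDl dotDr -[in leRHS]mulmxA.
  rewrite [in leRHS]dot_mulr trmxK lerDl mul_scalar_mx dotZr.
  by rewrite mulr_ge0 ?dot_ge0// ltW.
have := le_trans (rowproj_le (B *m y) fF) q2.
by rewrite q1 expr2 -mulrA -{3}[y j 0]mulr1 ler_pM2l// yj.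
Qed.

Lemma exists_complement n s (B : 'M[R]_(n, s)) (j : 'I_s) :
  exists k (F : 'M[R]_(k, n)), [/\ row_free F, (n < k + s)%N
    & forall i, i != j -> F *m col i B = 0].
Proof.
case: s B j => [|s] B j; first by case: j.
pose K := kermx (col' j B).
exists (\rank K), (row_base K); split.
- exact: row_base_free.
- rewrite mxrank_ker.
  have := rank_leq_col (col' j B); have := rank_leq_row (col' j B).
  rewrite /=; lia.
- move=> i ij; have [i' ->] : exists i', i = lift j i'.
    by case: (unliftP j i) ij => [i' ->|->]; [exists i'|rewrite eqxx].
  have -> : col (lift j i') B = col i' (col' j B).
    by apply/colP => l; rewrite !mxE.
  rewrite colE mulmxA.
  have /sub_kermxP -> : (row_base K <= kermx (col' j B))%MS by rewrite eq_row_base.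
  by rewrite mul0mx.
Qed.

(** For eta -> 0 this tends to the orthogonal projection onto the column space of
S; a positive eta keeps it a rational, hence measurable, function of S. *)
Definition ridge_proj m s (eta : R) (S : 'M[R]_(m, s)) : 'M[R]_m :=
  S *m invmx (S^T *m S + eta%:M) *m S^T.

Lemma trmx_ridge_proj m s (eta : R) (S : 'M[R]_(m, s)) : 0 < eta ->
  (ridge_proj eta S)^T = ridge_proj eta S.
Proof.
move=> e0; rewrite /ridge_proj !trmx_mul trmxK (pd_inv (pd_ridge S e0)).1.
by rewrite mulmxA.
Qed.

(** Pi - Pi^2 = eta W^T W with W = (S^T S + eta)^-1 S^T. *)
Lemma ridge_proj_sqr m s (eta : R) (S : 'M[R]_(m, s)) z : 0 < eta ->
  dot (ridge_proj eta S *m z) (ridge_proj eta S *m z) <= dot z (ridge_proj eta S *m z).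
Proof.
move=> e0; rewrite [leLHS]dot_mull trmx_ridge_proj// -subr_ge0 -dotBr mulmxA -mulmxBl.
set H := S^T *m S + eta%:M; have pH := pd_ridge S e0; have uH := pd_unit pH.
have -> : ridge_proj eta S - ridge_proj eta S *m ridge_proj eta S =
   eta *: ((invmx H *m S^T)^T *m (invmx H *m S^T)).
  have -> : ridge_proj eta S *m ridge_proj eta S =
    S *m invmx H *m (S^T *m S) *m invmx H *m S^T by rewrite /ridge_proj -/H !mulmxA.
  have -> : S^T *m S = H - eta%:M by rewrite /H addrK.
  rewrite mulmxBr mulmxKV// !mulmxBl opprB addrC subrK.
  rewrite trmx_mul trmxK (pd_inv pH).1 mul_mx_scalar -!scalemxAl.
  by rewrite !mulmxA.
set W := invmx H *m S^T.
rewrite -scalemxAl dotZr mulr_ge0 ?(ltW e0)//.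
by rewrite -mulmxA dot_mulr trmxK dot_ge0.
Qed.

Lemma psd_ridge_proj m s (eta : R) (S : 'M[R]_(m, s)) : 0 < eta -> psd (ridge_proj eta S).
Proof.
move=> e0; split; first exact: trmx_ridge_proj.
by move=> x; apply: le_trans (dot_ge0 _) (ridge_proj_sqr S x e0).
Qed.

Lemma ridge_proj_diag_le1 m s (eta : R) (S : 'M[R]_(m, s)) i : 0 < eta ->
  ridge_proj eta S i i <= 1.
Proof.
move=> e0; have := ridge_proj_sqr S (delta_mx i 0) e0; rewrite qf_delta dotE.
have r0 := psd_diag i (psd_ridge_proj S e0).
rewrite (bigD1 i)//= -colE mxE => /(le_trans _) h.
have := h (ridge_proj eta S i i * ridge_proj eta S i i) _.
rewrite lerDl sumr_ge0 => [/(_ isT)|l _]; last by rewrite -expr2 sqr_ge0.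
have [-> //|ri] := eqVneq (ridge_proj eta S i i) 0.
have r1 : 0 < ridge_proj eta S i i by rewrite lt_def ri.
by move=> h2; rewrite -(ler_pM2l r1) mulr1.
Qed.

Lemma ridge_proj_row_sqr m s (eta : R) (S : 'M[R]_(m, s)) i : 0 < eta ->
  \sum_j ridge_proj eta S i j ^+ 2 <= ridge_proj eta S i i.
Proof.
move=> e0; have := ridge_proj_sqr S (delta_mx i 0) e0; rewrite qf_delta dotE.
apply: le_trans; rewrite le_eqVlt; apply/orP; left; apply/eqP.
apply: eq_bigr => j _; rewrite -{1}(trmx_ridge_proj S e0) [X in X ^+ 2 = _]mxE.
by rewrite -colE [col _ _ _ _]mxE expr2.
Qed.

Lemma ridge_proj_entry_le1 m s (eta : R) (S : 'M[R]_(m, s)) i j : 0 < eta ->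
  `|ridge_proj eta S i j| <= 1.
Proof.
move=> e0; rewrite -(@ler_pXn2r _ 2) ?nnegrE// expr1n real_normK ?num_real//.
apply: le_trans (ridge_proj_diag_le1 S i e0); apply: le_trans (ridge_proj_row_sqr S i e0).
by rewrite (bigD1 j)//= lerDl sumr_ge0// => l _; rewrite sqr_ge0.
Qed.

(** The trace of Pi falls short of s only by the trace of the ridge inverse, so a
lower-tail estimate for the latter gives the mean of the diagonal of Pi. *)
Lemma tr_ridge_proj m s (eta : R) (S : 'M[R]_(m, s)) : 0 < eta ->
  \tr (ridge_proj eta S) + eta * \tr (invmx (S^T *m S + eta%:M)) = s%:R.
Proof.
move=> e0; set H := S^T *m S + eta%:M.
have uH := pd_unit (pd_ridge S e0).
rewrite /ridge_proj -/H -mulmxA mxtrace_mulC -mulmxA -mxtraceZ -mxtraceD.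
have -> : S^T *m S = H - eta%:M by rewrite /H addrK.
by rewrite mulmxBr mulVmx// mul_mx_scalar subrK mxtrace1.
Qed.

(** A bound on the trace of (G + eta)^-1 bounds G from below; when that bound is at
least twice the ridge, G itself is invertible and the ridge costs a factor 2. *)
Section RemoveReg.
Variables (s : nat) (G : 'M[R]_s) (eta tau : R).
Hypotheses (pG : psd G) (e0 : 0 < eta) (trtau : \tr (invmx (G + eta%:M)) <= tau)
  (et : 2 * eta * tau <= 1).

Lemma pd_ridge_add : pd (G + eta%:M).
Proof.
split=> [|x x0]; first by rewrite linearD/= pG.1 tr_scalar_mx.
rewrite mulmxDl dotDr mul_scalar_mx dotZr ltr_wpDl ?pG.2//.
by rewrite mulr_gt0// dot_gt0.
Qed.

Lemma ridge_add_ge x : 2 * eta * dot x x <= dot x ((G + eta%:M) *m x).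
Proof.
have pH := pd_ridge_add; have uH := pd_unit pH; have pHi := pd_inv pH.
set H := G + eta%:M in pH uH pHi *.
have [->|x0] := eqVneq x 0; first by rewrite !dot0l mulr0.
have := psd_sqr_le (H *m x) (pd_psd pHi).
rewrite mulmxA mulVmx// mul1mx [X in _ <= _ * X]dotC => h1.
have h2 : dot x x <= tau * dot x (H *m x).
  by apply: le_trans h1 _; rewrite ler_wpM2r// ltW// pH.2.
apply: le_trans (_ : 2 * eta * (tau * dot x (H *m x)) <= _).
  by rewrite ler_wpM2l// mulr_ge0// ltW.
by rewrite mulrA ger_pMl ?pH.2.
Qed.

Lemma pd_of_ridge : pd G.
Proof.
split=> [|x x0]; first exact: pG.1.
have := ridge_add_ge x; rewrite mulmxDl dotDr mul_scalar_mx dotZr.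
have : 0 < eta * dot x x by rewrite mulr_gt0// dot_gt0.
lra.
Qed.

(** With h = G w the left-hand side is h^T G^-1 h, in a form free of inverses of G.
With H = G + eta, expand the form H at w - 2 H^-1 h and use H <= 2 G. *)
Lemma qf_inv_ridge_le (w : 'cV[R]_s) :
  dot w (G *m w) <= 2 * dot (G *m w) (invmx (G + eta%:M) *m (G *m w)).
Proof.
have pH := pd_ridge_add; have uH := pd_unit pH; have pHi := pd_inv pH.
set H := G + eta%:M in pH uH pHi *; set h := G *m w.
have wHw : dot w (H *m w) <= 2 * dot w (G *m w).
  have := ridge_add_ge w; rewrite mulmxDl dotDr mul_scalar_mx dotZr; lra.
have := (pd_psd pH).2 (w - 2 *: (invmx H *m h)).
rewrite mulmxBr -scalemxAr (mulmxA H (invmx H)) mulmxV// mul1mx.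
rewrite dotBl !dotBr !dotZl !dotZr.
have -> : dot (invmx H *m h) (H *m w) = dot w h.
  by rewrite dot_mull pHi.1 mulmxA mulVmx// mul1mx dotC.
rewrite [dot (invmx H *m h) h]dotC -/h.
by rewrite -/h in wHw; lra.
Qed.

End RemoveReg.

(** * Extremal eigenvalues and singular values *)

Lemma eigenvalueP_ker n (M : 'M[R]_n) (mu : R) :
  eigenvalue M mu = ((M - mu%:M) \notin unitmx).
Proof. by rewrite /eigenvalue /eigenspace kermx_eq0 row_free_unit. Qed.

Lemma eigenvalue_qf n (M : 'M[R]_n) mu : M^T = M -> eigenvalue M mu ->
  exists2 x : 'cV[R]_n, x != 0 & dot x (M *m x) = mu * dot x x.
Proof.
move=> sM /eigenvalueP[v vM v0]; exists v^T.
  by apply: contra v0 => /eqP v0; rewrite -[v]trmxK v0 trmx0.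
by rewrite -[X in dot _ (X *m _)]sM -trmx_mul vM linearZ/= dotZr.
Qed.

End RowProj.

Section Kaczmarz.
Variable R : realType.

Lemma l2norm_dot n (x : 'cV[R]_n) : l2norm x ^+ 2 = dot x x.
Proof.
rewrite /l2norm sqr_sqrtr; last by rewrite sumr_ge0// => i _; rewrite sqr_ge0.
by rewrite dotE; apply: eq_bigr => i _; rewrite expr2.
Qed.

(** The constant comes from the traces of M and of (M^-1)^T M^-1; no compactness
argument is needed. *)
Lemma psd_unit_lower n (M : 'M[R]_n) : psd M -> M \in unitmx ->
  exists2 dl, 0 < dl & forall x, dl * dot x x <= dot x (M *m x).
Proof.
move=> pM uM; pose K := (invmx M)^T *m invmx M.
have pK : psd K.
  split=> [|x]; first by rewrite trmx_mul trmxK.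
  by rewrite -mulmxA dot_mulr trmxK dot_ge0.
pose c := 1 + \tr K * \tr M.
have tK := psd_tr_ge0 pK; have tM := psd_tr_ge0 pM.
have c0 : 0 < c by rewrite ltr_pwDl// mulr_ge0.
exists c^-1; first by rewrite invr_gt0.
move=> x; rewrite ler_pdivrMl// /c mulrDl mul1r.
have h : dot x x <= \tr K * \tr M * dot x (M *m x).
  have := psd_le_tr (M *m x) pK.
  rewrite -mulmxA [X in X <= _]dot_mulr trmxK mulmxA mulVmx// mul1mx => /le_trans; apply.
  by rewrite -mulrA ler_wpM2l// psd_sqr_le.
by apply: le_trans h _; rewrite lerDr; exact: pM.2.
Qed.

(** mu is the infimum of the Rayleigh quotient.  Were M - mu invertible, it would
be bounded below by a positive multiple of the identity, and mu would not be the
infimum. *)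
Lemma min_eigenvalue n (M : 'M[R]_n) : (0 < n)%N -> psd M ->
  exists mu, eigenvalue M mu /\ forall x, mu * dot x x <= dot x (M *m x).
Proof.
move=> n0 pM.
pose Q := [set r : R | exists2 x : 'cV[R]_n, dot x x = 1 & r = dot x (M *m x)].
have Q0 : Q !=set0.
  exists (M (Ordinal n0) (Ordinal n0)); exists (delta_mx (Ordinal n0) 0).
    by rewrite dot_delta mxE !eqxx.
  by rewrite qf_delta.
have lb0 : lbound Q 0 by move=> _ [x _ ->]; exact: pM.2.
pose mu := inf Q.
have low c : (lbound Q c) -> forall x, c * dot x x <= dot x (M *m x).
  move=> lbc x; have [->|x0] := eqVneq x 0; first by rewrite !dot0l mulr0.
  have d0 : 0 < dot x x by rewrite dot_gt0.
  pose a := (Num.sqrt (dot x x))^-1.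
  have a2 : a * a = (dot x x)^-1 by rewrite -expr2 exprVn sqr_sqrtr// ltW.
  have : c <= dot (a *: x) (M *m (a *: x)).
    apply: lbc; exists (a *: x) => //.
    by rewrite dotZl dotZr mulrA a2 mulVf// gt_eqF.
  by rewrite -scalemxAr dotZl dotZr mulrA a2 mulrC ler_pdivlMr.
have lbmu : lbound Q mu by move=> r Qr; apply: ge_inf => //; exists 0.
exists mu; split; last exact: low.
rewrite eigenvalueP_ker; apply/negP => uN.
have pN : psd (M - mu%:M).
  split=> [|x]; first by rewrite linearB/= pM.1 tr_scalar_mx.
  by rewrite mulmxBl dotBr mul_scalar_mx dotZr subr_ge0; exact: low.
have [dl dl0 hdl] := psd_unit_lower pN uN.
have : mu + dl <= mu.
  apply: lb_le_inf => // _ [x x1 ->].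
  have := hdl x; rewrite mulmxBl dotBr mul_scalar_mx dotZr x1; lra.
by lra.
Qed.

(** The reflection tr M - M is again positive semidefinite. *)
Lemma max_eigenvalue n (M : 'M[R]_n) : (0 < n)%N -> psd M ->
  exists mu, eigenvalue M mu /\ forall x, dot x (M *m x) <= mu * dot x x.
Proof.
move=> n0 pM.
have pM' : psd ((\tr M)%:M - M).
  split=> [|x]; first by rewrite linearB/= pM.1 tr_scalar_mx.
  by rewrite mulmxBl dotBr mul_scalar_mx dotZr subr_ge0 psd_le_tr.
have [mu [emu hmu]] := min_eigenvalue n0 pM'.
exists (\tr M - mu); split.
  move: emu; rewrite !eigenvalueP_ker.
  have -> : (\tr M)%:M - M - mu%:M = - (M - (\tr M - mu)%:M).
    by apply/matrixP => i j; rewrite !mxE mulrnBl; ring.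
  by rewrite -scaleN1r unitmxZ// unitrN unitr1.
move=> x; have := hmu x; rewrite mulmxBl dotBr mul_scalar_mx dotZr; lra.
Qed.

Section SingularValues.
Variables (m n : nat) (A : 'M[R]_(m, n)).
Hypothesis n0 : (0 < n)%N.

Lemma psd_gramT : psd (A^T *m A).
Proof.
split=> [|x]; first by rewrite trmx_mul trmxK.
by rewrite -mulmxA dot_mulr trmxK dot_ge0.
Qed.

Lemma qf_gramT x : dot x (A^T *m A *m x) = dot (A *m x) (A *m x).
Proof. by rewrite -mulmxA dot_mulr trmxK. Qed.

Lemma sv_eigen mu : eigenvalue (A^T *m A) mu -> 0 <= mu.
Proof.
move=> /(eigenvalue_qf psd_gramT.1)[x x0 e].
have := psd_gramT.2 x; rewrite e pmulr_lge0// dot_gt0//.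
Qed.

Lemma sv_sqrt mu : eigenvalue (A^T *m A) mu -> singular_value A (Num.sqrt mu).
Proof. by move=> emu; split; rewrite ?sqrtr_ge0// sqr_sqrtr// sv_eigen. Qed.

Lemma sigma_min_le v : sigma_min A ^+ 2 * dot v v <= dot (A *m v) (A *m v).
Proof.
have [mu [emu hmu]] := min_eigenvalue n0 psd_gramT.
apply: le_trans (_ : mu * dot v v <= _); last by rewrite -qf_gramT.
rewrite ler_wpM2r ?dot_ge0// -[leRHS]sqr_sqrtr ?sv_eigen//.
have lb : lbound (singular_value A) 0 by move=> sg [].
rewrite ler_pXn2r ?nnegrE ?sqrtr_ge0//.
  by apply: ge_inf; [exists 0|exact: sv_sqrt].
by apply: lb_le_inf => //; exists (Num.sqrt mu); exact: sv_sqrt.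
Qed.

Lemma sigma_max_ge v : dot (A *m v) (A *m v) <= sigma_max A ^+ 2 * dot v v.
Proof.
have [mu [emu hmu]] := max_eigenvalue n0 psd_gramT.
apply: le_trans (_ : _ <= mu * dot v v) _; first by rewrite -qf_gramT.
rewrite ler_wpM2r ?dot_ge0// -[leLHS]sqr_sqrtr ?sv_eigen//.
have ub : has_ubound (singular_value A).
  exists (Num.sqrt mu) => sg [sg0 /(eigenvalue_qf psd_gramT.1)[x x0 e]].
  rewrite -[leLHS]ger0_norm// -sqrtr_sqr ler_sqrt ?sv_eigen//.
  by have := hmu x; rewrite e ler_pM2r// dot_gt0.
have sm : Num.sqrt mu <= sigma_max A by apply: ub_le_sup => //; exact: sv_sqrt.
by rewrite ler_pXn2r ?nnegrE ?sqrtr_ge0// (le_trans _ sm)// sqrtr_ge0.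
Qed.

Lemma sigma_min_gt0 : \rank A = n -> 0 < sigma_min A.
Proof.
move=> rA; have [mu [emu hmu]] := min_eigenvalue n0 psd_gramT.
have mu0 : 0 < mu.
  rewrite lt_def sv_eigen// andbT; apply/eqP => mu0; move: emu.
  by rewrite mu0 eigenvalueP_ker raddf0 subr0 gram_unitmx.
apply: lt_le_trans (_ : Num.sqrt mu <= _); first by rewrite sqrtr_gt0.
apply: lb_le_inf; first by exists (Num.sqrt mu); exact: sv_sqrt.
move=> sg [sg0 /(eigenvalue_qf psd_gramT.1)[x x0 e]].
rewrite -[leRHS]ger0_norm// -sqrtr_sqr ler_sqrt ?sqr_ge0//.
by have := hmu x; rewrite e ler_pM2r// dot_gt0.
Qed.

Lemma sigma_min_le_max : sigma_min A ^+ 2 <= sigma_max A ^+ 2.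
Proof.
pose v : 'cV[R]_n := delta_mx (Ordinal n0) 0.
have v0 : 0 < dot v v by rewrite dot_delta mxE !eqxx ltr01.
by rewrite -(ler_pM2r v0); apply: le_trans (sigma_min_le v) (sigma_max_ge v).
Qed.

Lemma sigma_max_tr u : dot (A^T *m u) (A^T *m u) <= sigma_max A ^+ 2 * dot u u.
Proof.
set w := A^T *m u.
have [w0|w0] := eqVneq (dot w w) 0; first by rewrite w0 mulr_ge0 ?sqr_ge0 ?dot_ge0.
have wp : 0 < dot w w by rewrite lt_def w0 dot_ge0.
rewrite -(ler_pM2r wp) -expr2.
have -> : dot w w = dot u (A *m w) by rewrite [RHS]dot_mulr.
apply: le_trans (dot_CS _ _) _.
have -> : dot u (A *m w) = dot w w by rewrite dot_mulr.
have -> : sigma_max A ^+ 2 * dot u u * dot w w = dot u u * (sigma_max A ^+ 2 * dot w w) by ring.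
by rewrite ler_wpM2l ?dot_ge0// sigma_max_ge.
Qed.

End SingularValues.

(** * One step of the iteration and the recursion for the mean error *)

Lemma dot_expand n (u w : 'cV[R]_n) t : dot (u + t *: w) (u + t *: w) =
  dot u u + t * dot u w *+ 2 + t ^+ 2 * dot w w.
Proof. rewrite dotDl !dotDr !dotZl !dotZr [dot w u]dotC; ring. Qed.

(** Minimality along the line xs + t A^T e makes a quadratic polynomial in t with
zero constant term nonnegative, so its linear coefficient |A^T e|^2 vanishes. *)
Lemma normal_equations m n (A : 'M[R]_(m, n)) (b : 'cV[R]_m) xs :
  least_squares_sol A b xs -> A^T *m (A *m xs - b) = 0.
Proof.
move=> ls; set e := A *m xs - b.
set v := A^T *m e; apply/eqP; rewrite -dot_eq0.
have : dot v v ^+ 2 <= 0 * dot (A *m v) (A *m v).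
  apply: discriminant_le => t; rewrite add0r.
  have := ls (xs + t *: v); rewrite !l2norm_dot.
  have -> : A *m (xs + t *: v) - b = e + t *: (A *m v).
    by rewrite mulmxDr -scalemxAr addrAC.
  have ev : dot e (A *m v) = dot v v by rewrite dot_mulr.
  rewrite -/e dot_expand ev => h.
  by rewrite -subr_ge0 in h; apply: le_trans h _; apply: le_of_eq; ring.
by rewrite mul0r real_exprn_even_le0 ?num_real//= => /eqP ->.
Qed.

Section OneStep.
Variables (m n s : nat) (A : 'M[R]_(m, n)) (S : 'M[R]_(m, s)).
Hypothesis n0 : (0 < n)%N.
Let M := S^T *m A.
Let Pr := Defs.pinv M *m M.

Lemma Pr_sym : Pr^T = Pr.
Proof. by case: (Defs.pinvP M). Qed.

Lemma Pr_idem : Pr *m Pr = Pr.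
Proof. by case: (Defs.pinvP M) => h1 _ _ _; rewrite /Pr -mulmxA (mulmxA M) h1. Qed.

Lemma Pr_MT : Pr *m M^T = M^T.
Proof. by rewrite -Pr_sym -trmx_mul /Pr mulmxA; case: (Defs.pinvP M) => ->. Qed.

Lemma kaczmarz_err b xs x :
  dot (kaczmarz_step A b S x - xs) (kaczmarz_step A b S x - xs) =
  dot (x - xs) (x - xs) - dot (Pr *m (x - xs)) (Pr *m (x - xs)) +
  dot (Defs.pinv M *m (S^T *m (A *m xs - b))) (Defs.pinv M *m (S^T *m (A *m xs - b))).
Proof.
set v := x - xs; set y := Defs.pinv M *m (S^T *m (A *m xs - b)).
have -> : kaczmarz_step A b S x - xs = (v - Pr *m v) - y.
  rewrite /kaczmarz_step -/M -/Pr /y mulmxBl mul1mx /v !mulmxBr.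
  have -> : Defs.pinv M *m (S^T *m (A *m xs)) = Pr *m xs by rewrite /Pr /M !mulmxA.
  apply/matrixP => i j; rewrite !mxE; ring.
have Py : Pr *m y = y.
  by rewrite /y mulmxA; case: (Defs.pinvP M) => _ h _ _; rewrite /Pr h.
have vy : dot (v - Pr *m v) y = 0.
  rewrite -Py dot_mulr Pr_sym mulmxBr mulmxA Pr_idem subrr dot0l//.
have vP : dot v (Pr *m v) = dot (Pr *m v) (Pr *m v).
  by rewrite [RHS]dot_mull Pr_sym mulmxA Pr_idem.
rewrite -[- y]scaleN1r dot_expand vy -[- (Pr *m v)]scaleN1r dot_expand vP; ring.
Qed.

(** Write q = z^T Pi z with z = A v.  Since Pi z = S w lies in the range of S,
A^T Pi z = M^T w is fixed by the projection, so q = <A^T S w, P v>; by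
Cauchy-Schwarz q^2 <= sigma_max^2 |S w|^2 |P v|^2, and |S w|^2 <= q. *)
Lemma proj_ge eta v : 0 < eta ->
  dot (A *m v) (ridge_proj eta S *m (A *m v)) <=
  sigma_max A ^+ 2 * dot (Pr *m v) (Pr *m v).
Proof.
move=> e0; set z := A *m v.
pose w := invmx (S^T *m S + eta%:M) *m (S^T *m z).
have Sw : ridge_proj eta S *m z = S *m w by rewrite /ridge_proj /w !mulmxA.
set q := dot z (ridge_proj eta S *m z).
have q0 : 0 <= q by exact: (psd_ridge_proj S e0).2.
have sq : dot (S *m w) (S *m w) <= q by rewrite -Sw; exact: ridge_proj_sqr.
have [->|qn] := eqVneq q 0; first by rewrite mulr_ge0 ?sqr_ge0 ?dot_ge0.
have qp : 0 < q by rewrite lt_def qn.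
have qE : q = dot (A^T *m (S *m w)) (Pr *m v).
  have -> : A^T *m (S *m w) = M^T *m w by rewrite /M trmx_mul trmxK mulmxA.
  have -> : dot (M^T *m w) (Pr *m v) = dot (M^T *m w) v.
    by rewrite dot_mulr Pr_sym mulmxA Pr_MT.
  rewrite /q Sw dotC /z dot_mulr; congr dot.
  by rewrite /M trmx_mul trmxK mulmxA.
rewrite -(ler_pM2l qp) -expr2 {1}qE.
apply: le_trans (dot_CS _ _) _.
have h := sigma_max_tr A n0 (S *m w).
apply: le_trans (_ : sigma_max A ^+ 2 * q * dot (Pr *m v) (Pr *m v) <= _).
  apply: ler_wpM2r; first exact: dot_ge0.
  by apply: le_trans h _; rewrite ler_wpM2l// sqr_ge0.
by apply: le_of_eq; ring.
Qed.

(** The trace bound makes M M^T invertible, so that |M^+ h|^2 = h^T (M M^T)^-1 h. *)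
Lemma pinv_noise eta tau h : 0 < eta -> 2 * eta * tau <= 1 ->
  \tr (invmx ((A^T *m S)^T *m (A^T *m S) + eta%:M)) <= tau ->
  dot (Defs.pinv M *m h) (Defs.pinv M *m h) <=
  2 * dot h (invmx ((A^T *m S)^T *m (A^T *m S) + eta%:M) *m h).
Proof.
move=> e0 et; have -> : (A^T *m S)^T *m (A^T *m S) = M *m M^T.
  by rewrite /M !trmx_mul !trmxK mulmxA.
move=> htr; have pG : psd (M *m M^T).
  by rewrite -{1}[M]trmxK; exact: psd_gramT.
have uG : M *m M^T \in unitmx by exact: pd_unit (pd_of_ridge pG e0 htr et).
pose w := invmx (M *m M^T) *m h.
have Gw : M *m M^T *m w = h by rewrite /w mulmxA mulmxV// mul1mx.
have xE : Defs.pinv M *m h = M^T *m w.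
  by rewrite -[in RHS]Pr_MT -Gw /Pr !mulmxA.
have -> : dot (Defs.pinv M *m h) (Defs.pinv M *m h) = dot w (M *m M^T *m w).
  by rewrite xE -mulmxA [RHS]dot_mulr.
by have := qf_inv_ridge_le pG e0 htr et w; rewrite Gw.
Qed.

End OneStep.

Lemma sum_tuple_cons (T : finType) k (f : k.+1.-tuple T -> R) :
  \sum_(t : k.+1.-tuple T) f t = \sum_(l : T) \sum_(t : k.-tuple T) f [tuple of l :: t].
Proof.
rewrite pair_big /=.
rewrite (reindex (fun p : T * k.-tuple T => [tuple of p.1 :: p.2])) //=.
exists (fun t : k.+1.-tuple T => (thead t, [tuple of behead t])) => [[l t] _|t _] /=.
  by congr pair; apply: val_inj.
by rewrite [RHS]tuple_eta.
Qed.

(** The induction peels off the first choice, not the last: the statement for all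
starting points then applies to the point reached after one step. *)
Lemma expect_choices_bound m n s N (A : 'M[R]_(m, n)) b (S : 'I_N -> 'M[R]_(m, s)) xs (q nu : R) k :
  (0 < N)%N -> 0 < q <= 1 -> 0 <= nu ->
  (forall x, (\sum_l dot (kaczmarz_step A b (S l) x - xs) (kaczmarz_step A b (S l) x - xs)) / N%:R <=
     (1 - q) * dot (x - xs) (x - xs) + nu) ->
  forall x0,
  expect_choices (fun t : k.-tuple 'I_N => l2norm (kaczmarz_iter A b S x0 t - xs) ^+ 2) <=
  (1 - q) ^+ k * l2norm (x0 - xs) ^+ 2 + nu / q.
Proof.
move=> N0 /andP[q0 q1] nu0 step.
suff h : forall x0, expect_choices (fun t : k.-tuple 'I_N => l2norm (kaczmarz_iter A b S x0 t - xs) ^+ 2) <=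
  (1 - q) ^+ k * dot (x0 - xs) (x0 - xs) + nu * (1 - (1 - q) ^+ k) / q.
  (* The partial geometric sum is kept for the induction and bounded at the end. *)
  move=> x0; apply: le_trans (h x0) _; rewrite l2norm_dot lerD2l ler_pM2r ?invr_gt0//.
  have : 0 <= (1 - q) ^+ k by rewrite exprn_ge0// subr_ge0.
  by move=> r0; rewrite ler_piMr//; lra.
have N0' : 0 < N%:R :> R by rewrite ltr0n.
elim: k => [|k IH] x0.
  rewrite /expect_choices expn0 divr1 (big_pred1 [tuple]) /=; last first.
    by move=> t; rewrite [t]tuple0; symmetry; apply/eqP.
  by rewrite /kaczmarz_iter /= l2norm_dot !expr0 subrr mulr0 mul0r addr0 mul1r.
have r0 : 0 <= (1 - q) ^+ k by rewrite exprn_ge0// subr_ge0.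
have -> : expect_choices (fun t : k.+1.-tuple 'I_N => l2norm (kaczmarz_iter A b S x0 t - xs) ^+ 2) =
  (\sum_l expect_choices (fun t : k.-tuple 'I_N =>
     l2norm (kaczmarz_iter A b S (kaczmarz_step A b (S l) x0) t - xs) ^+ 2)) / N%:R.
  rewrite /expect_choices sum_tuple_cons -mulr_suml -mulrA expnS natrM invfM.
  by rewrite [N%:R^-1 * _]mulrC.
apply: le_trans (_ : (\sum_l ((1 - q) ^+ k * dot (kaczmarz_step A b (S l) x0 - xs) (kaczmarz_step A b (S l) x0 - xs) +
    nu * (1 - (1 - q) ^+ k) / q)) / N%:R <= _).
  by rewrite ler_pM2r ?invr_gt0//; apply: ler_sum => l _.
rewrite big_split /= -mulr_sumr sumr_const card_ord mulrDl -(mulrA ((1 - q) ^+ k)).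
have -> : (nu * (1 - (1 - q) ^+ k) / q *+ N) / N%:R = nu * (1 - (1 - q) ^+ k) / q.
  by rewrite -mulr_natr -mulrA divff ?mulr1// gt_eqF.
apply: le_trans (_ : (1 - q) ^+ k * ((1 - q) * dot (x0 - xs) (x0 - xs) + nu) +
   nu * (1 - (1 - q) ^+ k) / q <= _).
  by rewrite lerD2r ler_wpM2l.
rewrite exprS; apply: le_of_eq; field; lra.
Qed.

End Kaczmarz.

(** * Families of independent standard normal variables *)

(** An alias of I -> R that carries the product sigma-algebra. *)
Definition cfg (R : realType) (I : finType) : Type := I -> R.

Section cfg_measurable.
Variables (R : realType) (I : finType).

HB.instance Definition _ := gen_eqMixin (cfg R I).
HB.instance Definition _ := gen_choiceMixin (cfg R I).
HB.instance Definition _ := isPointed.Build (cfg R I) (fun=> 0).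

Definition box (B : I -> set R) : set (cfg R I) := [set x | forall i, B i (x i)].

Definition boxes : set (set (cfg R I)) :=
  [set A | exists B : I -> set R, (forall i, measurable (B i)) /\ A = box B].

Let cfg0 : <<s boxes >> set0. Proof. exact: sigma_algebra0. Qed.
Let cfgC A : <<s boxes >> A -> <<s boxes >> (~` A).
Proof. exact: sigma_algebraC. Qed.
Let cfgU (F : (set (cfg R I))^nat) : (forall i, <<s boxes >> (F i)) ->
  <<s boxes >> (\bigcup_i (F i)).
Proof. exact: sigma_algebra_bigcup. Qed.

HB.instance Definition _ := @isMeasurable.Build default_measure_display
  (cfg R I) <<s boxes >> cfg0 cfgC cfgU.

Lemma setI_closed_boxes : setI_closed boxes.
Proof.
move=> _ _ [B [mB ->]] [C [mC ->]]; exists (fun i => B i `&` C i); split.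
  by move=> i; exact: measurableI.
apply/seteqP; split=> [x [xB xC] i|x xBC]; first by split.
by split=> i; case: (xBC i).
Qed.

Lemma boxes_setT : boxes setT.
Proof. by exists (fun=> setT); split=> //; apply/seteqP; split. Qed.

Lemma measurable_coord i : measurable_fun setT (fun x : cfg R I => x i).
Proof.
move=> _ Y mY; rewrite setTI; apply: sub_sigma_algebra.
exists (fun j => if j == i then Y else setT); split=> [j|]; first by case: ifP.
apply/seteqP; split=> [x Yx j|x /(_ i)]; last by rewrite eqxx.
by case: eqP => // ->.
Qed.

Lemma measurable_cfg d (T : measurableType d) (f : T -> cfg R I) :
  (forall i, measurable_fun setT (fun w => f w i)) -> measurable_fun setT f.
Proof.
move=> mf; apply: (@measurability _ _ _ _ _ _ boxes) => //.
move=> _ [_ [B [mB ->]] <-]; rewrite setTI.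
have -> : f @^-1` (box B) = \bigcap_(i in [set: I]) ((fun w => f w i) @^-1` B i).
  by apply/seteqP; split=> [x xB i _|x xB i]; [exact: xB | exact: (xB i)].
apply: fin_bigcap_measurable => // i _; rewrite -[X in measurable X]setTI.
by apply: mf.
Qed.

End cfg_measurable.

Section GaussianLaw.
Variables (R : realType) (I : finType).
Implicit Types (d : measure_display).

Definition gaussian_law d (T : measurableType d) (P : probability T R) (X : T -> cfg R I) :=
  measurable_fun setT X /\
  forall B : I -> set R, (forall i, measurable (B i)) ->
    P (X @^-1` box B) = (\prod_i normal_prob 0 1 (B i))%E.

Definition EX d (T : measurableType d) (P : probability T R) (X : T -> cfg R I)
  (f : cfg R I -> \bar R) : \bar R := (\int[P]_w f (X w))%E.

(** Boxes form a pi-system, so the law of the family is determined by its marginals.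
Every invariance and independence statement below comes from here: two
constructions of an independent standard normal family are interchangeable. *)
Lemma gaussian_law_uniq d d' (T : measurableType d) (P : probability T R) (X : T -> cfg R I)
   (T' : measurableType d') (P' : probability T' R) (X' : T' -> cfg R I) (f : cfg R I -> \bar R) :
  gaussian_law P X -> gaussian_law P' X' -> measurable_fun setT f -> (forall x, 0 <= f x)%E ->
  EX P X f = EX P' X' f.
Proof.
move=> [mX gX] [mX' gX'] mf f0.
rewrite /EX.
have <- : (\int[pushforward P X]_x f x = \int[P]_w f (X w))%E.
  by rewrite ge0_integral_pushforward.
have <- : (\int[pushforward P' X']_x f x = \int[P']_w f (X' w))%E.
  by rewrite ge0_integral_pushforward.
apply: eq_measure_integral => A mA _.
apply: (@measure_unique _ _ _ (@boxes R I) (fun=> setT)) => //.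
- exact: setI_closed_boxes.
- by move=> _; exact: boxes_setT.
- by apply/seteqP; split=> // x _; exists 0%N.
- by move=> _ [B [mB ->]]; apply: (etrans (gX B mB)); exact/esym/gX'.
- by move=> k; change (P (X @^-1` setT) < +oo)%E; rewrite preimage_setT probability_setT ltry.
Qed.

Definition mix (J : pred I) (x y : cfg R I) : cfg R I :=
  fun i => if J i then x i else y i.

Lemma measurable_mix J : measurable_fun setT (fun z : cfg R I * cfg R I => mix J z.1 z.2).
Proof.
apply: measurable_cfg => i; rewrite /mix; case: (J i).
  by apply: (measurableT_comp (measurable_coord i)).
by apply: (measurableT_comp (measurable_coord i)).
Qed.

Lemma gaussian_law_mix d (T : measurableType d) (P : probability T R) (X : T -> cfg R I)
   d' (T' : measurableType d') (P' : probability T' R) (X' : T' -> cfg R I) J :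
  gaussian_law P X -> gaussian_law P' X' ->
  gaussian_law (P \x P')%E (fun z => mix J (X z.1) (X' z.2)).
Proof.
move=> [mX gX] [mX' gX']; split.
  apply: (measurableT_comp (f := fun z => mix J z.1 z.2) (g := fun w : T * T' => (X w.1, X' w.2))).
    exact: measurable_mix.
  by apply: measurable_fun_pair; apply: measurableT_comp.
move=> B mB.
have -> : (fun z : T * T' => mix J (X z.1) (X' z.2)) @^-1` box B =
  (X @^-1` box (fun i => if J i then B i else setT)) `*`
  (X' @^-1` box (fun i => if J i then setT else B i)).
  apply/seteqP; split=> [[w w'] h|[w w'] [/= h h'] i].
    by split=> i /=; have := h i; rewrite /mix /=; case: (J i).
  by have := h i; have := h' i; rewrite /mix /=; case: (J i).
have mB1 i : measurable (if J i then B i else setT) by case: (J i).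
have mB2 i : measurable (if J i then setT else B i) by case: (J i).
have mA1 : measurable (X @^-1` box (fun i => if J i then B i else setT)).
  rewrite -[X in measurable X]setTI; apply: mX => //; apply: sub_sigma_algebra.
  by eexists; split; [|reflexivity].
have mA2 : measurable (X' @^-1` box (fun i => if J i then setT else B i)).
  rewrite -[X in measurable X]setTI; apply: mX' => //; apply: sub_sigma_algebra.
  by eexists; split; [|reflexivity].
apply: (etrans (product_measure1E _ _ mA1 mA2)).
transitivity ((\prod_i normal_prob 0 1 (if J i then B i else setT)) *
  (\prod_i normal_prob 0 1 (if J i then setT else B i)))%E.
  by congr (_ * _)%E; [exact: gX | exact: gX'].
rewrite -big_split; apply: eq_bigr => i _ /=.
by case: (J i); rewrite probability_setT ?mule1 ?mul1e.
Qed.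

(** Resampling the coordinates outside J independently does not change the law; with
Tonelli this conditions on the coordinates in J. *)
Lemma EX_mix d (T : measurableType d) (P : probability T R) (X : T -> cfg R I) J (f : cfg R I -> \bar R) :
  gaussian_law P X -> measurable_fun setT f -> (forall x, 0 <= f x)%E ->
  EX P X f = EX P X (fun x => EX P X (fun y => f (mix J x y))).
Proof.
move=> gX mf f0.
rewrite (gaussian_law_uniq gX (gaussian_law_mix J gX gX) mf f0) /EX.
rewrite fubini_tonelli1//.
apply: (measurableT_comp mf); exact: (gaussian_law_mix J gX gX).1.
Qed.

End GaussianLaw.

(** * Gaussian integrals in one and two variables *)

Section OneDimensional.
Variable R : realType.
Let lam := (@lebesgue_measure R).

Lemma integral_normal_prob (f : R -> \bar R) :
  measurable_fun setT f -> (forall x, 0 <= f x)%E ->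
  (\int[normal_prob 0 1]_x f x = \int[lam]_x (f x * (normal_pdf 0 1 x)%:E))%E.
Proof.
move=> mf f0.
have dom := @normal_prob_dominates R 0 1.
rewrite -(Radon_Nikodym_SigmaFinite.change_of_variables dom)//.
have mN : measurable_fun setT (fun x => (normal_pdf 0 1 x)%:E : \bar R).
  by apply/measurable_EFinP; exact: measurable_normal_pdf.
have fi := Radon_Nikodym_SigmaFinite.f_integrable dom.
have mRN := measurable_int _ fi.
apply: ae_eq_integral => //.
- exact: emeasurable_funM.
- exact: emeasurable_funM.
have : ae_eq lam setT (Radon_Nikodym_SigmaFinite.f (normal_prob 0 1) lam)
                      (fun x => (normal_pdf 0 1 x)%:E).
  apply: integral_ae_eq => // E _ mE.
  by rewrite -Radon_Nikodym_SigmaFinite.f_integral.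
exact: ae_eqe_mul2l.
Qed.

(** The rescaled image of Lebesgue measure under the affine map agrees with Lebesgue
measure on half-open intervals, hence everywhere. *)
Lemma integral_affine (a b : R) (f : R -> \bar R) : a != 0 ->
  measurable_fun setT f -> (forall x, 0 <= f x)%E ->
  (\int[lam]_x f (a * x + b)%R = (`|a|^-1)%:E * \int[lam]_x f x)%E.
Proof.
move=> a0 mf f0.
pose phi (x : measurableTypeR R) : measurableTypeR R := a * x + b.
have mphi : measurable_fun setT phi.
  by apply: measurable_funD => //; apply: measurable_funM.
have na0 : 0 < `|a| by rewrite normr_gt0.
pose k := NngNum (ltW na0).
pose nu : {measure set (measurableTypeR R) -> \bar R} := mscale k (pushforward lam phi).
have key : forall A, measurable A -> lam A = nu mphi A.
  apply: (lebesgue_measure_unique (mu := nu mphi)) => _ [[u v] _ <-].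
  change (lam `]u, v]%classic = (`|a|)%:E * lam (phi @^-1` `]u, v]%classic))%E.
  have [a1|a1] := ltrP 0 a.
    have -> : phi @^-1` `]u, v]%classic = `](u - b) / a, (v - b) / a]%classic.
      apply/seteqP; split=> x /=; rewrite !in_itv/= /phi.
        by rewrite ltr_pdivrMr// ler_pdivlMr// ltrBlDr lerBrDr mulrC.
      by rewrite ltr_pdivrMr// ler_pdivlMr// ltrBlDr lerBrDr mulrC.
    rewrite /lam !lebesgue_measure_itv/= !lte_fin.
    rewrite ltr_pM2r ?invr_gt0// ltrD2r; case: ifP => _; last by rewrite mule0.
    rewrite -!EFinD -EFinM; congr EFin; rewrite gtr0_norm//; by field.
  have a2 : a < 0 by rewrite lt_neqAle a0.
  have -> : phi @^-1` `]u, v]%classic = `[(v - b) / a, (u - b) / a[%classic.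
    apply/seteqP; split=> x /=; rewrite !in_itv/= /phi.
      by rewrite ltr_ndivlMr// ler_ndivrMr// ltrBlDr lerBrDr mulrC => /andP[-> ->].
    by rewrite ltr_ndivlMr// ler_ndivrMr// ltrBlDr lerBrDr mulrC => /andP[-> ->].
  rewrite /lam !lebesgue_measure_itv/= !lte_fin.
  rewrite ltr_nM2r ?invr_lt0// ltrD2r; case: ifP => _; last by rewrite mule0.
  rewrite -!EFinD -EFinM; congr EFin; rewrite ltr0_norm//; by field.
have h1 : (\int[lam]_x f x = \int[nu mphi]_x f x)%E.
  by apply: eq_measure_integral => A mA _; exact: key.
have h2 : (\int[nu mphi]_x f x = (`|a|)%:E * \int[pushforward lam phi]_x f x)%E.
  by rewrite /nu ge0_integral_mscale.
rewrite h1 h2 muleA -EFinM mulVf ?mul1e ?gt_eqF//.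
by rewrite ge0_integral_pushforward//.
Qed.

Lemma normal_pdf_rot (c s x y : R) : c ^+ 2 + s ^+ 2 = 1 ->
  normal_pdf 0 1 (c * x + s * y) * normal_pdf 0 1 (c * y - s * x) =
  normal_pdf 0 1 x * normal_pdf 0 1 y.
Proof.
move=> cs; rewrite !normal_pdfE ?oner_eq0// /normal_fun.
rewrite mulrACA [RHS]mulrACA -!expRD; congr (_ * expR _).
rewrite !subr0 -!mulrDl -!opprD; congr (- _ / _).
rewrite -[in RHS](mul1r (x ^+ 2)) -[in RHS](mul1r (y ^+ 2)) -cs; ring.
Qed.

(** Rotation invariance of the plane Gaussian with one-dimensional substitutions
only: with densities, substitute u = c x + s y for y (x fixed), exchange the
integrals, and substitute for x (u fixed).  The factors |s|^-1 and |s| cancel. *)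
Lemma normal_prob_rot (c s : R) (F : R * R -> \bar R) : c ^+ 2 + s ^+ 2 = 1 -> s != 0 ->
  measurable_fun setT F -> (forall z, 0 <= F z)%E ->
  (\int[normal_prob 0 1]_x \int[normal_prob 0 1]_y F (c * x + s * y, c * y - s * x)%R =
   \int[normal_prob 0 1]_x \int[normal_prob 0 1]_y F (x, y))%E.
Proof.
move=> cs s0 mF F0.
pose N (z : R * R) : \bar R := (normal_pdf 0 1 z.1 * normal_pdf 0 1 z.2)%:E.
have N0 z : (0 <= N z)%E by rewrite lee_fin mulr_ge0// normal_pdf_ge0.
have mN : measurable_fun setT N.
  apply/measurable_EFinP; apply: measurable_funM.
    by apply: (measurableT_comp (measurable_normal_pdf _ _)).
  by apply: (measurableT_comp (measurable_normal_pdf _ _)).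
have dbl (H : R * R -> \bar R) : measurable_fun setT H -> (forall z, 0 <= H z)%E ->
   (\int[normal_prob 0 1]_x \int[normal_prob 0 1]_y H (x, y) =
    \int[lam]_x \int[lam]_y (H (x, y) * N (x, y)))%E.
  move=> mH H0.
  have mH1 x : measurable_fun setT (fun y => H (x, y)).
    by apply: (measurableT_comp mH); exact: measurable_fun_pair.
  rewrite integral_normal_prob//; last 2 first.
  - apply: (@measurable_fun_fubini_tonelli_F _ _ _ _ _ (normal_prob 0 1) H) => //.
  - by move=> x; apply: integral_ge0.
  apply: eq_integral => x _; rewrite integral_normal_prob// muleC.
  rewrite -ge0_integralZl//; first last.
  - by rewrite lee_fin normal_pdf_ge0.
  - by move=> y _; rewrite mule_ge0// lee_fin normal_pdf_ge0.
  - apply: emeasurable_funM; first exact: mH1.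
    by apply/measurable_EFinP; exact: measurable_normal_pdf.
  by apply: eq_integral => y _; rewrite muleCA -EFinM.
pose rho (z : R * R) : R * R := (c * z.1 + s * z.2, c * z.2 - s * z.1).
have mrho : measurable_fun setT rho.
  apply: measurable_fun_pair.
    by apply: measurable_funD; apply: measurable_funM.
  by apply: measurable_funB; apply: measurable_funM.
have dr := dbl (F \o rho) (measurableT_comp mF mrho) (fun z => F0 _).
apply: etrans dr _; apply: etrans _ (esym (dbl F mF F0)).
pose G (z : R * R) := (F z * N z)%E.
have mG : measurable_fun setT G by exact: emeasurable_funM.
have G0 z : (0 <= G z)%E by rewrite /G mule_ge0.
transitivity (\int[lam]_x \int[lam]_y (G (rho (x, y))))%E.
  apply: eq_integral => x _; apply: eq_integral => y _.
  by rewrite /G /=; congr (_ * _)%E; rewrite /N /rho /= normal_pdf_rot.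
transitivity (\int[lam]_x ((`|s|^-1)%:E * \int[lam]_u (G (u, (c * u - x) / s))%R))%E.
  apply: eq_integral => x _.
  have mGx : measurable_fun setT (fun u : R => G (u, (c * u - x) / s)).
    apply: (measurableT_comp mG); apply: measurable_fun_pair => //.
    by apply: measurable_funM => //; apply: measurable_funB => //; apply: measurable_funM.
  apply: etrans _ (integral_affine (c * x) s0 mGx (fun u => G0 _)).
  apply: eq_integral => y _; congr G; rewrite /rho /= addrC; congr pair.
  apply: (mulIf s0); rewrite divfK//.
  have e : x = (c ^+ 2 + s ^+ 2) * x by rewrite cs mul1r.
  by rewrite [X in _ = _ - X]e; ring.
pose K (z : R * R) := G (z.2, (c * z.2 - z.1) / s).
have mK : measurable_fun setT K.
  apply: (measurableT_comp mG); apply: measurable_fun_pair => //.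
  by apply: measurable_funM => //; apply: measurable_funB => //; apply: measurable_funM.
have K0 z : (0 <= K z)%E by exact: G0.
rewrite ge0_integralZl//; first last.
- by move=> x _; apply: integral_ge0.
- by apply: (@measurable_fun_fubini_tonelli_F _ _ _ _ _ (lam) K).
transitivity ((`|s|^-1)%:E * \int[lam]_u \int[lam]_x K (x, u))%E.
  have swap := fubini_tonelli (m1 := lam) (m2 := lam) K mK K0.
  exact: (congr1 (fun z => (`|s|^-1)%:E * z)%E swap).
rewrite -ge0_integralZl//; first last.
- by move=> x _; apply: integral_ge0.
- by apply: (@measurable_fun_fubini_tonelli_G _ _ _ _ _ (lam) K).
apply: eq_integral => u _.
have ns : - s^-1 != 0 by rewrite oppr_eq0 invr_eq0.
have -> : (\int[lam]_x K (x, u) = \int[lam]_x (G (u, (- s^-1) * x + (c * u / s))%R))%E.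
  by apply: eq_integral => x _; rewrite /K /=; congr (G (_, _)); field.
rewrite (integral_affine (f := fun v => G (u, v)) _ ns)//.
  by rewrite muleA -EFinM normrN normfV invrK mulVf ?mul1e// normr_eq0.
by apply: (measurableT_comp mG); apply: measurable_fun_pair.
Qed.

(** The integrand times the standard density is a multiple of the density with mean
- v / (1 + a) and variance 1 / (1 + a). *)
Lemma normal_prob_exp_quad (a v : R) : 0 < 1 + a ->
  (\int[normal_prob 0 1]_x (expR (- (a * x ^+ 2 / 2) - v * x))%:E =
   ((Num.sqrt (1 + a))^-1 * expR (v ^+ 2 / (1 + a) / 2))%:E)%E.
Proof.
move=> a0.
have mE : measurable_fun setT (fun x : R => (expR (- (a * x ^+ 2 / 2) - v * x))%:E).
  apply/measurable_EFinP; apply: measurableT_comp => //.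
  apply: measurable_funB => //.
    apply: measurable_funN; apply: measurable_funM => //.
    by apply: measurable_funM => //; apply: measurable_funX.
rewrite integral_normal_prob//.
set sg : R := (Num.sqrt (1 + a))^-1; set mm := - (v / (1 + a)).
have sg0 : 0 < sg by rewrite invr_gt0 sqrtr_gt0.
have sg2 : sg ^+ 2 = (1 + a)^-1 by rewrite exprVn sqr_sqrtr// ltW.
transitivity (\int[lam]_x ((sg * expR (v ^+ 2 / (1 + a) / 2))%:E * (normal_pdf mm sg x)%:E))%E.
  apply: eq_integral => x _; rewrite -!EFinM; congr EFin.
  rewrite !normal_pdfE ?oner_eq0 ?gt_eqF// /normal_fun /normal_peak.
  have -> : sg ^+ 2 * pi *+ 2 = sg ^+ 2 * (1 ^+ 2 * pi *+ 2).
    by rewrite expr1n mul1r mulrnAr.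
  rewrite sqrtrM ?sqr_ge0// sqrtr_sqr gtr0_norm// invfM.
  set pk := (Num.sqrt (1 ^+ 2 * pi *+ 2))^-1.
  rewrite [LHS]mulrCA -!expRD.
  rewrite [RHS]mulrACA -expRD.
  have -> : sg * (sg^-1 * pk) = pk by rewrite mulrA divff ?mul1r// gt_eqF.
  congr (_ * expR _).
  by rewrite sg2 /mm expr1n !mulr2n; field; rewrite gt_eqF.
rewrite ge0_integralZl//.
- by rewrite integral_normal_pdf mule1.
- apply/measurable_EFinP; exact: measurable_normal_pdf.
- by move=> x _; rewrite lee_fin normal_pdf_ge0.
- by rewrite lee_fin mulr_ge0 ?expR_ge0// ltW.
Qed.

End OneDimensional.

(** * Expectations of functions of a Gaussian family *)

Section Expectation.
Variables (R : realType) (I : finType).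
Context d (T : measurableType d) (P : probability T R) (X : T -> cfg R I).
Hypothesis gX : gaussian_law P X.
Implicit Types f g : cfg R I -> \bar R.
Let E := EX P X.

Lemma EX_ge0 f : (forall x, 0 <= f x)%E -> (0 <= E f)%E.
Proof. by move=> f0; apply: integral_ge0. Qed.

Lemma measurable_EX f : measurable_fun setT f -> measurable_fun setT (fun w => f (X w)).
Proof. by move=> mf; exact: (measurableT_comp mf gX.1). Qed.

Lemma le_EX f g : measurable_fun setT f -> measurable_fun setT g ->
  (forall x, 0 <= f x)%E -> (forall x, f x <= g x)%E -> (E f <= E g)%E.
Proof.
move=> mf mg f0 fg; apply: ge0_le_integral => //.
- exact: measurable_EX.
- exact: measurable_EX.
Qed.

Lemma EX_cst (c : \bar R) : E (fun=> c) = c.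
Proof. rewrite /E /EX integral_cst//. by rewrite [X in (_ * X)%E]probability_setT mule1. Qed.

Lemma EXZ (k : \bar R) f : measurable_fun setT f -> (forall x, 0 <= f x)%E -> (0 <= k)%E ->
  E (fun x => k * f x)%E = (k * E f)%E.
Proof. by move=> mf f0 k0; apply: ge0_integralZl => //; exact: measurable_EX. Qed.

Lemma EXD f g : measurable_fun setT f -> (forall x, 0 <= f x)%E ->
  measurable_fun setT g -> (forall x, 0 <= g x)%E ->
  E (fun x => f x + g x)%E = (E f + E g)%E.
Proof.
by move=> mf f0 mg g0; apply: ge0_integralD => //; exact: measurable_EX.
Qed.

Lemma eq_EX f g : f =1 g -> E f = E g.
Proof. by move=> fg; apply: eq_integral => w _; rewrite fg. Qed.

(** f depends on the coordinates in J only, and g on the others only; the two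
invariances under mix say this without mentioning restrictions. *)
Lemma EX_indep J f g :
  measurable_fun setT f -> (forall x, 0 <= f x)%E ->
  measurable_fun setT g -> (forall x, 0 <= g x)%E ->
  (forall x y, f (mix J x y) = f x) -> (forall x y, g (mix J x y) = g y) ->
  E (fun x => f x * g x)%E = (E f * E g)%E.
Proof.
move=> mf f0 mg g0 fJ gJ.
rewrite {1}/E (EX_mix J gX)//; last 2 first.
- exact: emeasurable_funM.
- by move=> x; rewrite mule_ge0.
transitivity (E (fun x => E g * f x)%E).
  apply: eq_EX => x; rewrite muleC -EXZ//.
  by apply: eq_EX => y; rewrite fJ gJ.
by rewrite EXZ ?EX_ge0// muleC.
Qed.

Definition update (x : cfg R I) (p : I) (y : R) : cfg R I :=
  fun i => if i == p then y else x i.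

Lemma measurable_update p : measurable_fun setT (fun z : cfg R I * R => update z.1 p z.2).
Proof.
apply: measurable_cfg => i; rewrite /update; case: (i == p).
  exact: measurable_snd.
by apply: (measurableT_comp (measurable_coord i)); exact: measurable_fst.
Qed.

Definition int_coord p f (x : cfg R I) : \bar R := (\int[normal_prob 0 1]_y f (update x p y))%E.

Lemma measurable_int_coord p f : measurable_fun setT f -> (forall x, 0 <= f x)%E ->
  measurable_fun setT (int_coord p f).
Proof.
move=> mf f0.
apply: (@measurable_fun_fubini_tonelli_F _ _ _ _ _ (normal_prob 0 1)
  (fun z : cfg R I * R => f (update z.1 p z.2))) => //.
exact: (measurableT_comp mf (measurable_update p)).
Qed.

Lemma int_coord_ge0 p f x : (forall x, 0 <= f x)%E -> (0 <= int_coord p f x)%E.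
Proof. by move=> f0; apply: integral_ge0. Qed.

Lemma law_coord p (A : set R) : measurable A ->
  pushforward P (fun w => X w p) A = normal_prob 0 1 A.
Proof.
move=> mA; pose B i := if i == p then A else setT.
have mB i : measurable (B i) by rewrite /B; case: ifP.
have := gX.2 B mB; rewrite /pushforward.
have -> : X @^-1` box B = (fun w => X w p) @^-1` A.
  apply/seteqP; split=> [w /(_ p)|w Aw i]; first by rewrite /B eqxx.
  by rewrite /B; case: eqP => // ->.
move=> ->; rewrite (bigD1 p)//= /B eqxx big1 ?mule1// => i /negbTE ->.
by rewrite probability_setT.
Qed.

Lemma EX_coord p f : measurable_fun setT f -> (forall x, 0 <= f x)%E ->
  E f = E (int_coord p f).
Proof.
move=> mf f0; rewrite /E (EX_mix (predC1 p) gX)//.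
apply: eq_EX => x; rewrite /E /EX /int_coord.
pose Xp : T -> measurableTypeR R := fun w => X w p.
have mXp : measurable_fun setT Xp.
  exact: (measurableT_comp (measurable_coord p) gX.1).
have mfu : measurable_fun setT (fun y : measurableTypeR R => f (update x p y)).
  apply: (measurableT_comp mf); apply: measurable_cfg => i; rewrite /update.
  by case: (i == p).
transitivity (\int[pushforward P Xp]_y f (update x p y))%E.
  rewrite ge0_integral_pushforward//.
  apply: eq_integral => w _; congr f; apply/funext => i.
  by rewrite /mix /update /=; case: eqP => [->|].
apply: eq_measure_integral => A mA _; exact: law_coord.
Qed.

Definition plane_rot (c s : R) p q (x : cfg R I) : cfg R I :=
  update (update x p (c * x p + s * x q)) q (c * x q - s * x p).

Lemma measurable_plane_rot c s p q : measurable_fun setT (plane_rot c s p q).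
Proof.
apply: measurable_cfg => i; rewrite /plane_rot /update.
have m1 := @measurable_coord R I.
case: (i == q); last case: (i == p) => //.
  by apply: measurable_funB; apply: measurable_funM.
by apply: measurable_funD; apply: measurable_funM.
Qed.

(** Integrating out the two coordinates reduces the claim to the plane. *)
Lemma EX_plane_rot c s p q f : p != q -> c ^+ 2 + s ^+ 2 = 1 -> s != 0 ->
  measurable_fun setT f -> (forall x, 0 <= f x)%E ->
  E (fun x => f (plane_rot c s p q x)) = E f.
Proof.
move=> pq cs s0 mf f0.
have key g : measurable_fun setT g -> (forall x, 0 <= g x)%E ->
    E g = E (fun x => \int[normal_prob 0 1]_u \int[normal_prob 0 1]_v
       g (update (update x p u) q v))%E.
  move=> mg g0; apply: etrans (EX_coord q mg g0) _.
  exact: (EX_coord p (measurable_int_coord q mg g0) (fun x => int_coord_ge0 q x g0)).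
have mfr : measurable_fun setT (fun x => f (plane_rot c s p q x)).
  exact: (measurableT_comp mf (measurable_plane_rot c s p q)).
apply: etrans (key _ mfr (fun x => f0 _)) _.
apply: etrans _ (esym (key _ mf f0)).
apply: eq_EX => x.
pose F (z : R * R) := f (update (update x p z.1) q z.2).
have mF : measurable_fun setT F.
  apply: (measurableT_comp mf); apply: measurable_cfg => i; rewrite /update.
  by case: (i == q); [exact: measurable_snd|case: (i == p); [exact: measurable_fst|]].
apply: etrans _ (normal_prob_rot cs s0 mF (fun z => f0 _)).
apply: eq_integral => u _; apply: eq_integral => v _; congr f.
apply/funext => i; rewrite /plane_rot /update /= !eqxx (negbTE pq).
by case: (i == q) => //; case: (i == p).
Qed.

Definition coords n (iota : 'I_n -> I) (x : cfg R I) : 'cV[R]_n := \col_i x (iota i).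

Lemma measurable_qf n (iota : 'I_n -> I) (K : 'M[R]_n) :
  measurable_fun setT (fun x : cfg R I => dot (coords iota x) (K *m coords iota x)).
Proof.
under eq_fun => x.
  rewrite dotE.
  under eq_bigr => i _.
    rewrite !mxE.
    under eq_bigr do rewrite mxE.
    over.
  over.
apply: measurable_sum => i; apply: measurable_funM; first exact: measurable_coord.
apply: measurable_sum => j; apply: measurable_funM => //; exact: measurable_coord.
Qed.

(** Induction on the number of variables: integrating one coordinate leaves the
quadratic form of the Schur complement of 1 + K, and its pivot is the factor by
which the determinant drops. *)
Lemma EX_quad n (iota : 'I_n -> I) (K : 'M[R]_n) : injective iota ->
  pd (1%:M + K) ->
  E (fun x => (expR (- (dot (coords iota x) (K *m coords iota x) / 2)))%:E) =
  ((Num.sqrt (\det (1%:M + K)))^-1)%:E.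
Proof.
elim: n iota K => [|n IH] iota K inj pK.
  rewrite det_mx00 sqrtr1 invr1 -[RHS]EX_cst; apply: eq_EX => x.
  by rewrite dotE big_ord0 mul0r oppr0 expR0.
move: iota K inj pK; rewrite -(add1n n) => iota K inj pK.
set M : 'M[R]_(1 + n) := 1%:M + K in pK *.
have a0 : 0 < M 0 0 by exact: pd_diag.
have sM : M^T = M by case: pK.
pose iota' i := iota (rshift 1 i).
have inj' : injective iota' by move=> i j /inj /rshift_inj.
pose K' := schur_compl M - 1%:M.
have EK' : 1%:M + K' = schur_compl M by rewrite /K' addrC subrK.
have pK' : pd (1%:M + K') by rewrite EK'; exact: pd_schur.
have mq n' (io : 'I_n' -> I) (L : 'M[R]_n') : measurable_fun setT (fun x =>
    (expR (- (dot (coords io x) (L *m coords io x) / 2)))%:E).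
  apply/measurable_EFinP; apply: measurableT_comp => //.
  by apply: measurable_funN; apply: measurable_funM => //; exact: measurable_qf.
have e0 (z : R) : (0 <= (expR z)%:E)%E by rewrite lee_fin expR_ge0.
apply: etrans (EX_coord (iota 0) (mq _ iota K) (fun x => e0 _)) _.
transitivity (E (fun x => ((Num.sqrt (M 0 0))^-1)%:E *
   (expR (- (dot (coords iota' x) (K' *m coords iota' x) / 2)))%:E)%E); last first.
  have sq0 : (0 <= ((Num.sqrt (M 0 0))^-1)%:E)%E by rewrite lee_fin invr_ge0 sqrtr_ge0.
  apply: etrans (EXZ (mq _ iota' K') (fun x => e0 _) sq0) _.
  rewrite [X in (_ * X)%E](IH _ _ inj' pK') EK' -EFinM det_schur ?lt0r_neq0//.
  by rewrite sqrtrM ?ltW// invfM.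
apply: eq_EX => x; rewrite /int_coord.
set y := coords iota' x; set u := (ursubmx M *m y) 0 0.
have vE z : coords iota (update x (iota 0) z) = col_mx z%:M y.
  apply/colP => i; rewrite [LHS]mxE /update (inj_eq inj).
  case: (splitP i) => [j ij|j ij].
    have -> : i = lshift n j by apply: val_inj.
    by rewrite col_mxEu ifT ?ord1 ?mxE ?mulr1n// -val_eqE /= ord1.
  have -> : i = rshift 1 j by apply: val_inj.
  by rewrite col_mxEd mxE.
transitivity (\int[normal_prob 0 1]_z ((expR (- (u ^+ 2 / M 0 0 / 2) - dot y (K' *m y) / 2))%:E *
    (expR (- ((M 0 0 - 1) * z ^+ 2 / 2) - u * z))%:E))%E.
  apply: eq_integral => z _; rewrite -EFinM -expRD vE; congr (expR _)%:E.
  have -> : K = M - 1%:M by rewrite /M addrC addKr.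
  rewrite mulmxBl mul1mx dotBr qf_schur ?lt0r_neq0// dot_col -/u.
  rewrite /K' (mulmxBl (schur_compl M)) mul1mx dotBr.
  have -> : (z%:M : 'M[R]_1) 0 0 = z by rewrite mxE mulr1n.
  by field; rewrite lt0r_neq0.
have g0 : 0 < 1 + (M 0 0 - 1) by rewrite addrC subrK.
have mz : measurable_fun setT (fun z : R => (expR (- ((M 0 0 - 1) * z ^+ 2 / 2) - u * z))%:E).
  apply/measurable_EFinP; apply: measurableT_comp => //.
  apply: measurable_funB => //; apply: measurable_funN; apply: measurable_funM => //.
  by apply: measurable_funM => //; apply: measurable_funX.
rewrite ge0_integralZl//.
rewrite normal_prob_exp_quad// -!EFinM [1 + (_ - 1)]addrC subrK; congr EFin.
rewrite mulrCA -expRD; congr (_ * expR _); lra.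
Qed.

End Expectation.

Lemma gaussian_law_entries (R : realType) (I : finType) d (T : measurableType d)
  (P : probability T R) (G : I -> {RV P >-> R}) :
  mutual_independence G -> (forall p, standard_normal (G p)) ->
  gaussian_law P (fun w => (fun p => G p w) : cfg R I).
Proof.
move=> ind std; split=> [|B mB].
  by apply: measurable_cfg => p; exact: measurable_funPT.
have := ind [set: I]%SET B mB.
have -> : \bigcap_(i in [set` [set: I]%SET]) (G i @^-1` B i) =
   (fun w => (fun p => G p w) : cfg R I) @^-1` box B.
  by apply/seteqP; split=> [w Bw p|w Bw p _]; [apply: Bw; rewrite /= inE|exact: Bw].
move=> ->; apply: eq_big => [p|p _]; first by rewrite inE.
exact: std.
Qed.

(** * Measurability of matrix functions *)

Section MeasMx.
Variable R : realType.
Context d (T : measurableType d).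

(** 1/f = f / f^2, which reduces the inverse to a real power on the nonnegative
reals, with the value 0 at 0. *)
Lemma measurable_funV (f : T -> R) : measurable_fun setT f ->
  measurable_fun setT (fun x => (f x)^-1).
Proof.
move=> mf.
have -> : (fun x => (f x)^-1) = (fun x => f x * (f x ^+ 2) `^ (-1)).
  apply/funext => x; rewrite powR_inv1 ?sqr_ge0//.
  have [->|fx] := eqVneq (f x) 0; first by rewrite invr0 mul0r.
  by rewrite expr2 invfM mulrA divff// mul1r.
apply: measurable_funM => //.
by apply: (measurableT_comp (measurable_powR _)); apply: measurable_funX.
Qed.

Lemma measurable_prodR (J : Type) (r : seq J) (h : J -> T -> R) :
  (forall j, measurable_fun setT (h j)) ->
  measurable_fun setT (fun x => \prod_(j <- r) h j x).
Proof.
move=> mh; elim: r => [|a r IH].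
  by under eq_fun do rewrite big_nil; exact: measurable_cst.
by under eq_fun do rewrite big_cons; exact: measurable_funM.
Qed.

Definition measurable_mx m n (F : T -> 'M[R]_(m, n)) :=
  forall i j, measurable_fun setT (fun x => F x i j).

Lemma measurable_mx_cst m n (A : 'M[R]_(m, n)) : measurable_mx (fun=> A).
Proof. by move=> i j; exact: measurable_cst. Qed.

Lemma measurable_mx_mul m n p (F : T -> 'M[R]_(m, n)) (G : T -> 'M[R]_(n, p)) :
  measurable_mx F -> measurable_mx G -> measurable_mx (fun x => F x *m G x).
Proof.
move=> mF mG i j; under eq_fun do rewrite mxE.
by apply: measurable_sum => k; exact: measurable_funM.
Qed.

Lemma measurable_mx_add m n (F G : T -> 'M[R]_(m, n)) :
  measurable_mx F -> measurable_mx G -> measurable_mx (fun x => F x + G x).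
Proof.
by move=> mF mG i j; under eq_fun do rewrite mxE; exact: measurable_funD.
Qed.

Lemma measurable_mx_tr m n (F : T -> 'M[R]_(m, n)) : measurable_mx F -> measurable_mx (fun x => (F x)^T).
Proof. by move=> mF i j; under eq_fun do rewrite mxE; exact: mF. Qed.

Lemma measurable_det n (F : T -> 'M[R]_n) : measurable_mx F ->
  measurable_fun setT (fun x => \det (F x)).
Proof.
move=> mF; apply: measurable_sum => s; apply: measurable_funM => //.
by apply: measurable_prodR => i; exact: mF.
Qed.

Lemma measurable_tr n (F : T -> 'M[R]_n) : measurable_mx F ->
  measurable_fun setT (fun x => \tr (F x)).
Proof. by move=> mF; apply: measurable_sum => i; exact: mF. Qed.

Lemma measurable_mx_inv n (F : T -> 'M[R]_n) : measurable_mx F -> (forall x, F x \in unitmx) ->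
  measurable_mx (fun x => invmx (F x)).
Proof.
move=> mF uF i j.
under eq_fun => x do rewrite /invmx uF mxE.
apply: measurable_funM; first by apply: measurable_funV; exact: measurable_det.
under eq_fun do rewrite mxE /cofactor.
apply: measurable_funM => //; apply: measurable_det => k l.
by under eq_fun do rewrite !mxE; exact: mF.
Qed.

Lemma measurable_dot n (F G : T -> 'cV[R]_n) : measurable_mx F -> measurable_mx G ->
  measurable_fun setT (fun x => dot (F x) (G x)).
Proof. by move=> mF mG; apply: (measurable_mx_mul (measurable_mx_tr mF) mG). Qed.

End MeasMx.

(** * Rotation invariance and independence of the sketching matrices *)

Section Model.
Variables (R : realType) (N m s : nat).
Let I : finType := ('I_N * 'I_m * 'I_s)%type.
Context d (T : measurableType d) (P : probability T R) (X : T -> cfg R I).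
Hypothesis gX : gaussian_law P X.
Let E := EX P X.

Definition Smat (x : cfg R I) (l : 'I_N) : 'M[R]_(m, s) := \matrix_(i, j) x (l, i, j).

Lemma measurable_mx_Smat l : measurable_mx (fun x => Smat x l).
Proof. by move=> i j; under eq_fun do rewrite mxE; exact: measurable_coord. Qed.

(** Left multiplication of all sketching matrices at once, as a map of
configurations. *)
Definition act (Gam : 'M[R]_m) (x : cfg R I) : cfg R I :=
  fun p => (Gam *m Smat x p.1.1) p.1.2 p.2.

Lemma Smat_act Gam x l : Smat (act Gam x) l = Gam *m Smat x l.
Proof. by apply/matrixP => i j; rewrite mxE. Qed.

Lemma act_mul G1 G2 x : act (G1 *m G2) x = act G1 (act G2 x).
Proof.
by apply/funext => p; rewrite /act Smat_act mulmxA.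
Qed.

Lemma act1 x : act 1%:M x = x.
Proof. by apply/funext => -[[l i] j]; rewrite /act mul1mx mxE. Qed.

Lemma measurable_act Gam : measurable_fun setT (act Gam).
Proof.
apply: measurable_cfg => p; apply: measurable_mx_mul; [exact: measurable_mx_cst|exact: measurable_mx_Smat].
Qed.

Definition invariant_act (Gam : 'M[R]_m) := forall f : cfg R I -> \bar R,
  measurable_fun setT f -> (forall x, 0 <= f x)%E -> E (fun x => f (act Gam x)) = E f.

Lemma invariant_act1 : invariant_act 1%:M.
Proof. by move=> f mf f0; apply: eq_EX => x; rewrite act1. Qed.

Lemma invariant_actM G1 G2 : invariant_act G1 -> invariant_act G2 ->
  invariant_act (G1 *m G2).
Proof.
move=> i1 i2 f mf f0; rewrite -(i1 f)// -(i2 (fun x => f (act G1 x)))//.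
  by apply: eq_EX => x; rewrite act_mul.
exact: (measurableT_comp mf (measurable_act G1)).
Qed.

Definition givens_rows (c sn : R) (p q : 'I_m) n (M : 'M[R]_(m, n)) : 'M[R]_(m, n) :=
  \matrix_(a, b) if a == q then c * M q b - sn * M p b
                 else if a == p then c * M p b + sn * M q b else M a b.

Definition givens c sn p q : 'M[R]_m := givens_rows c sn p q 1%:M.

Lemma mul_givens c sn p q n (M : 'M[R]_(m, n)) : givens c sn p q *m M = givens_rows c sn p q M.
Proof.
have e (a : 'I_m) (b : 'I_n) : M a b = \sum_j (1%:M : 'M[R]_m) a j * M j b.
  by rewrite -[in LHS](mul1mx M) mxE.
apply/matrixP => a b; rewrite [LHS]mxE [RHS]mxE.
under eq_bigr do rewrite mxE.
case: (a == q); last case: (a == p).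
- by rewrite !e !mulr_sumr -sumrB; apply: eq_bigr => j _; rewrite mulrBl !mulrA.
- by rewrite !e !mulr_sumr -big_split; apply: eq_bigr => j _; rewrite mulrDl !mulrA.
- by rewrite e.
Qed.

Lemma givens_orth c sn p q : p != q -> c ^+ 2 + sn ^+ 2 = 1 ->
  (givens c sn p q)^T *m givens c sn p q = 1%:M.
Proof.
move=> pq cs; apply: mulmx1C; rewrite mul_givens.
have qp : q != p by rewrite eq_sym.
have cs' : c * c + sn * sn = 1 by rewrite -cs !expr2.
apply/matrixP => a b.
have [->|aq] := eqVneq a q; have [->|bq] := eqVneq b q;
  rewrite !mxE ?eqxx ?(negbTE pq) ?(negbTE qp) ?(negbTE aq) ?(negbTE bq).
- by rewrite /= !mulr0 !mulr1 subr0 sub0r mulrN opprK.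
- have [ebp|bp] := eqVneq b p; rewrite ?ebp ?eqxx ?(negbTE qp) ?(negbTE pq) ?(negbTE bp) ?(negbTE bq) /=.
    by rewrite !mulr0 !mulr1 addr0 add0r mulrC subrr.
  by rewrite ?[_ == b]eq_sym ?(negbTE bq) ?(negbTE bp) /= ?mulr0 ?subrr.
- have [eap|ap] := eqVneq a p; rewrite ?eap ?eqxx ?(negbTE qp) ?(negbTE pq) ?(negbTE ap) ?(negbTE aq) /=.
    by rewrite !mulr0 !mulr1 subr0 sub0r mulrN mulrC addNr.
  by rewrite ?[_ == a]eq_sym ?(negbTE ap) ?(negbTE aq) /= ?mulr0 ?subrr.
have [eap|ap] := eqVneq a p; have [ebp|bp] := eqVneq b p;
  rewrite ?eap ?ebp ?eqxx ?(negbTE pq) ?(negbTE qp) ?(negbTE ap) ?(negbTE bp) ?(negbTE bq) ?(negbTE aq) /=.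
- by rewrite !mulr0 !mulr1 addr0 add0r.
- by rewrite ?[_ == b]eq_sym ?(negbTE bp) ?(negbTE bq) /= ?mulr0 ?addr0.
- by rewrite ?[_ == a]eq_sym ?(negbTE ap) ?(negbTE aq) /= ?mulr0 ?addr0.
- by rewrite eq_sym.
Qed.

(** A rotation of rows p and q is a product of plane rotations, one for each sketching
matrix and each column, acting on disjoint pairs of coordinates. *)
Lemma invariant_givens c sn p q : p != q -> c ^+ 2 + sn ^+ 2 = 1 -> sn != 0 ->
  invariant_act (givens c sn p q).
Proof.
move=> pq cs sn0 f mf f0.
pose step (lk : 'I_N * 'I_s) (x : cfg R I) : cfg R I :=
  plane_rot c sn (lk.1, p, lk.2) (lk.1, q, lk.2) x.
have mstep lk : measurable_fun setT (step lk) by exact: measurable_plane_rot.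
pose steps r x := foldr step x r.
have msteps r : measurable_fun setT (steps r).
  by elim: r => [|a r IH]; [exact: measurable_id|exact: (measurableT_comp (mstep a) IH)].
have inv_steps r g : measurable_fun setT g -> (forall x, 0 <= g x)%E ->
   E (fun x => g (steps r x)) = E g.
  elim: r g => [//|a r IH] g mg g0.
  have mga : measurable_fun setT (fun x => g (step a x)) by exact: (measurableT_comp mg (mstep a)).
  apply: etrans (IH _ mga (fun x => g0 _)) _.
  by apply: (EX_plane_rot gX _ cs sn0 mg g0); apply: contra pq => /eqP[->].
rewrite -(inv_steps (enum {: 'I_N * 'I_s}) f mf f0).
apply: eq_EX => x; congr f; apply/funext => -[[l i] k]; symmetry.
have stepE r : uniq r -> forall l i k, steps r x (l, i, k) =
    if (l, k) \in r then act (givens c sn p q) x (l, i, k) else x (l, i, k).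
  elim: r => [//|[l0 k0] r IH] /= /andP[ar ur] l' i' k'.
  rewrite in_cons /step /plane_rot /update /= !IH// (negbTE ar).
  rewrite /act mul_givens !mxE !xpair_eqE /=.
  have [->|ll] := eqVneq l' l0; have [->|kk] := eqVneq k' k0; rewrite /= ?andbF ?andbT//=.
  by case: (i' == q) => //; case: (i' == p) => //; rewrite ?mxE (negbTE ar).
by rewrite stepE ?enum_uniq// mem_enum.
Qed.

(** A product of plane rotations, each of which clears one coordinate of e into
coordinate p.  Trivial rotations are skipped, because invariant_givens needs a
nonzero sine. *)
Lemma exists_rotation (e : 'cV[R]_m) (p : 'I_m) : exists Gam : 'M[R]_m,
  [/\ Gam^T *m Gam = 1%:M, invariant_act Gam
    & forall i, i != p -> (Gam *m e) i 0 = 0].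
Proof.
have [Gam [oG iG G0]] : exists Gam : 'M[R]_m, [/\ Gam^T *m Gam = 1%:M, invariant_act Gam
    & forall i, i \in enum 'I_m -> i != p -> (Gam *m e) i 0 = 0].
  elim: (enum 'I_m) => [|a r [Gam [oG iG G0]]].
    exists 1%:M; split=> //; first by rewrite trmx1 mulmx1.
    exact: invariant_act1.
  have [ap|ap] := eqVneq a p.
    by exists Gam; split=> // i; rewrite in_cons => /predU1P[->|/G0//]; rewrite ap eqxx.
  have [a0|a0] := eqVneq ((Gam *m e) a 0) 0.
    by exists Gam; split=> // i; rewrite in_cons => /predU1P[->|/G0//].
  set v := Gam *m e in a0 *.
  pose rr := Num.sqrt (v p 0 ^+ 2 + v a 0 ^+ 2).
  have s0 : 0 < v p 0 ^+ 2 + v a 0 ^+ 2.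
    by rewrite ltr_wpDl ?sqr_ge0// lt_def sqr_ge0 sqrf_eq0 a0.
  have r0 : rr != 0 by rewrite gt_eqF// sqrtr_gt0.
  have r2 : rr ^+ 2 = v p 0 ^+ 2 + v a 0 ^+ 2 by rewrite sqr_sqrtr// ltW.
  have pa : p != a by rewrite eq_sym.
  have cs : (v p 0 / rr) ^+ 2 + (v a 0 / rr) ^+ 2 = 1.
    by rewrite !exprMn -mulrDl -r2 exprVn divff// sqrf_eq0.
  exists (givens (v p 0 / rr) (v a 0 / rr) p a *m Gam); split.
  - rewrite trmx_mul -mulmxA (mulmxA _^T (givens _ _ _ _)) givens_orth//.
    by rewrite mul1mx.
  - apply: invariant_actM => //; apply: invariant_givens => //.
    by rewrite mulf_neq0// invr_eq0.
  - move=> i; rewrite in_cons -mulmxA -/v mul_givens mxE.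
    case: eqP => [-> _ _|_ /= ir ip]; first by rewrite mulrAC [X in _ - X]mulrAC [v a 0 * _]mulrC subrr.
    by rewrite (negbTE ip); apply: G0.
by exists Gam; split=> // i; apply: G0; rewrite mem_enum.
Qed.

Lemma EX_prod (phi : 'I_N -> 'M[R]_(m, s) -> R) (c : R) :
  0 <= c -> (forall l, measurable_fun setT (fun x => phi l (Smat x l))) ->
  (forall l M, 0 <= phi l M) ->
  (forall l, (E (fun x => (phi l (Smat x l))%:E) <= c%:E)%E) ->
  (E (fun x => (\prod_l phi l (Smat x l))%:E) <= (c ^+ N)%:E)%E.
Proof.
move=> c0 mphi phi0 le.
have key (r : seq 'I_N) : uniq r ->
  (E (fun x => (\prod_(l <- r) phi l (Smat x l))%:E) <= (c ^+ size r)%:E)%E.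
  elim: r => [_|a r IH /= /andP[ar ur]].
    have -> : E (fun x => (\prod_(l <- [::]) phi l (Smat x l))%:E) = E (fun=> 1%:E).
      by apply: eq_EX => x; rewrite big_nil.
    by rewrite /E EX_cst.
  have -> : E (fun x => (\prod_(l <- a :: r) phi l (Smat x l))%:E) =
     E (fun x => ((phi a (Smat x a))%:E * (\prod_(l <- r) phi l (Smat x l))%:E)%E).
    by apply: eq_EX => x; rewrite big_cons EFinM.
  have mpr : measurable_fun setT (fun x => (\prod_(l <- r) phi l (Smat x l))%:E).
    by apply/measurable_EFinP; exact: measurable_prodR.
  have mpa : measurable_fun setT (fun x => (phi a (Smat x a))%:E).
    by apply/measurable_EFinP; exact: mphi.
  have pa0 x : (0 <= (phi a (Smat x a))%:E)%E by rewrite lee_fin.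
  have pr0 x : (0 <= (\prod_(l <- r) phi l (Smat x l))%:E)%E.
    by rewrite lee_fin; apply: prodr_ge0.
  rewrite /E (@EX_indep _ _ _ _ _ _ gX (fun p : I => p.1.1 == a) _ _ mpa pa0 mpr pr0).
  - rewrite exprS EFinM; apply: lee_pmul; last exact: IH.
    + exact: EX_ge0.
    + exact: EX_ge0.
    + exact: le.
  - by move=> x y; congr (phi a _)%:E; apply/matrixP => i j; rewrite !mxE /mix /= eqxx.
  - move=> x y; congr EFin; apply: eq_big_seq => l lr; congr (phi l _).
    apply/matrixP => i j; rewrite !mxE /mix /=; case: eqP => // la.
    by rewrite la (negbTE ar) in lr.
have := key (enum 'I_N) (enum_uniq _).
rewrite size_enum_ord => /(le_trans _); apply; rewrite le_eqVlt; apply/orP; left; apply/eqP.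
by apply: eq_EX => x; rewrite big_enum.
Qed.

End Model.

(** * The lower tail of the ridge inverse and the noise *)

Section MixLe.
Variables (R : realType) (I : finType).
Context d (T : measurableType d) (P : probability T R) (X : T -> cfg R I).
Hypothesis gX : gaussian_law P X.

Lemma EX_mix_le J (f : cfg R I -> \bar R) (c : R) :
  measurable_fun setT f -> (forall x, 0 <= f x)%E ->
  (forall x, EX P X (fun y => f (mix J x y)) <= c%:E)%E -> (EX P X f <= c%:E)%E.
Proof.
move=> mf f0 le; rewrite (EX_mix J gX mf f0).
rewrite -[leRHS](EX_cst P X c%:E).
apply: ge0_le_integral => //.
- by move=> w _; apply: integral_ge0.
- apply: (@measurable_fun_fubini_tonelli_F _ _ _ _ _ P
    (fun z : T * T => f (mix J (X z.1) (X z.2)))) => //.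
  by apply: (measurableT_comp mf); exact: (gaussian_law_mix J gX gX).1.
Qed.

End MixLe.

Section Estimates.
Variables (R : realType) (N m s : nat).
Let I : finType := ('I_N * 'I_m * 'I_s)%type.
Context d (T : measurableType d) (P : probability T R) (X : T -> cfg R I).
Hypothesis gX : gaussian_law P X.
Let E := EX P X.

Definition ridge_gram n (A : 'M[R]_(m, n)) (eta : R) (S : 'M[R]_(m, s)) : 'M[R]_s :=
  (A^T *m S)^T *m (A^T *m S) + eta%:M.

Lemma pd_ridge_gram n (A : 'M[R]_(m, n)) (eta : R) S : 0 < eta -> pd (ridge_gram A eta S).
Proof. exact: pd_ridge. Qed.

Lemma measurable_mx_inv_ridge n (A : 'M[R]_(m, n)) (eta : R) l : 0 < eta ->
  measurable_mx (fun x : cfg R I => invmx (ridge_gram A eta (Smat x l))).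
Proof.
move=> e0; apply: measurable_mx_inv => [|x]; last by apply: pd_unit; exact: pd_ridge_gram.
have mA : measurable_mx (fun x : cfg R I => A^T *m Smat x l).
  by apply: measurable_mx_mul; [exact: measurable_mx_cst|exact: measurable_mx_Smat].
by apply: measurable_mx_add; [apply: measurable_mx_mul => //; exact: measurable_mx_tr|exact: measurable_mx_cst].
Qed.

(** Condition on all columns but the j-th one of the l-th matrix.  The space
orthogonal to the other columns of A^T S has dimension k > n - s, and by
inv_ridge_le the exponent is bounded by a quadratic form in column j, whose
exponential moment is a determinant. *)
Lemma EX_lower_tail n (A : 'M[R]_(m, n)) (sg t eta : R) l j (k0 : nat) :
  0 < sg -> 0 <= t -> 0 < eta ->
  (forall v, sg * dot v v <= dot (A *m v) (A *m v)) -> (k0 + s <= n.+1)%N ->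
  (E (fun x => (expR (- (t / sg / invmx (ridge_gram A eta (Smat x l)) j j / 2)))%:E) <=
   ((Num.sqrt ((1 + t) ^+ k0))^-1)%:E)%E.
Proof.
move=> sg0 t0 e0 Asg k0s.
pose J (p : I) := ~~ ((p.1.1 == l) && (p.2 == j)).
pose iota (i : 'I_m) : I := (l, i, j).
have inj : injective iota by move=> i i' [].
have t1 : 0 < 1 + t by lra.
have ts : 0 <= t / sg by rewrite divr_ge0// ltW.
apply: (EX_mix_le gX (J := J)).
- apply/measurable_EFinP; apply: measurableT_comp => //.
  apply: measurable_funN; apply: measurable_funM => //; apply: measurable_funM => //.
  by apply: measurable_funV; exact: measurable_mx_inv_ridge.
- by move=> x; rewrite lee_fin expR_ge0.
move=> x.
have [k [F [fF kn F0]]] := exists_complement (A^T *m Smat x l) j.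
pose K := (t / sg) *: (A *m rowproj F *m A^T).
have pK : pd (1%:M + K) by exact: pd_1D.
have dK : (1 + t) ^+ k0 <= \det (1%:M + K).
  apply: le_trans (det_rowproj_ge fF sg0 t0 Asg).
  apply: ler_weXn2l; [by lra|]. by rewrite -(leq_add2r s); exact: leq_trans k0s kn.
apply: (@le_trans _ _ ((Num.sqrt (\det (1%:M + K)))^-1)%:E); last first.
  rewrite lee_fin lef_pV2 ?posrE ?sqrtr_gt0 ?det_pd ?exprn_gt0//.
  by rewrite ler_sqrt// ltW// det_pd.
rewrite -(EX_quad gX inj pK).
apply: (le_EX gX).
- apply/measurable_EFinP; apply: measurableT_comp => //.
  apply: measurable_funN; apply: measurable_funM => //; apply: measurable_funM => //.
  apply: measurable_funV.
  apply: (@measurableT_comp _ _ _ _ _ _ (fun x : cfg R I => invmx (ridge_gram A eta (Smat x l)) j j)).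
    exact: measurable_mx_inv_ridge.
  apply: measurable_cfg => i; rewrite /mix; case: (J i) => //; exact: measurable_coord.
- apply/measurable_EFinP; apply: measurableT_comp => //.
  by apply: measurable_funN; apply: measurable_funM => //; exact: measurable_qf.
- by move=> y; rewrite lee_fin expR_ge0.
move=> y; rewrite lee_fin ler_expR lerN2 ler_pM2r//.
set S' := Smat (mix J x y) l.
have col_mul p q r (U : 'M[R]_(p, q)) (V : 'M[R]_(q, r)) i : col i (U *m V) = U *m col i V.
  by rewrite !colE mulmxA.
have colj : col j (A^T *m S') = A^T *m coords iota y.
  rewrite col_mul; congr (_ *m _); apply/colP => i.
  by rewrite !mxE /mix /J /= !eqxx.
have coli i : i != j -> col i (A^T *m S') = col i (A^T *m Smat x l).
  move=> ij; rewrite !col_mul; congr (_ *m _); apply/colP => a.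
  by rewrite !mxE /mix /J /= (negbTE ij) andbF.
have F0' i : i != j -> F *m col i (A^T *m S') = 0 by move=> ij; rewrite coli// F0.
have := inv_ridge_le e0 fF F0'; rewrite colj -/(ridge_gram A eta S').
have q0 : 0 < invmx (ridge_gram A eta S') j j.
  by apply: pd_diag; apply: pd_inv; exact: pd_ridge_gram.
rewrite mulrC -ler_pdivlMr// mul1r => h.
rewrite /K -scalemxAl dotZr ler_wpM2l//.
apply: le_trans h; rewrite -(mulmxA (A *m _)) -(mulmxA A) [leLHS]dot_mulr.
by rewrite lexx.
Qed.

(** The noise h^T H^-1 h cut off where tr H^-1 is large: there kap times the form
could have no exponential moment.  The cutoff is inactive on the good event. *)
Definition noise_qf n (A : 'M[R]_(m, n)) (e : 'cV[R]_m) (eta kap : R) (S : 'M[R]_(m, s)) : R :=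
  if kap * dot e e * \tr (invmx (ridge_gram A eta S)) <= 2^-1
  then dot (S^T *m e) (invmx (ridge_gram A eta S) *m (S^T *m e)) else 0.

Lemma measurable_noise_qf n (A : 'M[R]_(m, n)) (e : 'cV[R]_m) (eta kap : R) l : 0 < eta ->
  measurable_fun setT (fun x : cfg R I => noise_qf A e eta kap (Smat x l)).
Proof.
move=> e0; have mG := @measurable_mx_inv_ridge _ A eta l e0.
have mS : measurable_mx (fun x : cfg R I => (Smat x l)^T *m e).
  by apply: measurable_mx_mul; [apply: measurable_mx_tr; exact: measurable_mx_Smat|exact: measurable_mx_cst].
apply: measurable_fun_ifT => //.
  by apply: measurable_fun_ler => //; apply: measurable_funM => //; exact: measurable_tr.
by apply: measurable_dot => //; exact: measurable_mx_mul.
Qed.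

Lemma noise_qf_rot n (A : 'M[R]_(m, n)) (e : 'cV[R]_m) (eta kap : R) Gam S :
  Gam^T *m Gam = 1%:M ->
  noise_qf (Gam *m A) (Gam *m e) eta kap (Gam *m S) = noise_qf A e eta kap S.
Proof.
move=> oG.
have e1 p q (U : 'M[R]_(m, p)) (V : 'M[R]_(m, q)) : (Gam *m U)^T *m (Gam *m V) = U^T *m V.
  by rewrite trmx_mul -mulmxA (mulmxA Gam^T) oG mul1mx.
by rewrite /noise_qf /ridge_gram !e1 /dot e1.
Qed.

(** When e is supported on row p, A^T e = 0 forces row p of A to vanish, so that
A^T S, and with it H, does not involve row p of S, while h is e p times that row.
Conditioning on the other rows leaves the exponential moment of a fixed quadratic
form, of trace at most 1/2. *)
Lemma EX_noise1 n (A : 'M[R]_(m, n)) (e : 'cV[R]_m) (eta kap : R) (p : 'I_m) l :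
  0 < eta -> 0 <= kap -> A^T *m e = 0 -> (forall i, i != p -> e i 0 = 0) ->
  (E (fun x => (expR (kap * noise_qf A e eta kap (Smat x l) / 2))%:E) <= (Num.sqrt 2)%:E)%E.
Proof.
move=> eta0 k0 Ae ep.
have m1 : measurable_fun setT (fun x : cfg R I => (expR (kap * noise_qf A e eta kap (Smat x l) / 2))%:E).
  apply/measurable_EFinP; apply: measurableT_comp => //.
  by apply: measurable_funM => //; apply: measurable_funM => //; exact: measurable_noise_qf.
have sq2 : 1 <= Num.sqrt 2 :> R by rewrite -{1}sqrtr1 ler_sqrt// ler1n.
have [a0|a0] := eqVneq (e p 0) 0.
  have e0 : e = 0.
    apply/colP => i; rewrite mxE; have [->//|] := eqVneq i p; exact: ep.
  rewrite (_ : E _ = 1%:E) ?lee_fin// -[RHS](EX_cst P X); apply: eq_EX => x.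
  by rewrite /noise_qf e0 mulmx0 !dot0l if_same mulr0 mul0r expR0.
have Ap a : A p a = 0.
  move/colP/(_ a): Ae; rewrite !mxE (bigD1 p)//= big1 ?addr0; last first.
    by move=> i ip; rewrite ep// mulr0.
  by rewrite mxE => /eqP; rewrite mulf_eq0 (negbTE a0) orbF => /eqP.
have ee : dot e e = e p 0 ^+ 2.
  rewrite dotE (bigD1 p)//= big1 ?addr0 ?expr2// => i ip.
  by rewrite ep// mulr0.
pose J (q : I) := ~~ ((q.1.1 == l) && (q.1.2 == p)).
pose iota (k : 'I_s) : I := (l, p, k).
have inj : injective iota by move=> i i' [].
apply: (EX_mix_le gX (J := J)) => //.
move=> x.
have ASE y : A^T *m Smat (mix J x y) l = A^T *m Smat x l.
  apply/matrixP => a b; rewrite !mxE; apply: eq_bigr => i _.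
  rewrite !mxE /mix /J /=; have [->|ip] := eqVneq i p; first by rewrite Ap !mul0r.
  by rewrite andbF.
have SeE y : (Smat (mix J x y) l)^T *m e = e p 0 *: coords iota y.
  apply/colP => a; rewrite !mxE (bigD1 p)//= big1 ?addr0; last first.
    by move=> i ip; rewrite ep// mulr0.
  by rewrite !mxE /mix /J /= !eqxx mulrC.
set H := invmx (ridge_gram A eta (Smat x l)).
have HE y : invmx (ridge_gram A eta (Smat (mix J x y) l)) = H by rewrite /H /ridge_gram ASE.
have pH : pd H by apply: pd_inv; exact: pd_ridge_gram.
case: (boolP (kap * dot e e * \tr H <= 2^-1)) => trH; last first.
  rewrite (_ : EX _ _ _ = 1%:E) ?lee_fin// -[RHS](EX_cst P X); apply: eq_EX => y.
  by rewrite /noise_qf HE (negbTE trH) mulr0 mul0r expR0.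
pose Nn := (kap * dot e e) *: H.
have c0 : 0 <= kap * dot e e by rewrite mulr_ge0// dot_ge0.
have pN : psd Nn.
  split=> [|z]; first by rewrite linearZ/= pH.1.
  by rewrite -scalemxAl dotZr mulr_ge0// (pd_psd pH).2.
have trN : \tr Nn <= 2^-1 by rewrite mxtraceZ.
have p1N : pd (1%:M + - Nn).
  split=> [|z z0]; first by rewrite linearB/= trmx1 pN.1.
  rewrite mulmxBl mul1mx dotBr subr_gt0.
  apply: le_lt_trans (psd_le_tr z pN) _.
  apply: le_lt_trans (_ : 2^-1 * dot z z < _); first by rewrite ler_wpM2r ?dot_ge0.
  by rewrite gtr_pMl ?dot_gt0// invf_lt1 ?ltr1n.
rewrite (_ : EX _ _ _ = ((Num.sqrt (\det (1%:M + - Nn)))^-1)%:E); last first.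
  rewrite -(EX_quad gX inj p1N); apply: eq_EX => y; congr (expR _)%:E.
  rewrite /noise_qf HE trH SeE -scalemxAr dotZl dotZr mulNmx dotNr /Nn -scalemxAl dotZr.
  by rewrite ee; ring.
have dN : 2^-1 <= \det (1%:M - Nn).
  have h : 2^-1 < 1 :> R by rewrite invf_lt1 ?ltr1n.
  apply: le_trans (det_1B_ge pN (le_lt_trans trN h)).
  by lra.
rewrite lee_fin -[leRHS]invrK lef_pV2 ?posrE ?sqrtr_gt0 ?det_pd ?invr_gt0 ?sqrtr_gt0//.
by rewrite -sqrtrV// ler_sqrt// ltW// det_pd.
Qed.

(** Both A and e are rotated, which changes neither the noise nor the law of S. *)
Lemma EX_noise n (A : 'M[R]_(m, n)) (e : 'cV[R]_m) (eta kap : R) (p : 'I_m) :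
  0 < eta -> 0 <= kap -> A^T *m e = 0 ->
  (E (fun x => (\prod_l expR (kap * noise_qf A e eta kap (Smat x l) / 2))%:E) <=
   (Num.sqrt 2 ^+ N)%:E)%E.
Proof.
move=> eta0 k0 Ae.
have [Gam [oG iG G0]] := exists_rotation gX e p.
have mp n' (B : 'M[R]_(m, n')) f l : measurable_fun setT (fun x : cfg R I =>
    expR (kap * noise_qf B f eta kap (Smat x l) / 2)).
  apply: measurableT_comp => //.
  by apply: measurable_funM => //; apply: measurable_funM => //; exact: measurable_noise_qf.
have mf : measurable_fun setT (fun x : cfg R I =>
   (\prod_l expR (kap * noise_qf (Gam *m A) (Gam *m e) eta kap (Smat x l) / 2))%:E).
  by apply/measurable_EFinP; apply: measurable_prodR => l.
have f0 (x : cfg R I) : (0 <= (\prod_l expR (kap * noise_qf (Gam *m A) (Gam *m e) eta kap (Smat x l) / 2))%:E)%E.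
  by rewrite lee_fin; apply: prodr_ge0 => l _; exact: expR_ge0.
rewrite (_ : E _ = E (fun x =>
   (\prod_l expR (kap * noise_qf (Gam *m A) (Gam *m e) eta kap (Smat x l) / 2))%:E)); last first.
  apply: etrans _ (iG _ mf f0); apply: eq_EX => x; congr EFin; apply: eq_bigr => l _.
  by rewrite Smat_act noise_qf_rot.
apply: (EX_prod gX (phi := fun l S => expR (kap * noise_qf (Gam *m A) (Gam *m e) eta kap S / 2))).
- by rewrite sqrtr_ge0.
- by move=> l; exact: mp.
- by move=> l S; exact: expR_ge0.
- move=> l; apply: (EX_noise1 (p := p)) => //.
  by rewrite trmx_mul -mulmxA (mulmxA Gam^T) oG mul1mx.
Qed.

End Estimates.

(** * Concentration of the entries of the ridge projections *)

(** Real-valued means of bounded nonnegative functions, where linear identities can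
be solved for; signs are handled by adding constants. *)
Section RealMean.
Variables (R : realType) (I : finType).
Context d (T : measurableType d) (P : probability T R) (X : T -> cfg R I).
Hypothesis gX : gaussian_law P X.
Implicit Types f g : cfg R I -> R.

Definition bounded_ge0 f := [/\ measurable_fun setT f, (forall x, 0 <= f x) &
  exists b, forall x, f x <= b].

Definition rmean f : R := fine (EX P X (fun x => (f x)%:E)).

Lemma EX_rmean f : bounded_ge0 f -> EX P X (fun x => (f x)%:E) = (rmean f)%:E.
Proof.
move=> [mf f0 [b fb]]; rewrite /rmean fineK// ge0_fin_numE.
  apply: le_lt_trans (ltry b); rewrite -(EX_cst P X b%:E).
  apply: (le_EX gX) => //; first exact/measurable_EFinP.
by apply: EX_ge0 => x; rewrite lee_fin.
Qed.

Lemma rmean_ge0 f : (forall x, 0 <= f x) -> 0 <= rmean f.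
Proof. by move=> f0; apply: fine_ge0; apply: EX_ge0 => x; rewrite lee_fin. Qed.

Lemma le_rmean f g : bounded_ge0 f -> bounded_ge0 g -> (forall x, f x <= g x) -> rmean f <= rmean g.
Proof.
move=> bf bg fg; rewrite -lee_fin -!EX_rmean//.
case: bf bg => mf f0 _ [mg g0 _].
by apply: (le_EX gX) => //; exact/measurable_EFinP.
Qed.

Lemma rmean_cst c : rmean (fun=> c) = c.
Proof. by rewrite /rmean EX_cst. Qed.

Lemma bounded_ge0_cst c : 0 <= c -> bounded_ge0 (fun=> c).
Proof. by move=> c0; split=> //; exists c. Qed.

Lemma bounded_ge0D f g : bounded_ge0 f -> bounded_ge0 g -> bounded_ge0 (fun x => f x + g x).
Proof.
move=> [mf f0 [b fb]] [mg g0 [c gc]]; split.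
- exact: measurable_funD.
- by move=> x; rewrite addr_ge0.
- by exists (b + c) => x; rewrite lerD.
Qed.

Lemma bounded_ge0Z c f : 0 <= c -> bounded_ge0 f -> bounded_ge0 (fun x => c * f x).
Proof.
move=> c0 [mf f0 [b fb]]; split.
- exact: measurable_funM.
- by move=> x; rewrite mulr_ge0.
- by exists (c * b) => x; rewrite ler_wpM2l.
Qed.

Lemma rmeanD f g : bounded_ge0 f -> bounded_ge0 g -> rmean (fun x => f x + g x) = rmean f + rmean g.
Proof.
move=> bf bg; apply: EFin_inj; rewrite EFinD -!EX_rmean//; last exact: bounded_ge0D.
case: bf bg => mf f0 _ [mg g0 _].
rewrite -(EXD gX) //; first exact/measurable_EFinP.
exact/measurable_EFinP.
Qed.

Lemma rmeanZ c f : 0 <= c -> bounded_ge0 f -> rmean (fun x => c * f x) = c * rmean f.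
Proof.
move=> c0 bf; apply: EFin_inj; rewrite EFinM -!EX_rmean//; last exact: bounded_ge0Z.
case: bf => mf f0 _.
by rewrite -(EXZ gX)//; exact/measurable_EFinP.
Qed.

Lemma bounded_ge0_sum (J : Type) (r : seq J) (F : J -> cfg R I -> R) :
  (forall j, bounded_ge0 (F j)) -> bounded_ge0 (fun x => \sum_(j <- r) F j x).
Proof.
move=> bF; elim: r => [|a r IH].
  by under eq_fun do rewrite big_nil; exact: bounded_ge0_cst.
by under eq_fun do rewrite big_cons; exact: bounded_ge0D.
Qed.

Lemma rmean_sum (J : Type) (r : seq J) (F : J -> cfg R I -> R) :
  (forall j, bounded_ge0 (F j)) -> rmean (fun x => \sum_(j <- r) F j x) = \sum_(j <- r) rmean (F j).
Proof.
move=> bF; elim: r => [|a r IH].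
  by under eq_fun do rewrite big_nil; rewrite big_nil rmean_cst.
under eq_fun do rewrite big_cons; rewrite big_cons -IH rmeanD//; exact: bounded_ge0_sum.
Qed.

Lemma eq_rmean f g : f =1 g -> rmean f = rmean g.
Proof. by move=> /funext ->. Qed.

End RealMean.

Section Moments.
Variables (R : realType) (N m s : nat).
Let I : finType := ('I_N * 'I_m * 'I_s)%type.
Context d (T : measurableType d) (P : probability T R) (X : T -> cfg R I).
Hypothesis gX : gaussian_law P X.
Variables (eta : R) (l : 'I_N).
Hypothesis eta0 : 0 < eta.
Let E := rmean P X.
Let prj (x : cfg R I) i j := ridge_proj eta (Smat x l) i j.

Lemma measurable_ridge_proj i j : measurable_fun setT (fun x => prj x i j).
Proof.
have mS := @measurable_mx_Smat R N m s l.
apply: measurable_mx_mul; last exact: measurable_mx_tr.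
apply: measurable_mx_mul => //; apply: measurable_mx_inv => [|x]; last by apply: pd_unit; exact: pd_ridge.
by apply: measurable_mx_add; [apply: measurable_mx_mul => //; exact: measurable_mx_tr|exact: measurable_mx_cst].
Qed.

Lemma bounded_ge0_diag i : bounded_ge0 (fun x => prj x i i).
Proof.
split; first exact: measurable_ridge_proj.
- by move=> x; apply: psd_diag; exact: psd_ridge_proj.
- by exists 1 => x; exact: ridge_proj_diag_le1.
Qed.

Lemma bounded_ge0_sqr i j : bounded_ge0 (fun x => prj x i j ^+ 2).
Proof.
split; first by apply: measurable_funX; exact: measurable_ridge_proj.
- by move=> x; rewrite sqr_ge0.
- exists 1 => x; rewrite -real_normK ?num_real// expr_le1//.
  exact: ridge_proj_entry_le1.
Qed.

Lemma ridge_proj_rot (Gam : 'M[R]_m) (S : 'M[R]_(m, s)) : Gam^T *m Gam = 1%:M ->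
  ridge_proj eta (Gam *m S) = Gam *m ridge_proj eta S *m Gam^T.
Proof.
move=> oG; rewrite /ridge_proj trmx_mul -(mulmxA S^T) (mulmxA Gam^T) oG mul1mx.
by rewrite !mulmxA.
Qed.

(** The quarter turn of rows i and j: it exchanges the diagonal entries i and j of a
symmetric matrix and changes the sign of the entry (i, j). *)
Definition turn i j : 'M[R]_m := givens 0 1 i j.

Lemma turn_cs : 0 ^+ 2 + 1 ^+ 2 = 1 :> R.
Proof. by rewrite expr0n expr1n add0r. Qed.

Lemma turnE (M : 'M[R]_m) i j : i != j -> M^T = M ->
  let M' := turn i j *m M *m (turn i j)^T in
  [/\ M' i i = M j j, M' i j = - M i j &
      forall k, k != i -> k != j -> M' k i = M k j].
Proof.
move=> ij sM /=; rewrite -mulmxA /turn mul_givens.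
have MT : M *m (givens 0 1 i j)^T = (givens_rows 0 1 i j M)^T.
  by rewrite -mul_givens trmx_mul sM.
have MS a b : M a b = M b a by rewrite -{1}sM mxE.
rewrite MT; split.
- by rewrite !mxE !eqxx (negbTE ij) !mul0r !mul1r !add0r.
- by rewrite !mxE !eqxx (negbTE ij) !mul0r !mul1r !sub0r.
- move=> k ki kj; rewrite !mxE (negbTE ki) (negbTE kj) !eqxx (negbTE ij).
  rewrite !mul0r !mul1r !add0r; exact: MS.
Qed.

Lemma rmean_turn i j f : i != j -> bounded_ge0 f -> E (fun x => f (act (turn i j) x)) = E f.
Proof.
move=> ij [mf f0 _]; rewrite /E /rmean; congr fine.
apply: (invariant_givens gX ij turn_cs (oner_neq0 _)) => //.
exact/measurable_EFinP.
Qed.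

Lemma prj_turn i j x : i != j ->
  [/\ prj (act (turn i j) x) i i = prj x j j,
      prj (act (turn i j) x) i j = - prj x i j &
      forall k, k != i -> k != j -> prj (act (turn i j) x) k i = prj x k j].
Proof.
move=> ij; rewrite /prj Smat_act ridge_proj_rot ?(givens_orth ij turn_cs)//.
by apply: turnE => //; exact: trmx_ridge_proj.
Qed.

Lemma rmean_diag_eq i j : E (fun x => prj x i i) = E (fun x => prj x j j).
Proof.
have [->//|ij] := eqVneq i j.
rewrite -(rmean_turn ij (bounded_ge0_diag i)); apply: eq_rmean => x.
by case: (prj_turn x ij).
Qed.

Lemma rmean_sqr_eq k i j : k != i -> k != j -> E (fun x => prj x k i ^+ 2) = E (fun x => prj x k j ^+ 2).
Proof.
move=> ki kj; have [->//|ij] := eqVneq i j.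
rewrite -(rmean_turn ij (bounded_ge0_sqr k i)); apply: eq_rmean => x.
by case: (prj_turn x ij) => _ _ ->.
Qed.

Lemma rmean_diag_le i : E (fun x => prj x i i) <= s%:R / m%:R.
Proof.
have m0 : (0 < m)%N by case: (m) i => [[]|].
rewrite ler_pdivlMr ?ltr0n//.
have -> : E (fun x => prj x i i) * m%:R = E (fun x => \tr (ridge_proj eta (Smat x l))).
  rewrite /E rmean_sum//; last exact: bounded_ge0_diag.
  rewrite (eq_bigr (fun=> E (fun x => prj x i i))); last by move=> j _; exact: rmean_diag_eq.
  by rewrite sumr_const card_ord mulr_natr.
rewrite -[leRHS](rmean_cst P X); apply: (le_rmean gX).
- by apply: bounded_ge0_sum => j; exact: bounded_ge0_diag.
- exact: bounded_ge0_cst.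
move=> x; rewrite -(tr_ridge_proj (Smat x l) eta0) lerDl.
apply: mulr_ge0; first exact: ltW.
by apply: psd_tr_ge0; apply: pd_psd; apply: pd_inv; exact: pd_ridge.
Qed.

(** The m diagonal entries have the same mean and add up to the trace. *)
Lemma rmean_diag_ge i (dl : R) :
  (forall j, (EX P X (fun x => (eta * invmx ((Smat x l)^T *m Smat x l + eta%:M) j j)%:E) <= dl%:E)%E) ->
  (1 - dl) * (s%:R / m%:R) <= E (fun x => prj x i i).
Proof.
move=> hdl; have m0 : (0 < m)%N by case: (m) i => [[]|].
have q0 (x : cfg R I) j : 0 <= invmx ((Smat x l)^T *m Smat x l + eta%:M) j j.
  by apply: psd_diag; apply: pd_psd; apply: pd_inv; exact: pd_ridge.
have trq (x : cfg R I) : 0 <= \tr (ridge_proj eta (Smat x l)) by apply: psd_tr_ge0; exact: psd_ridge_proj.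
have bq j : bounded_ge0 (fun x : cfg R I => eta * invmx ((Smat x l)^T *m Smat x l + eta%:M) j j).
  have mS := @measurable_mx_Smat R N m s l.
  split.
  - apply: measurable_funM => //; apply: measurable_mx_inv => [|x].
      by apply: measurable_mx_add; [apply: measurable_mx_mul => //; exact: measurable_mx_tr|exact: measurable_mx_cst].
    by apply: pd_unit; exact: pd_ridge.
  - by move=> x; rewrite mulr_ge0// ltW.
  - exists s%:R => x; rewrite -(tr_ridge_proj (Smat x l) eta0) ler_wpDl//.
    by rewrite ler_pM2l// /mxtrace (bigD1 j)//= lerDl sumr_ge0.
have : s%:R = E (fun x => \tr (ridge_proj eta (Smat x l))) +
   \sum_j E (fun x => eta * invmx ((Smat x l)^T *m Smat x l + eta%:M) j j).
  rewrite /E -(rmean_sum gX)// -(rmeanD gX).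
  - rewrite -[LHS](rmean_cst P X); apply: eq_rmean => x.
    by rewrite -(tr_ridge_proj (Smat x l) eta0) /mxtrace mulr_sumr.
  - by apply: bounded_ge0_sum => j; exact: bounded_ge0_diag.
  - exact: bounded_ge0_sum.
have -> : E (fun x => \tr (ridge_proj eta (Smat x l))) = E (fun x => prj x i i) * m%:R.
  rewrite /E rmean_sum//; last exact: bounded_ge0_diag.
  rewrite (eq_bigr (fun=> E (fun x => prj x i i))); last by move=> j _; exact: rmean_diag_eq.
  by rewrite sumr_const card_ord mulr_natr.
have h : \sum_(j < s) E (fun x => eta * invmx ((Smat x l)^T *m Smat x l + eta%:M) j j) <= dl * s%:R.
  rewrite mulr_natr -[X in _ <= _ *+ X](card_ord s) -sumr_const; apply: ler_sum => j _.
  by rewrite -lee_fin /E -EX_rmean.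
move=> e; rewrite mulrA ler_pdivrMr ?ltr0n//; lra.
Qed.

(** The m - 1 off-diagonal entries of row i have the same second moment, and their
squares add up to at most Pi i i, whose mean is at most s/m. *)
Lemma rmean_offdiag_le i j : i != j -> E (fun x => prj x i j ^+ 2) <= s%:R / (m%:R * (m%:R - 1)).
Proof.
move=> ij.
have m1 : (1 < m)%N.
  rewrite ltnNge; apply: contra ij => m1; rewrite -val_eqE /=.
  have := ltn_ord i; have := ltn_ord j; lia.
have m1' : 0 < m%:R - 1 :> R by rewrite subr_gt0 ltr1n.
have : E (fun x => prj x i j ^+ 2) * (m%:R - 1) <= s%:R / m%:R.
  apply: le_trans (rmean_diag_le i).
  have -> : E (fun x => prj x i j ^+ 2) * (m%:R - 1) = \sum_(k | k != i) E (fun x => prj x i k ^+ 2).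
    rewrite (eq_bigr (fun=> E (fun x => prj x i j ^+ 2))); last first.
      by move=> k ki; apply: rmean_sqr_eq => //; rewrite eq_sym.
    by rewrite sumr_const cardC1 card_ord -[in RHS]mulr_natr -subn1 natrB ?(ltnW m1).
  apply: le_trans (_ : E (fun x => \sum_k prj x i k ^+ 2) <= _).
    rewrite /E rmean_sum//; last by move=> k; exact: bounded_ge0_sqr.
    by rewrite [leRHS](bigD1 i)//= lerDr; apply: rmean_ge0 => x; rewrite sqr_ge0.
  apply: (le_rmean gX).
  - by apply: bounded_ge0_sum => k; exact: bounded_ge0_sqr.
  - exact: bounded_ge0_diag.
  - by move=> x; exact: ridge_proj_row_sqr.
by rewrite -ler_pdivlMr// => h; apply: le_trans h _; rewrite invfM mulrA.
Qed.

(** From exp(-y) >= 1 - y one gets exp y <= 1/(1 - y), and 1/(1 - y) is at most the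
right-hand side for y <= 1/2. *)
Lemma expR_le_quad (y : R) : y <= 2^-1 -> expR y <= 1 + y + 2 * y ^+ 2.
Proof.
move=> y2; have h : 0 < 1 - y by lra.
have := expR_ge1Dx (- y); rewrite expRN => h2.
have e0 := expR_gt0 y.
have : expR y <= (1 - y)^-1 by rewrite -[leLHS]invrK lef_pV2 ?posrE ?invr_gt0.
move/le_trans; apply; rewrite -[leLHS]mul1r ler_pdivrMr//.
have : 0 <= y ^+ 2 * (1 - 2 * y) by rewrite mulr_ge0 ?sqr_ge0//; lra.
by lra.
Qed.

(** The linear term of expR_le_quad has mean zero.  As the quarter turn maps one sign
of the quadratic bound to the other, both bounds have the same mean, and their sum
has no linear term; both are nonnegative, unlike Pi i j itself. *)
Lemma EX_exp_offdiag i j (lam : R) : i != j -> `|lam| <= 2^-1 ->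
  (EX P X (fun x => (expR (lam * prj x i j))%:E) <=
   (expR (2 * lam ^+ 2 * (s%:R / (m%:R * (m%:R - 1)))))%:E)%E.
Proof.
move=> ij lam2.
pose f sg (x : cfg R I) := 1 + sg * (lam * prj x i j) + 2 * (lam ^+ 2 * prj x i j ^+ 2).
have p1 x : `|lam * prj x i j| <= 2^-1.
  rewrite normrM -[leRHS]mulr1 ler_pM//; exact: ridge_proj_entry_le1.
have p1' x : - 2^-1 <= lam * prj x i j <= 2^-1 by rewrite -ler_norml.
have bf sg : sg = 1 \/ sg = -1 -> bounded_ge0 (f sg).
  move=> hsg; split.
  - apply: measurable_funD; last first.
      apply: measurable_funM => //; apply: measurable_funM => //.
      by apply: measurable_funX; exact: measurable_ridge_proj.
    apply: measurable_funD => //; apply: measurable_funM => //.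
    by apply: measurable_funM => //; exact: measurable_ridge_proj.
  - move=> x; rewrite /f -exprMn; have := p1' x; set y := lam * _.
    by case: hsg => ->; have := sqr_ge0 y; lra.
  - exists (1 + 2^-1 + 2 * lam ^+ 2) => x; rewrite /f.
    have h : prj x i j ^+ 2 <= 1.
      by rewrite -real_normK ?num_real// expr_le1//; exact: ridge_proj_entry_le1.
    have h2 : lam ^+ 2 * prj x i j ^+ 2 <= lam ^+ 2 by rewrite ler_piMr ?sqr_ge0.
    by have := p1' x; case: hsg => ->; lra.
have bp : bounded_ge0 (f 1) by apply: bf; left.
have bm : bounded_ge0 (f (-1)) by apply: bf; right.
have epm : E (f (-1)) = E (f 1).
  rewrite -(rmean_turn ij bp); apply: eq_rmean => x.
  by rewrite /f; case: (prj_turn x ij) => _ -> _; rewrite sqrrN; ring.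
have c4 : 0 <= 4 * lam ^+ 2 by rewrite pmulr_rge0// sqr_ge0.
have c2 : 0 <= 2 * lam ^+ 2 by rewrite pmulr_rge0// sqr_ge0.
have e2 : E (f 1) + E (f (-1)) = 2 + 4 * lam ^+ 2 * E (fun x => prj x i j ^+ 2).
  rewrite /E -(rmeanD gX)// -(rmeanZ gX c4); last exact: bounded_ge0_sqr.
  rewrite -[X in X + _](rmean_cst P X) -(rmeanD gX).
  - by apply: eq_rmean => x; rewrite /f; ring.
  - exact: bounded_ge0_cst.
  - by apply: bounded_ge0Z => //; exact: bounded_ge0_sqr.
suff hE : (EX P X (fun x => (expR (lam * prj x i j))%:E) <= (E (f 1))%:E)%E.
    apply: (le_trans hE); rewrite lee_fin; apply: le_trans (expR_ge1Dx _).
  have -> : E (f 1) = 1 + 2 * lam ^+ 2 * E (fun x => prj x i j ^+ 2) by lra.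
  by rewrite lerD2l ler_wpM2l// rmean_offdiag_le.
  rewrite /E -EX_rmean//; apply: (le_EX gX).
  - apply/measurable_EFinP; apply: measurableT_comp => //.
    by apply: measurable_funM => //; exact: measurable_ridge_proj.
  - by apply/measurable_EFinP; case: bp.
  - by move=> x; rewrite lee_fin expR_ge0.
  - move=> x; rewrite lee_fin; apply: le_trans (expR_le_quad _) _.
      by case/andP: (p1' x).
    by rewrite /f mul1r exprMn.
Qed.

Lemma EX_exp_diag i (mu : R) : mu <= E (fun x => prj x i i) ->
  (EX P X (fun x => (expR (- (prj x i i / 8)))%:E) <= (expR (- (3 / 32 * mu)))%:E)%E.
Proof.
move=> muE.
(* For y = - p / 8 with 0 <= p <= 1, 1 + y + 2 y^2 <= 1 - p / 8 + p / 32. *)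
pose f (x : cfg R I) := 1 - 3 / 32 * prj x i i.
have bpi := bounded_ge0_diag i.
have p0 x : 0 <= prj x i i by case: bpi.
have p1 x : prj x i i <= 1 by exact: ridge_proj_diag_le1.
have bf : bounded_ge0 f.
  split.
  - apply: measurable_funB => //; apply: measurable_funM => //; exact: measurable_ridge_proj.
  - by move=> x; rewrite /f; have := p1 x; lra.
  - by exists 1 => x; rewrite /f; have := p0 x; lra.
have c332 : 0 <= 3 / 32 :> R by lra.
have e1 : E f + 3 / 32 * E (fun x => prj x i i) = 1.
  rewrite /E -(rmeanZ gX c332)//.
  rewrite -(rmeanD gX)//; last exact: bounded_ge0Z.
  by rewrite -[RHS](rmean_cst P X); apply: eq_rmean => x; rewrite /f subrK.
suff hE : (EX P X (fun x => (expR (- (prj x i i / 8)))%:E) <= (E f)%:E)%E.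
  apply: (le_trans hE); rewrite lee_fin; apply: le_trans (expR_ge1Dx _).
  by lra.
  rewrite /E -EX_rmean//; apply: (le_EX gX).
  - apply/measurable_EFinP; apply: measurableT_comp => //.
    by apply: measurable_funN; apply: measurable_funM => //; exact: measurable_ridge_proj.
  - by apply/measurable_EFinP; case: bf.
  - by move=> x; rewrite lee_fin expR_ge0.
  - move=> x; rewrite lee_fin; apply: le_trans (expR_le_quad _) _.
      by have := p0 x; lra.
    by rewrite /f; have := p0 x; have := p1 x; nra.
Qed.

End Moments.

(** * Deterministic consequences of the good event *)

Section Gershgorin.
Variable R : realType.

(** Bounds all off-diagonal products by |2 z_i z_j| <= z_i^2 + z_j^2. *)
Lemma gershgorin_ge m (B : 'M[R]_m) (th u : R) z : 0 <= u ->
  (forall i, th <= B i i) -> (forall i j, i != j -> `|B i j| <= u) ->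
  (th - (m%:R - 1) * u) * dot z z <= dot z (B *m z).
Proof.
move=> u0 hd ho.
have -> : dot z (B *m z) = \sum_i \sum_j B i j * (z i 0 * z j 0).
  rewrite dotE; apply: eq_bigr => i _; rewrite mxE mulr_sumr; apply: eq_bigr => j _; ring.
have key i : (th + u) * z i 0 ^+ 2 - u / 2 * (\sum_j (z i 0 ^+ 2 + z j 0 ^+ 2)) <=
    \sum_j B i j * (z i 0 * z j 0).
  rewrite (bigD1 i)//= [leRHS](bigD1 i)//= mulrDr mulr_sumr.
  have h : - (\sum_(j | j != i) u / 2 * (z i 0 ^+ 2 + z j 0 ^+ 2)) <=
      \sum_(j | j != i) B i j * (z i 0 * z j 0).
    rewrite -sumrN; apply: ler_sum => j ji; rewrite lerNl.
    have h1 : - (B i j * (z i 0 * z j 0)) <= u * `|z i 0 * z j 0|.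
      apply: le_trans (ler_norm _) _; rewrite normrN normrM ler_wpM2r//.
      by apply: ho; rewrite eq_sym.
    apply: le_trans h1 _; rewrite -mulrA ler_wpM2l//.
    have h3 := sqr_ge0 (z i 0 - z j 0); have h4 := sqr_ge0 (z i 0 + z j 0).
    have e3 : (z i 0 - z j 0) ^+ 2 = z i 0 ^+ 2 + z j 0 ^+ 2 - 2 * (z i 0 * z j 0) by ring.
    have e4 : (z i 0 + z j 0) ^+ 2 = z i 0 ^+ 2 + z j 0 ^+ 2 + 2 * (z i 0 * z j 0) by ring.
    rewrite e3 in h3; rewrite e4 in h4.
    by rewrite ler_norml; apply/andP; split; lra.
  have hi : th * z i 0 ^+ 2 <= B i i * (z i 0 * z i 0).
    by rewrite -expr2 ler_wpM2r ?sqr_ge0.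
  lra.
apply: le_trans (ler_sum _ (fun i _ => key i)).
rewrite sumrB -!mulr_sumr.
have -> : \sum_i z i 0 ^+ 2 = dot z z by rewrite dotE; apply: eq_bigr => i _; rewrite expr2.
under eq_bigr => i _ do rewrite big_split /= sumr_const card_ord.
rewrite big_split /= sumr_const card_ord.
under eq_bigr => i _ do rewrite -mulr_natr.
rewrite -mulr_suml.
have -> : \sum_i z i 0 ^+ 2 = dot z z by rewrite dotE; apply: eq_bigr => i _; rewrite expr2.
by rewrite -(mulr_natr (dot z z)); apply: le_of_eq; field.
Qed.

End Gershgorin.

Section Deterministic.
Variables (R : realType) (m n s N : nat) (A : 'M[R]_(m, n)) (b : 'cV[R]_m) (xs : 'cV[R]_n).
Variable (S : 'I_N -> 'M[R]_(m, s)).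
Variables (g eta1 : R).
Hypotheses (nm : (n <= m)%N) (rA : \rank A = n).
Hypotheses (s0 : (0 < s)%N) (sn : (s < n)%N) (N0 : (0 < N)%N) (g0 : 0 < g) (eta10 : 0 < eta1).

Let e := A *m xs - b.
(** On the good event every 1/(H^-1)_jj is at least tail_level, so that tr H^-1 is at
most s / tail_level.  Given this bound, ridge_param is the largest ridge for which
2 eta tr H^-1 <= 1 is guaranteed, and noise_scale the largest factor kap for which
kap |e|^2 tr H^-1 <= 1/2 is.  The factor 1/8
leaves room in the exponent of the lower tail. *)
Definition tail_level := sigma_min A ^+ 2 * g / 8.
Definition ridge_param := tail_level / (2 * s%:R).
Definition noise_scale := tail_level / (2 * s%:R * dot (A *m xs - b) (A *m xs - b)).

Hypothesis Hq : forall l j, invmx (ridge_gram A ridge_param (S l)) j j <= tail_level^-1.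
Hypothesis Hn : noise_scale * (\sum_l noise_qf A (A *m xs - b) ridge_param noise_scale (S l)) <= 2 * N%:R.
Hypothesis Hd : forall i, N%:R * (9 / 20 * (s%:R / m%:R)) <= \sum_l ridge_proj eta1 (S l) i i.
Hypothesis Ho : forall i j, i != j ->
  `|\sum_l ridge_proj eta1 (S l) i j| <= N%:R * (2 / 5 * (s%:R / (m%:R * (m%:R - 1)))).

Let n0 : (0 < n)%N. Proof. exact: leq_ltn_trans sn. Qed.
Let m1 : (1 < m)%N.
Proof. by apply: leq_trans nm; apply: leq_trans sn; rewrite ltnS. Qed.
Let smin0 : 0 < sigma_min A. Proof. exact: sigma_min_gt0. Qed.
Let sR : 0 < s%:R :> R. Proof. by rewrite ltr0n. Qed.
Let mR : 0 < m%:R :> R. Proof. by rewrite ltr0n ltnW. Qed.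
Let m1R : 0 < m%:R - 1 :> R. Proof. by rewrite subr_gt0 ltr1n. Qed.
Let NR : 0 < N%:R :> R. Proof. by rewrite ltr0n. Qed.
Let rho0 : 0 < tail_level. Proof. by rewrite /tail_level divr_gt0// mulr_gt0// exprn_gt0. Qed.
Let eta0 : 0 < ridge_param. Proof. by rewrite /ridge_param divr_gt0// mulr_gt0. Qed.

Lemma sigma_max_sqr_gt0 : 0 < sigma_max A ^+ 2.
Proof. by apply: lt_le_trans (sigma_min_le_max A n0); rewrite exprn_gt0. Qed.

(** Gershgorin with diagonal 9/20 s/m and row sums 2/5 s/m leaves s/(20 m). *)
Lemma avg_ridge_proj z : N%:R * (s%:R / (36 * m%:R)) * dot z z <=
  \sum_l dot z (ridge_proj eta1 (S l) *m z).
Proof.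
have -> : \sum_l dot z (ridge_proj eta1 (S l) *m z) = dot z ((\sum_l ridge_proj eta1 (S l)) *m z).
  rewrite mulmx_suml dotE; under [RHS]eq_bigr do rewrite summxE mulr_sumr.
  by rewrite exchange_big; apply: eq_bigr => l _; rewrite dotE.
pose u : R := N%:R * (2 / 5 * (s%:R / (m%:R * (m%:R - 1)))).
have u0 : 0 <= u by rewrite /u !mulr_ge0// invr_ge0 mulr_ge0// ltW.
apply: le_trans (@gershgorin_ge _ _ _ (N%:R * (9 / 20 * (s%:R / m%:R))) u z u0 _ _).
- rewrite ler_wpM2r ?dot_ge0// /u.
  have -> : (m%:R - 1) * (N%:R * (2 / 5 * (s%:R / (m%:R * (m%:R - 1))))) =
    N%:R * (2 / 5 * (s%:R / m%:R)) :> R.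
    by field; rewrite !gt_eqF.
  have -> : s%:R / (36 * m%:R) = 36^-1 * (s%:R / m%:R) :> R by field; rewrite gt_eqF.
  have p : 0 < N%:R * (s%:R / m%:R) :> R by rewrite mulr_gt0// divr_gt0.
  lra.
- by move=> i; rewrite summxE.
- by move=> i j ij; rewrite summxE; exact: Ho.
Qed.

Let P l := Defs.pinv ((S l)^T *m A) *m ((S l)^T *m A).

Lemma avg_kaczmarz_proj v : N%:R * (s%:R / (36 * m%:R * kappa2 A)) * dot v v <=
  \sum_l dot (P l *m v) (P l *m v).
Proof.
have smx := sigma_max_sqr_gt0.
have h : sigma_min A ^+ 2 * (N%:R * (s%:R / (36 * m%:R))) * dot v v <=
    sigma_max A ^+ 2 * \sum_l dot (P l *m v) (P l *m v).
  apply: le_trans (_ : N%:R * (s%:R / (36 * m%:R)) * dot (A *m v) (A *m v) <= _).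
    rewrite -mulrA mulrCA; apply: ler_wpM2l; last exact: sigma_min_le.
    by rewrite mulr_ge0// divr_ge0// mulr_ge0// ltW.
  apply: le_trans (avg_ridge_proj (A *m v)) _.
  rewrite mulr_sumr; apply: ler_sum => l _; exact: proj_ge.
rewrite -(ler_pM2l smx); apply: le_trans h; apply: le_of_eq.
rewrite /kappa2; move: smx (smin0); move: (sigma_max A) (sigma_min A) => p q.
rewrite exprn_even_gt0//= => pn qp.
by field; rewrite pn !gt_eqF.
Qed.

(** The ridge costs a factor 2 and the mean of noise_scale times the form is at most
2; dividing by noise_scale = sigma_min^2 g / (16 s |e|^2) gives 64. *)
Lemma avg_noise :
  \sum_l dot (Defs.pinv ((S l)^T *m A) *m ((S l)^T *m e)) (Defs.pinv ((S l)^T *m A) *m ((S l)^T *m e))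
  <= N%:R * (64 * s%:R * dot e e / (sigma_min A ^+ 2 * g)).
Proof.
have trH l : \tr (invmx (ridge_gram A ridge_param (S l))) <= s%:R / tail_level.
  rewrite /mxtrace mulrC mulr_natr -[X in _ <= _ *+ X](card_ord s) -sumr_const.
  by apply: ler_sum.
have et : 2 * ridge_param * (s%:R / tail_level) <= 1.
  apply: le_of_eq; rewrite /ridge_param; move: rho0; move: tail_level => r r0.
  by field; rewrite !gt_eqF.
have h1 l : dot (Defs.pinv ((S l)^T *m A) *m ((S l)^T *m e)) (Defs.pinv ((S l)^T *m A) *m ((S l)^T *m e))
    <= 2 * noise_qf A e ridge_param noise_scale (S l).
  rewrite /noise_qf ifT; first exact: (pinv_noise _ eta0 et (trH l)).
  have [e0|e0] := eqVneq (dot e e) 0; first by rewrite e0 mulr0 mul0r invr_ge0.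
  have -> : noise_scale * dot e e = tail_level / (2 * s%:R).
    rewrite /noise_scale -/e; move: e0 tail_level; move: (dot e e) => w w0 r.
    by field; rewrite w0 gt_eqF.
  apply: le_trans (_ : tail_level / (2 * s%:R) * (s%:R / tail_level) <= _).
    by rewrite ler_wpM2l// divr_ge0 ?mulr_ge0// ltW.
  move: rho0; move: tail_level => r r0.
  by apply: le_of_eq; field; rewrite !gt_eqF.
have [e0|e0] := eqVneq (dot e e) 0.
  have e00 : e = 0 by apply/eqP; rewrite -dot_eq0 e0.
  rewrite e0 mulr0 mul0r mulr0 big1// => l _.
  by rewrite e00 !mulmx0 dot0l.
have ep : 0 < dot e e by rewrite lt_def e0 dot_ge0.
have kp : 0 < noise_scale by rewrite /noise_scale divr_gt0// !mulr_gt0.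
apply: le_trans (ler_sum _ (fun l _ => h1 l)) _.
rewrite -mulr_sumr -(ler_pM2l kp) mulrCA.
apply: le_trans (_ : 2 * (2 * N%:R) <= _); first by rewrite ler_pM2l//.
apply: le_of_eq; rewrite /noise_scale -/e /tail_level.
move: (smin0) ep; move: (sigma_min A) (dot e e) => p q p0 q0.
by field; rewrite !gt_eqF.
Qed.

(** The constant is 2304 = 64 * 36: the noise bound divided by the contraction rate. *)
Lemma kaczmarz_bound x0 k :
  expect_choices (fun t : k.-tuple 'I_N => l2norm (kaczmarz_iter A b S x0 t - xs) ^+ 2) <=
  (1 - s%:R / (36 * m%:R * kappa2 A)) ^+ k * l2norm (x0 - xs) ^+ 2 +
  2304 * m%:R * kappa2 A / sigma_min A ^+ 2 * (l2norm e ^+ 2 / g).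
Proof.
have smx := sigma_max_sqr_gt0.
have smm := sigma_min_le_max A n0.
have k2 : 1 <= kappa2 A by rewrite /kappa2 ler_pdivlMr ?mul1r// exprn_gt0.
set q := s%:R / (36 * m%:R * kappa2 A).
have kp : 0 < kappa2 A by lra.
have k0 : 0 < 36 * m%:R * kappa2 A by apply: mulr_gt0 => //; apply: mulr_gt0.
have q0 : 0 < q by apply: divr_gt0.
have q1 : q <= 1.
  rewrite /q ler_pdivrMr// mul1r.
  have sm : s%:R <= m%:R :> R by rewrite ler_nat ltnW// (leq_trans sn).
  by nra.
set nu := 64 * s%:R * dot e e / (sigma_min A ^+ 2 * g).
have nu0 : 0 <= nu.
  by rewrite /nu divr_ge0// ?mulr_ge0 ?dot_ge0// ?sqr_ge0// ltW.
have -> : 2304 * m%:R * kappa2 A / sigma_min A ^+ 2 * (l2norm e ^+ 2 / g) = nu / q.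
  rewrite l2norm_dot /nu /q; move: (smin0) kp; move: (sigma_min A) (dot e e) (kappa2 A).
  by move=> p w k2' p0 k0'; field; rewrite !gt_eqF.
apply: expect_choices_bound => //; first by rewrite q0.
move=> x; rewrite ler_pdivrMr//.
under eq_bigr do rewrite kaczmarz_err.
rewrite big_split /= sumrB sumr_const card_ord.
have h1 := avg_kaczmarz_proj (x - xs); have h2 := avg_noise.
rewrite -/q in h1; rewrite -/nu -/e in h2; rewrite -/e -mulr_natr.
lra.
Qed.

End Deterministic.

(** * Exponential moments of the failure terms *)

Section Numeric.
Variable R : realType.

Lemma expR1_ge2 : 2 <= expR 1 :> R.
Proof. by have := expR_ge1Dx (1 : R); lra. Qed.

Lemma expR1_le4 : expR 1 <= 4 :> R.
Proof.
have h : expR (2^-1) <= 2 :> R.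
  by apply: le_trans (expR_le_quad _) _ => //; lra.
have -> : (1 : R) = 2^-1 + 2^-1 by lra.
have h0 := expR_gt0 (2^-1 : R); rewrite expRD; nra.
Qed.

Lemma sqrt_expR (x : R) : Num.sqrt (expR x) = expR (x / 2).
Proof.
have -> : expR x = expR (x / 2) ^+ 2 by rewrite expr2 -expRD; congr expR; lra.
by rewrite sqrtr_sqr ger0_norm// expR_ge0.
Qed.

Lemma ln_ge_half (m : nat) : (1 < m)%N -> 2^-1 <= ln m%:R :> R.
Proof.
move=> m1; have m0 : 0 < m%:R :> R by rewrite ltr0n ltnW.
have := expR_ge1Dx (- ln m%:R : R); rewrite expRN lnK ?posrE// => h.
have : m%:R^-1 <= 2^-1 :> R by rewrite lef_pV2 ?posrE// ler_nat.
lra.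
Qed.

End Numeric.

Section Terms.
Variables (R : realType) (N m s : nat).
Let I : finType := ('I_N * 'I_m * 'I_s)%type.
Context d (T : measurableType d) (P : probability T R) (X : T -> cfg R I).
Hypothesis gX : gaussian_law P X.
Let E := EX P X.

(** The good event is defined by a measurable function of the sketching matrices,
hence is measurable itself. *)
Lemma markov_lt (f : cfg R I -> R) (p : R) : measurable_fun setT f ->
  (forall x, 0 <= f x) -> (E (fun x => (f x)%:E) <= p%:E)%E ->
  measurable [set w | f (X w) < 1] /\ ((1 - p)%:E <= P [set w | (f (X w) < 1)%R])%E.
Proof.
move=> mf f0 Ef.
have mfX : measurable_fun setT (fun w => f (X w)) by exact: (measurableT_comp mf gX.1).
have mB : measurable [set w | 1 <= f (X w)].
  have -> : [set w | 1 <= f (X w)] = (fun w => f (X w)) @^-1` `[1, +oo[%classic.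
    by apply/seteqP; split=> w /=; rewrite in_itv/= andbT.
  by rewrite -[X in measurable X]setTI; apply: mfX.
have AE : [set w | f (X w) < 1] = ~` [set w | 1 <= f (X w)].
  by apply/seteqP; split=> w /=; [move=> h; apply/negP; rewrite -ltNge|move/negP; rewrite -ltNge].
have PB : (P [set w | (1 <= f (X w))%R] <= p%:E)%E.
  apply: le_trans Ef.
  have -> : P [set w | (1 <= f (X w))%R] = (\int[P]_w (\1_[set w | (1 <= f (X w))%R] w)%:E)%E.
    by rewrite integral_indic// setIT.
  apply: ge0_le_integral => //; [| |move=> w _].
  - by apply/measurable_EFinP; exact: measurable_indic.
  - exact/measurable_EFinP.
  - rewrite lee_fin indicE.
    by case: (boolP (w \in _)) => [/set_mem//|_]; exact: f0.
rewrite AE; split; first exact: measurableC.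
rewrite probability_setC// EFinB; apply: leeB => //.
Qed.

(** The exponent is positive exactly when 1/(H^-1)_jj lies below sg g / 8.  The rate
(e - 1) / sg makes 1 + t = e in EX_lower_tail. *)
Definition tail_term n (A : 'M[R]_(m, n)) (sg g eta : R) l j (x : cfg R I) : R :=
  expR ((expR 1 - 1) / sg * (sg * g / 8 - (invmx (ridge_gram A eta (Smat x l)) j j)^-1) / 2).

Lemma measurable_tail_term n (A : 'M[R]_(m, n)) (sg g eta : R) l j : 0 < eta ->
  measurable_fun setT (tail_term A sg g eta l j).
Proof.
move=> e0; apply: measurableT_comp => //; apply: measurable_funM => //.
apply: measurable_funM => //; apply: measurable_funB => //.
by apply: measurable_funV; exact: measurable_mx_inv_ridge.
Qed.

Lemma tail_term_lt1 n (A : 'M[R]_(m, n)) (sg g eta : R) l j x : 0 < eta -> 0 < sg -> 0 < g ->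
  tail_term A sg g eta l j x < 1 -> invmx (ridge_gram A eta (Smat x l)) j j <= (sg * g / 8)^-1.
Proof.
move=> e0 sg0 g0; rewrite /tail_term expR_lt1.
set q := invmx _ _ _; set r := sg * g / 8.
have r0 : 0 < r by rewrite /r divr_gt0// mulr_gt0.
have q0 : 0 < q by apply: pd_diag; apply: pd_inv; exact: pd_ridge_gram.
have t0 : 0 < (expR 1 - 1) / sg by rewrite divr_gt0//; have := expR1_ge2 R; lra.
rewrite pmulr_llt0 ?invr_gt0// pmulr_rlt0// subr_lt0 => h.
by rewrite -[leLHS]invrK lef_pV2 ?posrE ?invr_gt0// ltW.
Qed.

(** The exponent is (e - 1) g / 16 - k0 / 2 <= 3 g / 16 - g / 2. *)
Lemma EX_tail_term n (A : 'M[R]_(m, n)) (sg g eta : R) l j k0 :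
  0 < eta -> 0 < sg -> 0 <= g -> g <= k0%:R -> (k0 + s <= n.+1)%N ->
  (forall v, sg * dot v v <= dot (A *m v) (A *m v)) ->
  (E (fun x => (tail_term A sg g eta l j x)%:E) <= (expR (- (5 / 16 * g)))%:E)%E.
Proof.
move=> e0 sg0 g0 gk k0s hA.
have e2 := expR1_ge2 R; have e4 := expR1_le4 R.
have t0 : 0 <= expR 1 - 1 :> R by lra.
have := EX_lower_tail gX l j sg0 t0 e0 hA k0s.
set f := (X in EX P _ X) => hf.
have mf : measurable_fun setT f.
  apply/measurable_EFinP; apply: measurableT_comp => //.
  apply: measurable_funN; apply: measurable_funM => //; apply: measurable_funM => //.
  by apply: measurable_funV; exact: measurable_mx_inv_ridge.
have f0 x : (0 <= f x)%E by rewrite lee_fin expR_ge0.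
rewrite (_ : E _ = E (fun x => (expR ((expR 1 - 1) * g / 16))%:E * f x)%E); last first.
  apply: eq_EX => x; rewrite /f -EFinM -expRD; congr (expR _)%:E.
  by rewrite /ridge_gram; move: (invmx _ j j)^-1 => q; field; rewrite gt_eqF.
have kz (k : R) : E (fun x => (expR k)%:E * f x)%E = ((expR k)%:E * EX P X f)%E.
  by apply: (EXZ gX mf f0); rewrite lee_fin expR_ge0.
rewrite kz.
apply: (@le_trans _ _ ((expR ((expR 1 - 1) * g / 16))%:E * (expR (- (k0%:R / 2)))%:E)%E).
  rewrite lee_pmul2l//; last by rewrite lte_fin expR_gt0.
  apply: le_trans hf _; rewrite lee_fin [1 + _]addrC subrK -expRM_natl mulr1 sqrt_expR.
  by rewrite expRN.
rewrite -EFinM lee_fin -expRD ler_expR; nra.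
Qed.

Lemma EX_prod_shift (phi : 'I_N -> 'M[R]_(m, s) -> R) (a c : R) :
  (forall l, measurable_fun setT (fun x : cfg R I => phi l (Smat x l))) ->
  (forall l, (E (fun x => (expR (phi l (Smat x l)))%:E) <= (expR c)%:E)%E) ->
  (E (fun x => (expR (\sum_l phi l (Smat x l) + a))%:E) <= (expR (N%:R * c + a))%:E)%E.
Proof.
move=> mphi hphi.
have hp := EX_prod gX (phi := fun l S => expR (phi l S)) (expR_ge0 c)
   (fun l => measurableT_comp (@measurable_expR R) (mphi l)) (fun l S => expR_ge0 _) hphi.
set f := (X in EX P _ X) in hp.
have mf : measurable_fun setT f.
  by apply/measurable_EFinP; apply: measurable_prodR => l; exact: (measurableT_comp (@measurable_expR R) (mphi l)).
have f0 x : (0 <= f x)%E by rewrite lee_fin; apply: prodr_ge0 => l _; exact: expR_ge0.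
rewrite (_ : E _ = E (fun x => (expR a)%:E * f x)%E); last first.
  by apply: eq_EX => x; rewrite /f -EFinM -expR_sum -expRD addrC.
have kz (k : R) : E (fun x => (expR k)%:E * f x)%E = ((expR k)%:E * EX P X f)%E.
  by apply: (EXZ gX mf f0); rewrite lee_fin expR_ge0.
rewrite kz.
rewrite addrC expRD EFinM lee_pmul2l ?lte_fin ?expR_gt0//.
by apply: le_trans hp _; rewrite lee_fin -expRM_natl.
Qed.

(** sg = 1 and sg = -1 control the two signs of the average; 2/5 v is the allowed
deviation and 1/10 the Chernoff parameter, which gives 2 v / 100 - v / 25 = - v / 50
per matrix. *)
Definition offdiag_term (eta sg v : R) i j (x : cfg R I) : R :=
  expR (\sum_l (sg / 10) * ridge_proj eta (Smat x l) i j + - (N%:R * (2 / 5 * v) / 10)).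

Lemma EX_offdiag_term (eta sg : R) i j : 0 < eta -> sg = 1 \/ sg = -1 -> i != j ->
  (E (fun x => (offdiag_term eta sg (s%:R / (m%:R * (m%:R - 1))) i j x)%:E) <=
   (expR (- (N%:R * (s%:R / (m%:R * (m%:R - 1))) / 50)))%:E)%E.
Proof.
move=> e0 hsg ij; set v := s%:R / (m%:R * (m%:R - 1)).
apply: le_trans (EX_prod_shift (phi := fun l S => (sg / 10) * ridge_proj eta S i j)
   (c := 2 * (sg / 10) ^+ 2 * v) _ _ _) _.
- by move=> l; apply: measurable_funM => //; exact: measurable_ridge_proj.
- move=> l; apply: (EX_exp_offdiag gX l e0 ij).
  by case: hsg => ->; rewrite ler_norml; lra.
- rewrite lee_fin ler_expR; apply: le_of_eq.
  by case: hsg => ->; field.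
Qed.

(** The average of the diagonal entries is allowed to fall to half of the lower bound
mu of the mean; the Chernoff parameter 1/8 gives - 3 mu / 32 + mu / 16 per
matrix. *)
Definition diag_term (eta mu : R) i (x : cfg R I) : R :=
  expR (\sum_l - (ridge_proj eta (Smat x l) i i / 8) + N%:R * (mu / 2) / 8).

Lemma EX_diag_term (eta mu : R) i : 0 < eta ->
  (forall l, mu <= rmean P X (fun x => ridge_proj eta (Smat x l) i i)) ->
  (E (fun x => (diag_term eta mu i x)%:E) <= (expR (- (N%:R * mu / 32)))%:E)%E.
Proof.
move=> e0 hmu.
apply: le_trans (EX_prod_shift (phi := fun l S => - (ridge_proj eta S i i / 8))
   (c := - (3 / 32 * mu)) _ _ _) _.
- by move=> l; apply: measurable_funN; apply: measurable_funM => //; exact: measurable_ridge_proj.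
- by move=> l; exact: (EX_exp_diag gX e0 (hmu l)).
- by rewrite lee_fin ler_expR; apply: le_of_eq; field.
Qed.

(** 2^(N/2) <= exp(N/2) leaves the mean exp(- N/2). *)
Definition noise_term n (A : 'M[R]_(m, n)) (e : 'cV[R]_m) (eta kap : R) (x : cfg R I) : R :=
  expR (\sum_l kap * noise_qf A e eta kap (Smat x l) / 2 + - N%:R).

Lemma EX_noise_term n (A : 'M[R]_(m, n)) (e : 'cV[R]_m) (eta kap : R) (p : 'I_m) :
  0 < eta -> 0 <= kap -> A^T *m e = 0 ->
  (E (fun x => (noise_term A e eta kap x)%:E) <= (expR (- (N%:R / 2)))%:E)%E.
Proof.
move=> e0 k0 Ae.
have hp := EX_noise gX p e0 k0 Ae.
set f := (X in EX P _ X) in hp.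
have mf : measurable_fun setT f.
  apply/measurable_EFinP; apply: measurable_prodR => l; apply: measurableT_comp => //.
  by apply: measurable_funM => //; apply: measurable_funM => //; exact: measurable_noise_qf.
have f0 x : (0 <= f x)%E by rewrite lee_fin; apply: prodr_ge0 => l _; exact: expR_ge0.
rewrite (_ : E _ = E (fun x => (expR (- N%:R))%:E * f x)%E); last first.
  by apply: eq_EX => x; rewrite /f -EFinM -expR_sum -expRD addrC.
have kz (k : R) : E (fun x => (expR k)%:E * f x)%E = ((expR k)%:E * EX P X f)%E.
  by apply: (EXZ gX mf f0); rewrite lee_fin expR_ge0.
rewrite kz.
apply: (@le_trans _ _ ((expR (- N%:R))%:E * (expR (N%:R / 2))%:E)%E).
  rewrite lee_pmul2l ?lte_fin ?expR_gt0//; apply: le_trans hp _.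
  rewrite lee_fin expRM_natl lerXn2r ?nnegrE ?sqrtr_ge0 ?expR_ge0//.
  rewrite -[2^-1]mul1r -sqrt_expR ler_sqrt ?expR_gt0//; exact: expR1_ge2.
by rewrite -EFinM lee_fin -expRD ler_expR; lra.
Qed.

Lemma inv_ridge_diag_le1 (S : 'M[R]_(m, s)) (eta : R) j : 0 < eta ->
  eta * invmx (S^T *m S + eta%:M) j j <= 1.
Proof.
move=> e0; have pH := pd_ridge S e0; set H := S^T *m S + eta%:M in pH *.
have uH := pd_unit pH; have pHi := pd_inv pH.
set q := invmx H j j; have q0 : 0 < q by exact: pd_diag.
pose y : 'cV[R]_s := invmx H *m delta_mx j 0.
have yj : y j 0 = q by rewrite /y -colE mxE.
have Hy : H *m y = delta_mx j 0 by rewrite /y mulmxA mulmxV// mul1mx.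
have h1 : eta * dot y y <= q.
  rewrite -yj -[leRHS]dot_delta -Hy dotC /H mulmxDl dotDr mul_scalar_mx dotZr lerDr.
  by rewrite -mulmxA dot_mulr trmxK dot_ge0.
have h2 : q ^+ 2 <= dot y y.
  rewrite dotE (bigD1 j)//= yj -expr2 lerDl sumr_ge0// => i _.
  by rewrite -expr2 sqr_ge0.
rewrite -(ler_pM2l q0) mulr1 mulrCA -expr2; apply: le_trans h1.
by rewrite ler_wpM2l// ltW.
Qed.

(** The lower tail for A = 1: outside an event of probability at most exp(- 5) the entry
is at most 8/g, which the ridge g/160 turns into 1/20; on that event it is at
most 1. *)
Lemma EX_inv_small (g : R) l j k0 : 16 <= g -> g <= k0%:R -> (k0 + s <= m.+1)%N ->
  (E (fun x => (g / 160 * invmx ((Smat x l)^T *m Smat x l + (g / 160)%:M) j j)%:E) <= (10^-1)%:E)%E.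
Proof.
move=> g16 gk k0s; set eta := g / 160.
have g0 : 0 < g by lra.
have e0 : 0 < eta by rewrite /eta; lra.
have hA v : 1 * dot v v <= dot ((1%:M : 'M[R]_m) *m v) (1%:M *m v) by rewrite mul1r !mul1mx.
have ht := @EX_tail_term m 1%:M 1 g eta l j k0 e0 ltr01 (ltW g0) gk k0s hA.
have rE (x : cfg R I) : ridge_gram (1%:M : 'M[R]_m) eta (Smat x l) = (Smat x l)^T *m Smat x l + eta%:M.
  by rewrite /ridge_gram trmx1 mul1mx.
have mt : measurable_fun setT (fun x => (tail_term (1%:M : 'M[R]_m) 1 g eta l j x)%:E).
  by apply/measurable_EFinP; exact: measurable_tail_term.
have pt x : (0 <= (tail_term (1%:M : 'M[R]_m) 1 g eta l j x)%:E)%E by rewrite lee_fin expR_ge0.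
apply: (@le_trans _ _ (E (fun x => (tail_term (1%:M : 'M[R]_m) 1 g eta l j x)%:E + (20^-1)%:E))%E).
  apply: (le_EX gX).
  - apply/measurable_EFinP; apply: measurable_funM => //.
    have mG := @measurable_mx_inv_ridge R N m s m 1%:M eta l e0 j j.
    by apply: eq_measurable_fun mG => x _; rewrite rE.
  - by apply: emeasurable_funD.
  - move=> x; rewrite lee_fin mulr_ge0 ?(ltW e0)//.
    by apply: psd_diag; apply: pd_psd; apply: pd_inv; exact: pd_ridge.
  - move=> x; rewrite -EFinD lee_fin.
    have [h|h] := ltrP (tail_term (1%:M : 'M[R]_m) 1 g eta l j x) 1; last first.
      by have := inv_ridge_diag_le1 (Smat x l) j e0; lra.
    have := tail_term_lt1 e0 ltr01 g0 h; rewrite rE mul1r => hq.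
    have : eta * invmx ((Smat x l)^T *m Smat x l + eta%:M) j j <= eta * (g / 8)^-1.
      by rewrite ler_wpM2l// ltW.
    have -> : eta * (g / 8)^-1 = 20^-1 by rewrite /eta; field; rewrite gt_eqF.
    have h0 : 0 <= tail_term (1%:M : 'M[R]_m) 1 g eta l j x := expR_ge0 _.
    by lra.
rewrite (_ : E _ = E (fun x => (tail_term (1%:M : 'M[R]_m) 1 g eta l j x)%:E) + (20^-1)%:E)%E; last first.
  by rewrite [LHS](EXD gX mt pt)// [X in (_ + X)%E]EX_cst.
apply: (@le_trans _ _ ((expR (- (5 / 16 * g)))%:E + (20^-1)%:E)%E); first exact: leeD.
rewrite -EFinD lee_fin.
suff : expR (- (5 / 16 * g)) <= 32^-1 :> R by lra.
apply: (@le_trans _ _ (expR (- 5))); first by rewrite ler_expR; lra.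
rewrite expRN lef_pV2 ?posrE ?expR_gt0//.
have -> : (5 : R) = 5%:R * 1 by rewrite mulr1.
rewrite expRM_natl; have e2 := expR1_ge2 R.
have -> : 32 = 2 ^+ 5 :> R by ring.
by rewrite lerXn2r// ?nnegrE// ltW// expR_gt0.
Qed.

End Terms.

(** * The good event *)

Section MeanLe.
Variables (R : realType) (I : finType).
Context d (T : measurableType d) (P : probability T R) (X : T -> cfg R I).
Hypothesis gX : gaussian_law P X.

Definition mean_le (f : cfg R I -> R) (a : R) :=
  [/\ measurable_fun setT f, (forall x, 0 <= f x)
    & (EX P X (fun x => (f x)%:E) <= a%:E)%E].

Lemma mean_le0 : mean_le (fun=> 0) 0.
Proof. by split=> //; rewrite EX_cst. Qed.

Lemma mean_leD f g a b : mean_le f a -> mean_le g b -> mean_le (fun x => f x + g x) (a + b).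
Proof.
move=> [mf f0 fa] [mg g0 gb]; split.
- exact: measurable_funD.
- by move=> x; rewrite addr_ge0.
- rewrite EFinD; have := EXD gX (f := fun x => (f x)%:E) (g := fun x => (g x)%:E).
  move=> -> //; [exact: leeD|exact/measurable_EFinP|exact/measurable_EFinP].
Qed.

Lemma mean_le_sum (J : Type) (r : seq J) (F : J -> cfg R I -> R) (a : J -> R) :
  (forall j, mean_le (F j) (a j)) -> mean_le (fun x => \sum_(j <- r) F j x) (\sum_(j <- r) a j).
Proof.
move=> h; elim: r => [|j r IH].
  by under eq_fun do rewrite big_nil; rewrite big_nil; exact: mean_le0.
by under eq_fun do rewrite big_cons; rewrite big_cons; exact: mean_leD.
Qed.

End MeanLe.

Lemma sum_term_lt (R : realType) (J : finType) (F : J -> R) (a : R) j :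
  (forall j, 0 <= F j) -> \sum_j F j < a -> F j < a.
Proof.
move=> F0; apply: le_lt_trans; rewrite (bigD1 j)//= lerDl sumr_ge0//.
Qed.

Lemma sum_ord_cst (R : realType) (a : nat) (x : R) : \sum_(i < a) x = x * a%:R.
Proof. by rewrite sumr_const card_ord mulr_natr. Qed.

(** The lower-tail terms number N s <= N^2 <= exp(g / 8).  All the other terms are at
most m^(-c), because N >= 64 c m^2 ln m, and there are 2 m^2 + m + 1 <= m^3 of
them. *)
Lemma failure_bound (R : realType) (N m s : nat) (c g : R) :
  (3 <= m)%N -> (s <= N)%N -> 3 < c -> 0 <= g -> (0 < s)%N ->
  64 * c * m%:R ^+ 2 * ln m%:R <= N%:R -> N%:R <= expR (g / 16) ->
  \sum_(l < N) \sum_(j < s) expR (- (5 / 16 * g)) +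
  (\sum_(i < m) \sum_(j < m) (if i == j then 0 else
      expR (- (N%:R * (s%:R / (m%:R * (m%:R - 1))) / 50)) +
      expR (- (N%:R * (s%:R / (m%:R * (m%:R - 1))) / 50))) +
   (\sum_(i < m) expR (- (N%:R * (9 / 10 * (s%:R / m%:R)) / 32)) +
    expR (- (N%:R / 2)))) <=
  11 / 10 * powR m%:R (3 - c) + expR (- (g / 16)).
Proof.
move=> m3 sN c3 g0 s0 Nlow Nup.
have m0 : (0 < m)%N by rewrite (leq_trans _ m3).
have mR : 3 <= m%:R :> R by rewrite ler_nat.
have sR : 1 <= s%:R :> R by rewrite ler1n.
set L := ln m%:R : R.
have L2 : 2^-1 <= L by apply: ln_ge_half; rewrite (leq_trans _ m3).
have L0 : 0 < L by lra.
have cL : 0 < c * L by rewrite mulr_gt0//; lra.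
have NL : 64 * (c * L) * m%:R ^+ 2 <= N%:R by move: Nlow; rewrite -/L; lra.
set M : R := m%:R in mR NL *.
set t := expR (- (c * L)).
have t0 : 0 < t by exact: expR_gt0.
have tp : M ^+ 3 * t = powR m%:R (3 - c).
  rewrite /powR ifF; last by rewrite gt_eqF// ltr0n.
  have -> : M = expR L by rewrite lnK// posrE ltr0n.
  by rewrite -expRM_natl /t -expRD -/L; congr expR; ring.
have h1 : \sum_(l < N) \sum_(j < s) expR (- (5 / 16 * g)) <= expR (- (g / 16)).
  rewrite !sum_ord_cst -mulrA.
  apply: (@le_trans _ _ (expR (- (5 / 16 * g)) * (expR (g / 16) * expR (g / 16)))).
    rewrite ler_wpM2l ?expR_ge0// ler_pM//.
    by apply: le_trans Nup; rewrite ler_nat.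
  by rewrite -!expRD ler_expR; lra.
have M1 : 0 < M - 1 by lra.
have MM : 0 < M * (M - 1) by rewrite mulr_gt0//; lra.
have h2 : expR (- (N%:R * (s%:R / (M * (M - 1))) / 50)) <= t.
  rewrite ler_expR lerN2 mulrA -mulrA [_^-1 / _]mulrC mulrA -[_ / 50]mulr1.
  suff : 50 * (c * L) * (M * (M - 1)) <= N%:R * s%:R.
    move=> h; rewrite mulr1 -mulrA -invfM ler_pdivlMr ?mulr_gt0//; nra.
  apply: (@le_trans _ _ N%:R); last by rewrite ler_peMr.
  apply: le_trans NL; nra.
have h3 : expR (- (N%:R * (9 / 10 * (s%:R / M)) / 32)) <= t.
  rewrite ler_expR lerN2.
  have -> : N%:R * (9 / 10 * (s%:R / M)) / 32 = (N%:R * s%:R * 9 / 320) / M.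
    by field; rewrite gt_eqF//; lra.
  rewrite ler_pdivlMr; last by lra.
  have : 64 * (c * L) * M ^+ 2 <= N%:R * s%:R.
    by apply: le_trans NL _; rewrite ler_peMr.
  nra.
have h4 : expR (- (N%:R / 2)) <= t.
  by rewrite ler_expR lerN2; nra.
have g2 : \sum_(i < m) \sum_(j < m) (if i == j then 0 else
      expR (- (N%:R * (s%:R / (M * (M - 1))) / 50)) +
      expR (- (N%:R * (s%:R / (M * (M - 1))) / 50))) <= 2 * t * M ^+ 2.
  apply: (@le_trans _ _ (\sum_(i < m) \sum_(j < m) 2 * t)).
    apply: ler_sum => i _; apply: ler_sum => j _.
    by case: (i == j); lra.
  by rewrite !sum_ord_cst -/M expr2 !mulrA.
have g3 : \sum_(i < m) expR (- (N%:R * (9 / 10 * (s%:R / M)) / 32)) <= t * M.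
  apply: (@le_trans _ _ (\sum_(i < m) t)); first exact: ler_sum.
  by rewrite sum_ord_cst.
rewrite -tp.
have : 2 * t * M ^+ 2 + (t * M + t) <= M ^+ 3 * t.
  have -> : 2 * t * M ^+ 2 + (t * M + t) = (2 * M ^+ 2 + M + 1) * t by ring.
  rewrite ler_pM2r//; nra.
have : 0 <= M ^+ 3 * t by rewrite mulr_ge0 ?exprn_ge0//; lra.
lra.
Qed.

Theorem theorem2p5 (R : realType) :
  exists C : R, 0 < C /\
  forall (m n : nat) (A : 'M[R]_(m, n)) (b : 'cV[R]_m) (xs : 'cV[R]_n)
    (s N : nat) (c : R)
    (d : measure_display) (T : measurableType d) (P : probability T R)
    (G : 'I_N * 'I_m * 'I_s -> {RV P >-> R}),
  let e := A *m xs - b in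
  let gap := Num.sqrt n%:R - Num.sqrt s%:R in
  (n <= m)%N -> \rank A = n ->
  least_squares_sol A b xs ->
  (1 <= s < n)%N ->
  3 < c ->
  64 * c * m%:R ^+ 2 * ln m%:R <= N%:R ->
  N%:R <= expR (gap ^+ 2 / 16) ->
  gaussian_entries G ->
  with_prob_at_least P
    (1 - 11 / 10 * powR m%:R (3 - c) - expR (- (gap ^+ 2 / 16)))
    (fun w : T => forall (x0 : 'cV[R]_n) (k : nat),
      expect_choices (fun t : k.-tuple 'I_N =>
        l2norm (kaczmarz_iter A b (gaussian_collection G w) x0 t - xs) ^+ 2)
      <= (1 - s%:R / (36 * m%:R * kappa2 A)) ^+ k * l2norm (x0 - xs) ^+ 2
         + C * m%:R * kappa2 A / sigma_min A ^+ 2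
           * (l2norm e ^+ 2 / gap ^+ 2)).
Proof.
exists 2304; split; first by rewrite ltr0n.
move=> m n A b xs s N c d T P G e gap nm rA ls /andP[s0 sn] c3 Nlow Nup [ind std].
have gX := gaussian_law_entries ind std.
set X := (fun w => _) in gX.
set g := gap ^+ 2 in Nup *.
have n0 : (0 < n)%N by exact: leq_ltn_trans sn.
have m2 : (1 < m)%N by apply: leq_trans nm; apply: leq_trans sn; rewrite ltnS.
have m0 : (0 < m)%N by exact: ltnW.
have mR : 2 <= m%:R :> R by rewrite ler_nat.
have L2 : 2^-1 <= ln m%:R :> R by exact: ln_ge_half.
have N96 : 96 * m%:R ^+ 2 <= N%:R :> R.
  apply: le_trans Nlow.
  have h : 3 / 2 <= c * ln m%:R by nra.
  have h2 : 0 <= m%:R ^+ 2 :> R by rewrite exprn_ge0.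
  nra.
have sN : (s <= N)%N.
  apply: leq_trans (ltnW sn) _; apply: leq_trans nm _.
  by rewrite -(ler_nat R); apply: le_trans N96; nra.
have N0 : (0 < N)%N by exact: leq_trans sN.
(* A smaller gap would give N <= e <= 4, against N >= 96 m^2. *)
have g16 : 16 <= g.
  rewrite leNgt; apply/negP => gl.
  have : N%:R <= 4 :> R.
    apply: le_trans Nup _; apply: le_trans (expR1_le4 R).
    by rewrite ler_expR; lra.
  have : 4 <= m%:R ^+ 2 :> R by nra.
  lra.
have g0 : 0 < g by lra.
pose k0 := (n - s)%N.
(* (sqrt n - sqrt s)^2 <= (sqrt n - sqrt s) (sqrt n + sqrt s) = n - s *)
have gk : g <= k0%:R.
  have s0R : 0 <= s%:R :> R by rewrite ler0n.
  have n0R : 0 <= n%:R :> R by rewrite ler0n.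
  have snR : Num.sqrt s%:R <= Num.sqrt n%:R :> R by rewrite ler_sqrt// ler_nat ltnW.
  have sq : Num.sqrt s%:R ^+ 2 = s%:R :> R by rewrite sqr_sqrtr.
  have nq : Num.sqrt n%:R ^+ 2 = n%:R :> R by rewrite sqr_sqrtr.
  rewrite /k0 natrB; last exact: ltnW.
  rewrite -[leRHS](congr2 (fun x y => x - y) nq sq) /g /gap.
  move: snR (sqrtr_ge0 (s%:R : R)); move: (Num.sqrt n%:R) (Num.sqrt s%:R) => p q pq q0.
  nra.
have kn : (k0 + s <= n.+1)%N by rewrite /k0 subnK// ltnW.
have km : (k0 + s <= m.+1)%N by exact: leq_trans kn _.
have m3 : (3 <= m)%N.
  have h16 : 16 <= k0%:R :> R by exact: le_trans gk.
  rewrite (ler_nat R 16) in h16.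
  apply: leq_trans nm; apply: leq_trans (leq_subr s n); exact: leq_trans h16.
have smin0 : 0 < sigma_min A by exact: sigma_min_gt0.
have sg0 : 0 < sigma_min A ^+ 2 by rewrite exprn_gt0.
have hA := sigma_min_le A n0.
pose eta := ridge_param s A g.
pose kap := noise_scale s A b xs g.
pose eta1 := g / 160.
pose mu : R := 9 / 10 * (s%:R / m%:R).
pose v : R := s%:R / (m%:R * (m%:R - 1)).
have sR : 0 < s%:R :> R by rewrite ltr0n.
have rho0 : 0 < tail_level A g by rewrite /tail_level divr_gt0// mulr_gt0.
have eta0 : 0 < eta by rewrite /eta /ridge_param divr_gt0// mulr_gt0.
have eta10 : 0 < eta1 by rewrite /eta1; lra.
have kap0 : 0 <= kap by rewrite /kap /noise_scale divr_ge0 ?(ltW rho0)// !mulr_ge0 ?dot_ge0// ltW.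
have Ae : A^T *m e = 0 by exact: normal_equations.
(* Psi < 1 makes every summand less than 1, that is, every exponent negative. *)
pose Psi (x : cfg R ('I_N * 'I_m * 'I_s)%type) : R :=
  \sum_(l < N) \sum_(j < s) tail_term A (sigma_min A ^+ 2) g eta l j x +
  (\sum_(i < m) \sum_(j < m) (if i == j then 0 else offdiag_term eta1 1 v i j x + offdiag_term eta1 (-1) v i j x) +
  (\sum_(i < m) diag_term eta1 mu i x + noise_term A e eta kap x)).
have mulow l i : mu <= rmean P X (fun x => ridge_proj eta1 (Smat x l) i i).
  apply: le_trans (rmean_diag_ge gX (dl := 10^-1) eta10 i _).
    by apply: le_of_eq; rewrite /mu; congr (_ * _); field.
  by move=> j; exact: (EX_inv_small gX l j g16 gk km).
have okP : mean_le P X Psi (11 / 10 * powR m%:R (3 - c) + expR (- (g / 16))).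
  have [mP P0 EP] : mean_le P X Psi (\sum_(l < N) \sum_(j < s) expR (- (5 / 16 * g)) +
    (\sum_(i < m) \sum_(j < m) (if i == j then 0 else
        expR (- (N%:R * v / 50)) + expR (- (N%:R * v / 50))) +
     (\sum_(i < m) expR (- (N%:R * mu / 32)) + expR (- (N%:R / 2))))).
    have moff sg i j : measurable_fun setT (offdiag_term eta1 sg v i j :
       cfg R ('I_N * 'I_m * 'I_s)%type -> R).
      apply: measurableT_comp => //; apply: measurable_funD => //.
      by apply: measurable_sum => l; apply: measurable_funM => //; exact: measurable_ridge_proj.
    apply: (mean_leD gX); last apply: (mean_leD gX); last apply: (mean_leD gX).
    - apply: (mean_le_sum gX) => l; apply: (mean_le_sum gX) => j; split.
      + exact: measurable_tail_term.
      + by move=> x; exact: expR_ge0.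
      + exact: (EX_tail_term gX l j eta0 sg0 (ltW g0) gk kn hA).
    - apply: (mean_le_sum gX) => i; apply: (mean_le_sum gX) => j.
      have [ij|ij] := eqVneq i j; first exact: mean_le0.
      apply: (mean_leD gX); split=> //; try by move=> x; exact: expR_ge0.
      + by apply: (EX_offdiag_term gX eta10) => //; left.
      + by apply: (EX_offdiag_term gX eta10) => //; right.
    - apply: (mean_le_sum gX) => i; split; last exact: (EX_diag_term gX).
      + apply: measurableT_comp => //; apply: measurable_funD => //.
        apply: measurable_sum => l; apply: measurable_funN; apply: measurable_funM => //.
        exact: measurable_ridge_proj.
      + by move=> x; exact: expR_ge0.
    - split; last exact: (EX_noise_term gX (Ordinal m0)).
      + apply: measurableT_comp => //; apply: measurable_funD => //.
        apply: measurable_sum => l; apply: measurable_funM => //.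
        by apply: measurable_funM => //; exact: measurable_noise_qf.
      + by move=> x; exact: expR_ge0.
  split=> //; apply: le_trans EP _; rewrite lee_fin.
  by apply: failure_bound => //; exact: ltW.
case: okP => mP P0 EP.
have [mEv PEv] := markov_lt gX mP P0 EP.
exists [set w | Psi (X w) < 1]; split=> //.
  by apply: le_trans PEv; rewrite lee_fin; lra.
move=> w /= Pw.
have tl0 l j : 0 <= tail_term A (sigma_min A ^+ 2) g eta l j (X w) by exact: expR_ge0.
have of0 sg i j : 0 <= offdiag_term eta1 sg v i j (X w) by exact: expR_ge0.
have di0 i : 0 <= diag_term eta1 mu i (X w) by exact: expR_ge0.
have no0 : 0 <= noise_term A e eta kap (X w) by exact: expR_ge0.
have oo0 i j : 0 <= (if i == j then 0 else offdiag_term eta1 1 v i j (X w) + offdiag_term eta1 (-1) v i j (X w)).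
  by case: (i == j) => //; rewrite addr_ge0.
have s1 : 0 <= \sum_(l < N) \sum_(j < s) tail_term A (sigma_min A ^+ 2) g eta l j (X w).
  by apply: sumr_ge0 => l _; exact: sumr_ge0.
have s2 : 0 <= \sum_(i < m) \sum_(j < m) (if i == j then 0 else offdiag_term eta1 1 v i j (X w) + offdiag_term eta1 (-1) v i j (X w)).
  by apply: sumr_ge0 => l _; exact: sumr_ge0.
have s3 : 0 <= \sum_(i < m) diag_term eta1 mu i (X w) by exact: sumr_ge0.
rewrite /Psi in Pw.
have w1 : \sum_(l < N) \sum_(j < s) tail_term A (sigma_min A ^+ 2) g eta l j (X w) < 1 by lra.
have w2 : \sum_(i < m) \sum_(j < m) (if i == j then 0 else offdiag_term eta1 1 v i j (X w) + offdiag_term eta1 (-1) v i j (X w)) < 1 by lra.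
have w3 : \sum_(i < m) diag_term eta1 mu i (X w) < 1 by lra.
have w4 : noise_term A e eta kap (X w) < 1 by lra.
move=> x0 k.
refine (@kaczmarz_bound R m n s N A b xs (Smat (X w)) g eta1 nm rA s0 sn N0 g0 eta10 _ _ _ _ x0 k).
- move=> l j; apply: (tail_term_lt1 eta0 sg0 g0).
  apply: (sum_term_lt (F := fun j => tail_term A (sigma_min A ^+ 2) g eta l j (X w))) => //.
  apply: (sum_term_lt (F := fun l => \sum_(j < s) tail_term A (sigma_min A ^+ 2) g eta l j (X w))) => //.
  by move=> l'; exact: sumr_ge0.
- move: w4; rewrite /noise_term expR_lt1 -mulr_suml -mulr_sumr -/e -/eta -/kap; lra.
- move=> i; have := sum_term_lt i di0 w3; rewrite /diag_term expR_lt1.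
  rewrite sumrN -mulr_suml /mu; lra.
- move=> i j ij.
  have : offdiag_term eta1 1 v i j (X w) + offdiag_term eta1 (-1) v i j (X w) < 1.
    have := sum_term_lt i (fun i => sumr_ge0 _ (fun j _ => oo0 i j)) w2.
    by move=> /(sum_term_lt j (oo0 i)); rewrite (negbTE ij).
  move=> h; have h1 : offdiag_term eta1 1 v i j (X w) < 1.
    by apply: le_lt_trans h; rewrite lerDl.
  have h2 : offdiag_term eta1 (-1) v i j (X w) < 1.
    by apply: le_lt_trans h; rewrite lerDr.
  rewrite /offdiag_term expR_lt1 -mulr_sumr in h1; rewrite /offdiag_term expR_lt1 -mulr_sumr in h2.
  by rewrite ler_norml -/v; apply/andP; split; lra.
Qed.
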